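(* Let $n\ge3$, let $0<\beta_1,\dots,\beta_n\le\pi/2$ satisfy $\sum_{i=1}^n(\pi-\beta_i)>2\pi$, and let $w_1,\dots,w_n>0$ and $w_1',\dots,w_n'>0$. For small $t>0$ consider the hyperbolic prism with $n$-edged polygonal base, with dihedral angles $\beta_1,\dots,\beta_n$ at the vertical edges, $\alpha_i=\pi/2-w_it$ ($i=1,\dots,n$) at the horizontal edges of one of the two horizontal faces and $\alpha_i'=\pi/2-w_i't$ ($i=1,\dots,n$) at the corresponding horizontal edges of the other one. When $t\searrow0$ (with $\beta_1,\dots,\beta_n$ fixed), the prism converges to the $n$-edged hyperbolic polygon with angles $\beta_1,\dots,\beta_n$ of minimal $\mathcal W$-perimeter, where $\mathcal W=\{w_1+w_1',\dots,w_n+w_n'\}$.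
   Context: The prism is the hyperbolic polyhedron in $\mathbf H^3$ with the combinatorial type of a prism over an $n$-gon. Its edges are arranged so that, for each $i$ modulo $n$, the edges with dihedral angles $\alpha_i$, $\beta_i$, $\alpha_i'$ and $\beta_{i+1}$ bound a quadrilateral (lateral) face. By Andreev's theorem, such a polyhedron exists and is unique up to isometry for the given angles when $t>0$ is small. Convergence is Gromov–Hausdorff convergence. In the limit polygon the edge $e_i$ joins the vertices with angles $\beta_i$ and $\beta_{i+1}$, and the $\mathcal W$-perimeter is $\sum_i(w_i+w_i')|e_i|$, where $|e_i|$ is the length of $e_i$. There is a unique polygon with ordered angles $\beta_1,\dots,\beta_n$ minimizing the $\mathcal W$-perimeter. *)

(* Defs.v *)
From HB Require Import structures.
From mathcomp Require Import all_boot all_order all_algebra.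
From mathcomp Require Import all_classical all_reals all_analysis.
Import Order.TTheory GRing.Theory Num.Theory.
Import numFieldNormedType.Exports.

Set Implicit Arguments.
Unset Strict Implicit.
Unset Printing Implicit Defensive.

Local Open Scope classical_set_scope.
Local Open Scope ring_scope.

(** * Hyperbolic space: the hyperboloid model *)

Definition mink (R : realType) (d : nat) (x y : 'rV[R]_d.+1) : R :=
  - (x 0 0 * y 0 0) + \sum_(i < d) x 0 (lift ord0 i) * y 0 (lift ord0 i).

Definition hyp (R : realType) (d : nat) : set 'rV[R]_d.+1 :=
  [set x | mink x x = -1 /\ 0 < x 0 0].

Definition arcosh (R : realType) (x : R) : R := ln (x + Num.sqrt (x ^+ 2 - 1)).

Definition hdist (R : realType) (d : nat) (x y : 'rV[R]_d.+1) : R :=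
  arcosh (- mink x y).

(** * Compact convex polytopes in hyperbolic [d]-space *)

(* A unit spacelike vector [u] represents the half-space [mink u x <= 0], of
   which it is the outward unit normal along the hyperplane [mink u x = 0]. *)
Definition halfspaces (R : realType) (d : nat) (F : finType)
    (u : F -> 'rV[R]_d.+1) : set 'rV[R]_d.+1 :=
  [set x | hyp x /\ forall f, mink (u f) x <= 0].

(* Central projection to the Klein model takes hyperbolic convex hulls to
   Euclidean ones, so the hull of points of [hyp] is the trace on [hyp] of the
   cone that they span. *)
Definition hull (R : realType) (d : nat) (V : finType)
    (p : V -> 'rV[R]_d.+1) : set 'rV[R]_d.+1 :=
  [set x | hyp x /\
    exists2 c : V -> R, (forall v, 0 <= c v) & x = \sum_v c v *: p v].

(* The facets are labelled by [F] and the vertices by [V]. The combinatorial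
   type is prescribed by the vertex-facet incidences, which determine the
   face lattice of a polytope. *)
Record polytope (R : realType) (d : nat) (F V : finType)
    (inc : F -> V -> bool) := Polytope {
  normal : F -> 'rV[R]_d.+1 ;
  vertex : V -> 'rV[R]_d.+1 ;
  normal_unit : forall f, mink (normal f) (normal f) = 1 ;
  vertex_hyp : forall v, hyp (vertex v) ;
  halfspaces_hull : halfspaces normal = hull vertex ;
  incidence : forall f v, mink (normal f) (vertex v) = 0 <-> inc f v
}.

Definition body (R : realType) (d : nat) (F V : finType)
    (inc : F -> V -> bool) (P : polytope R d inc) : set 'rV[R]_d.+1 :=
  halfspaces (normal P).

(* Interior angle between two adjacent facets: [pi] minus the angle between
   their outward normals. For [d = 2] this is the angle of a polygon at the
   common vertex of two consecutive edges. *)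
Definition dihedral (R : realType) (d : nat) (F V : finType)
    (inc : F -> V -> bool) (P : polytope R d inc) (f g : F) : R :=
  pi - acos (mink (normal P f) (normal P g)).

(** * Polygons and prisms; indices are cyclic, [ordS i] being [i + 1 mod n] *)

(* The edge [i] joins the vertices [i] and [i + 1]. *)
Definition polygon_inc (n : nat) (i j : 'I_n) : bool :=
  (j == i) || (j == ordS i).

Definition polygon (R : realType) (n : nat) := polytope R 2 (@polygon_inc n).

Definition polygon_angles (R : realType) (n : nat) (beta : 'I_n -> R)
    (Q : polygon R n) : Prop :=
  forall i, dihedral Q i (ordS i) = beta (ordS i).

Definition perimeter (R : realType) (n : nat) (W : 'I_n -> R)
    (Q : polygon R n) : R :=
  \sum_(i < n) W i * hdist (vertex Q i) (vertex Q (ordS i)).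

Definition min_perimeter_polygon (R : realType) (n : nat)
    (W beta : 'I_n -> R) (Q : polygon R n) : Prop :=
  polygon_angles beta Q /\
  forall Q' : polygon R n, polygon_angles beta Q' ->
    perimeter W Q <= perimeter W Q'.

(* The facets are the two horizontal ones [inl true], [inl false] and the
   lateral ones [inr i]; [(b, j)] is the end on [inl b] of the vertical edge
   [j], and the vertical edges of the facet [inr i] are [i] and [i + 1]. *)
Definition prism_inc (n : nat) (f : (bool + 'I_n)%type)
    (v : (bool * 'I_n)%type) : bool :=
  match f with
  | inl b => v.1 == b
  | inr i => polygon_inc i v.2
  end.

Definition prism (R : realType) (n : nat) := polytope R 3 (@prism_inc n).

Definition prism_angles (R : realType) (n : nat) (alpha alpha' beta : 'I_n -> R)
    (P : prism R n) : Prop :=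
  [/\ forall i, dihedral P (inl true) (inr i) = alpha i,
      forall i, dihedral P (inl false) (inr i) = alpha' i
    & forall i, dihedral P (inr i) (inr (ordS i)) = beta (ordS i)].

(** * Gromov-Hausdorff distance *)

Definition hausdorff_dist (R : realType) (Z : metricType R) (A B : set Z)
    : \bar R :=
  ereal_inf [set r%:E | r in [set r : R | [/\ 0 < r,
    forall a, A a -> exists2 b, B b & mdist a b < r
    & forall b, B b -> exists2 a, A a & mdist a b < r]]].

Definition isometric_on (R : realType) (S : Type) (dS : S -> S -> R)
    (A : set S) (Z : metricType R) (f : S -> Z) : Prop :=
  forall x y, A x -> A y -> mdist (f x) (f y) = dS x y.

(* Gromov-Hausdorff distance between the subset [A] with the metric [dS] and
   the subset [B] with the metric [dT]. *)
Definition gh_dist (R : realType) (S T : Type) (dS : S -> S -> R) (A : set S)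
    (dT : T -> T -> R) (B : set T) : \bar R :=
  ereal_inf [set r | exists (Z : metricType R) (f : S -> Z) (g : T -> Z),
    [/\ isometric_on dS A f, isometric_on dT B g
      & r = hausdorff_dist (f @` A) (g @` B)]].

(* Main.v *)
(** Let [u+], [u-] be the normals of the horizontal faces of the prism and
    [u_i] those of the lateral ones. As [u+] and [u-] are ultraparallel, [u+ + u-]
    is timelike: it is [eta] times a point [p], with [eta = 2 sinh (h / 2)] and
    [h] the height of the prism. Since
    [<u+ + u-, u_i> = - (sin (w_i t) + sin (w'_i t))], the hyperbolic sine of the
    distance from [p] to the [i]-th lateral plane is about [(t / eta) W_i].

    The first variation of the W-perimeter of polygons with fixed angles gives the
    same for the minimal polygon: the relations between infinitesimal changes of
    the edge lengths are those between the normals [v_i], so [W_i = <q, v_i>] for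
    some [q]; then [-q] is timelike and proportional to a point at distances
    from the edges with hyperbolic sines [l W_i].

    Projecting the lateral normals orthogonally to [p] (and to the direction of
    the common perpendicular) gives planar vectors turning once around, whose
    consecutive angles are explicit functions of [eta] and [t], respectively of
    [l]. That they sum to [2 pi] determines [l], because the limit angles are
    strictly decreasing in the scale, and forces [t / eta] to converge to [l].
    The normals, hence the vertices, of the prism then converge, in a frame
    adapted to [p], to those of the polygon, and so do the convex hulls. *)
Require Import Defs.
From HB Require Import structures.
From mathcomp Require Import all_boot all_order all_algebra.
From mathcomp Require Import all_classical all_reals all_analysis.
From mathcomp Require Import ring lra.
Import Order.TTheory GRing.Theory Num.Theory.
Import numFieldNormedType.Exports.

Set Implicit Arguments.
Unset Strict Implicit.
Unset Printing Implicit Defensive.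

Local Open Scope classical_set_scope.
Local Open Scope ring_scope.

(** * Minkowski space and the metric of the hyperboloid *)

(** The obstacle is the height of the prism, on which the angles give no direct bound: a priori
    [t / eta] might tend to 0 or to infinity. No compactness is used. The components [tau] are split
    into the unknown scale [t / eta] and a factor with known limit, and the cosines are compared
    with those of the polygon uniformly in the scale, so that monotonicity alone pins it down;
    monotonicity rests on the cosines of the [beta i] being nonnegative.

    That the turning is exactly [2 pi], and no larger multiple, is convexity: modulo the plane of
    [p] and the perpendicular direction, no lateral normal is a nonnegative combination of two
    consecutive others. The polygon is put into 3-space as a prism of height zero, so that one
    normal form, with vertices explicit in a few parameters, serves both bodies.

    The critical equation needs deformations with fixed angles: of four consecutive lines, the
    middle two slide along the outer two. Each deformation relates four weights, which is enough to
    propagate [q] from three edges to all. *)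

Lemma sum_cauchy_schwarz (R : realFieldType) (I : finType) (a b : I -> R) :
  (\sum_i a i * b i) ^+ 2 <= (\sum_i a i ^+ 2) * (\sum_i b i ^+ 2).
Proof.
set A := \sum_i a i ^+ 2; set B := \sum_i b i ^+ 2; set C := \sum_i _.
have A0 : 0 <= A by apply: sumr_ge0 => i _; rewrite sqr_ge0.
have H : 0 <= A * (A * B - C ^+ 2).
  have -> : A * (A * B - C ^+ 2) = \sum_i (A * b i - C * a i) ^+ 2.
    have -> : \sum_i (A * b i - C * a i) ^+ 2 =
        \sum_i (A ^+ 2 * b i ^+ 2 - 2 * A * C * (a i * b i) + C ^+ 2 * a i ^+ 2).
      by apply: eq_bigr => i _; ring.
    rewrite big_split /= sumrB -!mulr_sumr -/A -/B -/C; ring.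
  by apply: sumr_ge0 => i _; rewrite sqr_ge0.
have [A00|Ane] := eqVneq A 0; last first.
  have Ap : 0 < A by rewrite lt_neqAle eq_sym Ane.
  by move: H; rewrite pmulr_rge0 // subr_ge0.
suff -> : C = 0 by rewrite A00 mul0r expr0n.
have a0 i : a i = 0.
  move/eqP: A00; rewrite psumr_eq0 => [|j _]; last exact: sqr_ge0.
  by move/allP/(_ i (mem_index_enum i)); rewrite sqrf_eq0 => /eqP.
by rewrite /C big1 // => i _; rewrite a0 mul0r.
Qed.

Section minkowski.
Context {R : realType} {d : nat}.
Implicit Types (x y z p : 'rV[R]_d.+1) (a b c : R).

Lemma minkC x y : mink x y = mink y x.
Proof. by rewrite /mink mulrC; congr (_ + _); apply: eq_bigr => i _; rewrite mulrC. Qed.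

Lemma minkDl x y z : mink (x + y) z = mink x z + mink y z.
Proof.
rewrite /mink !mxE mulrDl opprD addrACA -big_split /=; congr (_ + _).
by apply: eq_bigr => i _; rewrite !mxE mulrDl.
Qed.

Lemma minkZl a x y : mink (a *: x) y = a * mink x y.
Proof.
rewrite /mink mxE mulrDr mulr_sumr; congr (_ + _); first by ring.
by apply: eq_bigr => i _; rewrite !mxE mulrA.
Qed.

Lemma minkDr x y z : mink x (y + z) = mink x y + mink x z.
Proof. by rewrite minkC minkDl !(minkC _ x). Qed.

Lemma minkZr a x y : mink x (a *: y) = a * mink x y.
Proof. by rewrite minkC minkZl minkC. Qed.

Lemma minkNl x y : mink (- x) y = - mink x y.
Proof. by rewrite -scaleN1r minkZl mulN1r. Qed.

Lemma minkNr x y : mink x (- y) = - mink x y.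
Proof. by rewrite minkC minkNl minkC. Qed.

Lemma minkBl x y z : mink (x - y) z = mink x z - mink y z.
Proof. by rewrite minkDl minkNl. Qed.

Lemma minkBr x y z : mink x (y - z) = mink x y - mink x z.
Proof. by rewrite minkDr minkNr. Qed.

Lemma mink0l x : mink 0 x = 0.
Proof. by rewrite -(scale0r (0 : 'rV[R]_d.+1)) minkZl mul0r. Qed.

Lemma mink0r x : mink x 0 = 0.
Proof. by rewrite minkC mink0l. Qed.

Lemma mink_suml (I : finType) (f : I -> 'rV[R]_d.+1) y :
  mink (\sum_i f i) y = \sum_i mink (f i) y.
Proof.
elim/big_ind2 : _ => [|a b u v <- <-|//]; first exact: mink0l.
by rewrite minkDl.
Qed.

Lemma mink_sumr (I : finType) (f : I -> 'rV[R]_d.+1) y :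
  mink y (\sum_i f i) = \sum_i mink y (f i).
Proof. by rewrite minkC mink_suml; apply: eq_bigr => i _; rewrite minkC. Qed.

Definition minkE := (minkDl, minkDr, minkBl, minkBr, minkNl, minkNr, minkZl, minkZr).

(** Cauchy-Schwarz on the spatial parts bounds [p0^2 x0^2] by [(p0^2 - 1) X], with [X] the squared
    spatial norm of [x], so the time component of [x] cannot dominate. The equality case is recorded
    because it later identifies points and directions. *)
Lemma mink_orth_ge0 p x : mink p p = -1 -> mink p x = 0 -> 0 <= mink x x ?= iff (x == 0).
Proof.
rewrite /mink => pp px.
have CS := sum_cauchy_schwarz (fun i : 'I_d => p 0 (lift ord0 i)) (fun i : 'I_d => x 0 (lift ord0 i)).
set X := \sum_i x 0 (lift ord0 i) * _; have XE : X = \sum_(i < d) x 0 (lift ord0 i) ^+ 2.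
  by apply: eq_bigr => i _; rewrite expr2.
have PE : \sum_(i < d) p 0 (lift ord0 i) ^+ 2 = p 0 0 ^+ 2 - 1.
  under eq_bigr do rewrite expr2.
  by move: pp; set S := \sum_i _; lra.
have sx : \sum_(i < d) p 0 (lift ord0 i) * x 0 (lift ord0 i) = p 0 0 * x 0 0 by move: px; lra.
have X0 : 0 <= X by rewrite XE; apply: sumr_ge0 => i _; exact: sqr_ge0.
rewrite PE sx -XE in CS.
have ge : 0 <= - (x 0 0 * x 0 0) + X.
  rewrite leNgt; apply/negP => lt.
  have p2 : 1 <= p 0 0 ^+ 2.
    by rewrite -subr_ge0 -PE; apply: sumr_ge0 => i _; exact: sqr_ge0.
  have : p 0 0 ^+ 2 * X < p 0 0 ^+ 2 * (x 0 0) ^+ 2.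
    by rewrite ltr_pM2l ?(lt_le_trans ltr01) // expr2; lra.
  rewrite -exprMn; move: CS; nra.
split=> //; apply/eqP/eqP => [e|x0]; last first.
  by rewrite -[RHS]/(mink x x) x0 mink0l.
have x2 : X = x 0 0 ^+ 2 by rewrite expr2; lra.
have X00 : X = 0.
  rewrite exprMn -x2 in CS; move: CS.
  have -> : (p 0 0 ^+ 2 - 1) * X = p 0 0 ^+ 2 * X - X by ring.
  by lra.
apply/rowP => j; rewrite mxE.
have [->|[i ->]] : j = ord0 \/ exists i, j = lift ord0 i.
  by case: (unliftP ord0 j) => [i ->|->]; [right; exists i|left].
  by apply/eqP; rewrite -sqrf_eq0 -x2 X00.
move/eqP: X00; rewrite XE psumr_eq0 => [|k _]; last exact: sqr_ge0.
by move/allP/(_ i (mem_index_enum i)); rewrite sqrf_eq0 => /eqP.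
Qed.

Lemma mink_orth_cauchy_schwarz p x y : mink p p = -1 -> mink p x = 0 -> mink p y = 0 ->
  mink x y ^+ 2 <= mink x x * mink y y.
Proof.
move=> pp px py.
have [A0 Aiff] := mink_orth_ge0 pp px.
have [/eqP x0|xn0] := boolP (x == 0); first by rewrite x0 !mink0l expr0n mul0r.
have Ap : 0 < mink x x by rewrite lt_neqAle A0 andbT Aiff.
have : mink p (mink x x *: y - mink x y *: x) = 0 by rewrite !minkE px py !mulr0 subrr.
move/(mink_orth_ge0 pp) => [+ _].
have -> : mink (mink x x *: y - mink x y *: x) (mink x x *: y - mink x y *: x) =
    mink x x * (mink x x * mink y y - mink x y ^+ 2) by rewrite !minkE (minkC y x); ring.
by rewrite pmulr_rge0 // subr_ge0.
Qed.

(** Projecting [x] orthogonally to [y] only gives [mink x y ^+ 2 >= 1]; the sign comes from the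
    positive time components, through Cauchy-Schwarz on the spatial parts. *)
Lemma hyp_mink_ge1 x y : hyp x -> hyp y -> 1 <= - mink x y.
Proof.
move=> [xx x0] [yy y0].
have H : mink y (x + mink x y *: y) = 0 by rewrite !minkE yy (minkC y x); ring.
have [+ _] := mink_orth_ge0 yy H; rewrite !minkE xx yy (minkC y x) => ge.
have : 1 <= mink x y ^+ 2 by rewrite expr2; lra.
suff xy : mink x y <= 0 by nra.
rewrite /mink addrC subr_le0.
have CS := sum_cauchy_schwarz (fun i : 'I_d => x 0 (lift ord0 i)) (fun i : 'I_d => y 0 (lift ord0 i)).
have E z : mink z z = -1 -> \sum_(i < d) z 0 (lift ord0 i) ^+ 2 = z 0 0 ^+ 2 - 1.
  rewrite /mink; under eq_bigr do rewrite -expr2.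
  by set S := \sum_i _; rewrite expr2; lra.
rewrite (E x) // (E y) // in CS.
have xy0 : 0 <= x 0 0 * y 0 0 by rewrite mulr_ge0 // ltW.
apply: (le_trans (ler_norm _)).
rewrite -(ler_pXn2r (ltn0Sn 1)) ?nnegrE ?normr_ge0 // real_normK ?num_real //.
apply: (le_trans CS).
have : 0 <= \sum_(i < d) y 0 (lift ord0 i) ^+ 2 by apply: sumr_ge0 => i _; exact: sqr_ge0.
have : 0 <= \sum_(i < d) x 0 (lift ord0 i) ^+ 2 by apply: sumr_ge0 => i _; exact: sqr_ge0.
rewrite (E x) // (E y) // exprMn; nra.
Qed.

Lemma hyp_eq x y : hyp x -> hyp y -> - mink x y = 1 -> x = y.
Proof.
move=> [xx _] [yy _] xy; apply/eqP; rewrite -subr_eq0.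
have xy1 : mink x y = -1 by lra.
have H : mink y (x - y) = 0 by rewrite !minkE yy (minkC y x) xy1; ring.
have [_ <-] := mink_orth_ge0 yy H; apply/eqP.
by rewrite !minkE xx yy (minkC y x) xy1; ring.
Qed.

End minkowski.

Lemma arcosh_exp_ge1 {R : realType} (x : R) : 1 <= x -> 1 <= x + Num.sqrt (x ^+ 2 - 1).
Proof. by move=> x1; rewrite (le_trans x1) // lerDl sqrtr_ge0. Qed.

Lemma arcosh1 {R : realType} : arcosh (1 : R) = 0.
Proof. by rewrite /arcosh expr1n subrr sqrtr0 addr0 ln1. Qed.

Lemma le_arcosh {R : realType} (x y : R) : 1 <= x -> x <= y -> arcosh x <= arcosh y.
Proof.
move=> x1 xy; have y1 := le_trans x1 xy.
rewrite /arcosh ler_ln ?posrE ?(lt_le_trans ltr01) ?arcosh_exp_ge1 //.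
apply: lerD => //; apply: ler_wsqrtr; rewrite lerD2r; nra.
Qed.

Lemma arcosh_eq0 {R : realType} (x : R) : 1 <= x -> arcosh x = 0 -> x = 1.
Proof.
move=> x1 /eqP; rewrite ln_eq0 ?(lt_le_trans ltr01) ?arcosh_exp_ge1 // => /eqP.
have := sqrtr_ge0 (x ^+ 2 - 1); lra.
Qed.

(** The bound on [c] is the addition formula for the hyperbolic cosine, applied to [arcosh a] and
    [arcosh b]. *)
Lemma arcosh_le_add {R : realType} (a b c : R) : 1 <= a -> 1 <= b -> 1 <= c ->
  c <= a * b + Num.sqrt (a ^+ 2 - 1) * Num.sqrt (b ^+ 2 - 1) -> arcosh c <= arcosh a + arcosh b.
Proof.
move=> a1 b1 c1 cab.
set s := Num.sqrt (a ^+ 2 - 1) in cab *; set r := Num.sqrt (b ^+ 2 - 1) in cab *.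
have s0 : 0 <= s by exact: sqrtr_ge0.
have r0 : 0 <= r by exact: sqrtr_ge0.
have s2 : s ^+ 2 = a ^+ 2 - 1 by rewrite sqr_sqrtr // subr_ge0; nra.
have r2 : r ^+ 2 = b ^+ 2 - 1 by rewrite sqr_sqrtr // subr_ge0; nra.
have -> : arcosh a + arcosh b = arcosh (a * b + s * r).
  rewrite /arcosh -lnM ?posrE ?(lt_le_trans ltr01) ?arcosh_exp_ge1 //; congr ln.
  have -> : (a * b + s * r) ^+ 2 - 1 = (a * r + b * s) ^+ 2.
    have -> : (a * b + s * r) ^+ 2 = a ^+ 2 * b ^+ 2 + 2 * a * b * s * r + s ^+ 2 * r ^+ 2 by ring.
    have -> : (a * r + b * s) ^+ 2 = a ^+ 2 * r ^+ 2 + 2 * a * b * s * r + b ^+ 2 * s ^+ 2 by ring.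
    by rewrite s2 r2; ring.
  rewrite sqrtr_sqr ger0_norm -/s -/r; last by rewrite addr_ge0 // mulr_ge0 // (le_trans ler01).
  by ring.
exact: le_arcosh.
Qed.

Section hdist_metric.
Context {R : realType} {d : nat}.
Implicit Types (x y z : 'rV[R]_d.+1).

Lemma hdistxx x : hyp x -> hdist x x = 0.
Proof. by move=> [xx _]; rewrite /hdist xx opprK arcosh1. Qed.

Lemma hdistC x y : hdist x y = hdist y x.
Proof. by rewrite /hdist minkC. Qed.

Lemma hdist_eq0 x y : hyp x -> hyp y -> hdist x y = 0 -> x = y.
Proof. by move=> hx hy /(arcosh_eq0 (hyp_mink_ge1 hx hy)); exact: hyp_eq. Qed.

(** The law of cosines at [y]: the components of [x] and [z] orthogonal to [y] lie in a positive
    definite space, where Cauchy-Schwarz bounds the cosine of the angle. *)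
Lemma hdist_triangle y x z : hyp x -> hyp y -> hyp z ->
  hdist x z <= hdist x y + hdist y z.
Proof.
move=> hx hy hz; apply: arcosh_le_add; rewrite ?hyp_mink_ge1 //.
have xy1 := hyp_mink_ge1 hx hy; have yz1 := hyp_mink_ge1 hy hz.
case: hx hy hz => [xx _] [yy _] [zz _].
have H u : mink y (u + mink u y *: y) = 0 by rewrite !minkE yy (minkC y u); ring.
have := mink_orth_cauchy_schwarz yy (H x) (H z).
rewrite !minkE xx yy zz !(minkC y) (minkC z y) !sqrrN -sqrtrM; last by nra.
set a := mink x y; set b := mink y z; set c := mink x z => CS.
have E : (c + b * a + (a * b + a * (b * -1))) = c + a * b by ring.
rewrite E in CS.
have {CS} : (c + a * b) ^+ 2 <= (a ^+ 2 - 1) * (b ^+ 2 - 1) by move: CS; congr (_ <= _); ring.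
move=> CS.
have : - (c + a * b) <= Num.sqrt ((a ^+ 2 - 1) * (b ^+ 2 - 1)).
  apply: (le_trans (ler_norm _)); rewrite normrN -sqrtr_sqr; exact: ler_wsqrtr.
lra.
Qed.

End hdist_metric.

(* The spatial coordinates identify hyperbolic space with a copy of ['rV_d]. *)
Definition hspace (R : realType) (d : nat) : Type := 'rV[R]_d.

HB.instance Definition _ (R : realType) (d : nat) := Choice.on (hspace R d).

Definition of_hspace (R : realType) (d : nat) (y : hspace R d) : 'rV[R]_d.+1 :=
  \row_j (if unlift ord0 j is Some i then (y : 'rV[R]_d) 0 i
          else Num.sqrt (1 + \sum_i (y : 'rV[R]_d) 0 i ^+ 2)).

Definition to_hspace (R : realType) (d : nat) (x : 'rV[R]_d.+1) : hspace R d :=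
  \row_i x 0 (lift ord0 i).

Section hspace_metric.
Context {R : realType} {d : nat}.

Lemma of_hspaceK : cancel (@of_hspace R d) (@to_hspace R d).
Proof. by move=> y; apply/rowP => i; rewrite !mxE liftK. Qed.

Lemma hyp_of_hspace (y : hspace R d) : hyp (of_hspace y).
Proof.
have S0 : 0 <= \sum_i (y : 'rV[R]_d) 0 i ^+ 2 by apply: sumr_ge0 => i _; exact: sqr_ge0.
split; last by rewrite mxE unlift_none sqrtr_gt0; lra.
have -> : mink (of_hspace y) (of_hspace y) =
    - of_hspace y 0 0 ^+ 2 + \sum_i (y : 'rV[R]_d) 0 i ^+ 2.
  by rewrite /mink; congr (_ + _); apply: eq_bigr => i _; rewrite !mxE liftK.
by rewrite mxE unlift_none sqr_sqrtr; lra.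
Qed.

Lemma to_hspaceK (x : 'rV[R]_d.+1) : hyp x -> of_hspace (to_hspace x) = x.
Proof.
move=> [xx x0]; apply/rowP => j; rewrite mxE.
case: unliftP => [i ->|->]; first by rewrite mxE.
under eq_bigr do rewrite !mxE expr2.
move: xx; rewrite /mink => xx.
have -> : 1 + \sum_(i < d) x 0 (lift ord0 i) * x 0 (lift ord0 i) = x 0 0 ^+ 2.
  by rewrite expr2; lra.
by rewrite sqrtr_sqr gtr0_norm.
Qed.

Definition hspace_dist (x y : hspace R d) : R := hdist (of_hspace x) (of_hspace y).

Fact hspace_distxx x : hspace_dist x x = 0.
Proof. by apply: hdistxx; exact: hyp_of_hspace. Qed.

Fact hspace_dist_eq0 x y : hspace_dist x y = 0 -> x = y.
Proof.
move/(hdist_eq0 (hyp_of_hspace x) (hyp_of_hspace y)) => xy.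
by rewrite -(of_hspaceK x) xy of_hspaceK.
Qed.

Fact hspace_distC x y : hspace_dist x y = hspace_dist y x.
Proof. exact: hdistC. Qed.

Fact hspace_dist_triangle y x z : hspace_dist x z <= hspace_dist x y + hspace_dist y z.
Proof. by apply: hdist_triangle; exact: hyp_of_hspace. Qed.

HB.instance Definition _ := isMetric.Build R (hspace R d)
  hspace_distxx hspace_dist_eq0 hspace_distC hspace_dist_triangle.

End hspace_metric.

Lemma mdist_to_hspace (R : realType) (d : nat) (x y : 'rV[R]_d.+1) : hyp x -> hyp y ->
  mdist (to_hspace x) (to_hspace y) = hdist x y.
Proof. by move=> hx hy; rewrite /mdist /= /hspace_dist !to_hspaceK. Qed.

(** * Gromov-Hausdorff bounds from a common hyperbolic space *)

Lemma gh_dist_ge0 (R : realType) (S T : Type) (dS : S -> S -> R) (A : set S)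
    (dT : T -> T -> R) (B : set T) : (0 <= gh_dist dS A dT B)%E.
Proof.
apply: le_ereal_inf_tmp => _ [Z [f [g [_ _ ->]]]].
by apply: le_ereal_inf_tmp => _ [r [r0 _ _] <-]; rewrite lee_fin ltW.
Qed.

(** Distances depend only on [mink], so maps preserving it are isometric into the metric space
    [hspace R d], even from hyperbolic spaces of different dimensions. *)
Lemma gh_dist_le_hausdorff (R : realType) (d1 d2 d : nat)
    (A : set 'rV[R]_d1.+1) (B : set 'rV[R]_d2.+1)
    (F : 'rV[R]_d1.+1 -> 'rV[R]_d.+1) (G : 'rV[R]_d2.+1 -> 'rV[R]_d.+1) (r : R) :
  0 < r ->
  (forall x, A x -> hyp (F x)) -> (forall x, B x -> hyp (G x)) ->
  (forall x y, mink (F x) (F y) = mink x y) ->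
  (forall x y, mink (G x) (G y) = mink x y) ->
  (forall a, A a -> exists2 b, B b & hdist (F a) (G b) < r) ->
  (forall b, B b -> exists2 a, A a & hdist (F a) (G b) < r) ->
  (gh_dist (@hdist R d1) A (@hdist R d2) B <= r%:E)%E.
Proof.
move=> r0 hF hG FF GG AB BA.
apply: (@le_trans _ _ (hausdorff_dist ((fun x => to_hspace (F x)) @` A) ((fun x => to_hspace (G x)) @` B))).
  apply: ereal_inf_lbound; exists (hspace R d), (fun x => to_hspace (F x)), (fun x => to_hspace (G x)).
  split=> // x y Ax Ay; rewrite mdist_to_hspace /hdist ?FF ?GG //; by [apply: hF|apply: hG].
apply: ereal_inf_lbound; exists r => //; split=> //.
- move=> _ [a Aa <-]; have [b Bb ab] := AB _ Aa.
  by exists (to_hspace (G b)); [exists b|rewrite mdist_to_hspace //; by [apply: hF|apply: hG]].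
- move=> _ [b Bb <-]; have [a Aa ab] := BA _ Bb.
  by exists (to_hspace (F a)); [exists a|rewrite mdist_to_hspace //; by [apply: hF|apply: hG]].
Qed.

(** * Cyclic indices, polytopes and the cross product *)

Lemma val_iter_ordS (n k : nat) (i : 'I_n) : iter k (@ordS n) i = ((i + k) %% n)%N :> nat.
Proof.
elim: k => [|k IH] /=; first by rewrite addn0 modn_small.
by rewrite IH -(addn1 ((i + k) %% n)) modnDml addn1 addnS.
Qed.

Lemma iter_ordS_eq (n k l : nat) (i : 'I_n) :
  (iter k (@ordS n) i == iter l (@ordS n) i) = (k == l %[mod n])%N.
Proof. by rewrite -val_eqE /= !val_iter_ordS eqn_modDl. Qed.

Lemma ordS_neq (n : nat) (i : 'I_n) : (1 < n)%N -> ordS i != i.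
Proof. by move=> n1; rewrite (iter_ordS_eq 1 0) mod0n modn_small. Qed.

Lemma ordSS_neq (n : nat) (i : 'I_n) : (2 < n)%N -> ordS (ordS i) != i.
Proof. by move=> n2; rewrite (iter_ordS_eq 2 0) mod0n modn_small. Qed.

Lemma ordS_inj (n : nat) : injective (@ordS n).
Proof. exact: can_inj (@ordSK n). Qed.

Lemma ordS_cyclic_ind (n : nat) (Pr : 'I_n -> Prop) (i0 : 'I_n) :
  Pr i0 -> (forall i, Pr i -> Pr (ordS i)) -> forall i, Pr i.
Proof.
move=> P0 PS i.
have PI k : Pr (iter k (@ordS n) i0) by elim: k => //= k; apply: PS.
(* Going from [i0] to [i] takes [i - i0] steps modulo [n]; adding [n] avoids truncated
   subtraction. *)
suff -> : i = iter (i + (n - i0)) (@ordS n) i0 by [].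
apply: val_inj; rewrite /= val_iter_ordS addnCA subnKC; last exact: ltnW.
by rewrite modnDr modn_small.
Qed.

Lemma polygon_inc_ordS (n : nat) (i j : 'I_n) :
  polygon_inc i (ordS j) = (j == i) || (ordS j == i).
Proof. by rewrite /polygon_inc (inj_eq (@ordS_inj n)) orbC. Qed.

Section polytopes.
Context {R : realType} {d : nat} {F V : finType} {inc : F -> V -> bool}.
Implicit Type P : polytope R d inc.

Lemma vertex_halfspace P f v : mink (normal P f) (vertex P v) <= 0.
Proof.
have : hull (vertex P) (vertex P v).
  split; first exact: vertex_hyp.
  exists (fun u => (u == v)%:R) => [u|]; first by rewrite ler0n.
  rewrite (bigD1 v) //= eqxx scale1r big1 ?addr0 // => u /negbTE ->.
  by rewrite scale0r.
by rewrite -halfspaces_hull => -[_]; exact.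
Qed.

Lemma vertex_incE P f v : inc f v -> mink (normal P f) (vertex P v) = 0.
Proof. by move/incidence. Qed.

Lemma vertex_halfspace_lt P f v : ~~ inc f v -> mink (normal P f) (vertex P v) < 0.
Proof.
move=> /negP nfv; rewrite lt_neqAle vertex_halfspace andbT.
by apply/eqP => /incidence.
Qed.

(* A common vertex is a timelike vector orthogonal to both normals, so that
   [acos] is applied inside its domain. *)
Lemma dihedral_mink P f g v b : inc f v -> inc g v -> dihedral P f g = b ->
  mink (normal P f) (normal P g) = - cos b.
Proof.
move=> fv gv; rewrite /dihedral => db.
have [vv _] := vertex_hyp P v.
have vf : mink (vertex P v) (normal P f) = 0 by rewrite minkC vertex_incE.
have vg : mink (vertex P v) (normal P g) = 0 by rewrite minkC vertex_incE.
have := mink_orth_cauchy_schwarz vv vf vg; rewrite !normal_unit mul1r => m2.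
have mi : mink (normal P f) (normal P g) \in `[(-1), 1].
  by rewrite in_itv /=; apply/andP; split; nra.
by rewrite -(acosK mi) -db addrC cosDpi opprK cosN.
Qed.

Lemma mink_dihedral P f g b : 0 <= b <= pi ->
  mink (normal P f) (normal P g) = - cos b -> dihedral P f g = b.
Proof.
move=> /andP[b0 bpi] fg; rewrite /dihedral fg.
have -> : - cos b = cos (pi - b) by rewrite addrC cosDpi cosN.
rewrite cosK; first by ring.
by rewrite in_itv /=; apply/andP; split; lra.
Qed.

(** All pairings [- mink (x u) (x v)] are at least 1. This makes nonzero conic combinations of
    vertices timelike and bounds their coefficients. *)
Lemma conic_hyp (x : V -> 'rV[R]_d.+1) (c : V -> R) : (forall v, hyp (x v)) ->
  (forall v, 0 <= c v) ->
  (\sum_v c v) ^+ 2 <= - mink (\sum_v c v *: x v) (\sum_v c v *: x v).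
Proof.
move=> hx c0; rewrite mink_suml -sumrN expr2 mulr_suml; apply: ler_sum => v _.
rewrite mink_sumr -sumrN mulr_sumr; apply: ler_sum => u _.
rewrite minkZl minkZr mulrA -mulrN.
by apply: ler_peMr; [rewrite mulr_ge0|exact: hyp_mink_ge1].
Qed.

End polytopes.

(** * The cross product in Minkowski 3-space *)

Section vec3.
Context {R : realType}.
Implicit Types a b c x y : 'rV[R]_3.

Definition vec3 (p q r : R) : 'rV[R]_3 := \row_(k < 3) nth 0 [:: p; q; r] k.

Lemma vec3P x : exists p q r, x = vec3 p q r.
Proof.
exists (x 0 0), (x 0 1), (x 0 2%:R); apply/rowP => -[[|[|[|//]]] i]; rewrite mxE /=;
  congr (x _ _); exact: val_inj.
Qed.

Lemma vec3_0 p q r : vec3 p q r 0 0 = p. Proof. by rewrite mxE. Qed.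
Lemma vec3_1 p q r : vec3 p q r 0 1 = q. Proof. by rewrite mxE. Qed.
Lemma vec3_2 p q r : vec3 p q r 0 2%:R = r. Proof. by rewrite mxE. Qed.

Lemma mink_vec3 p q r s t u :
  mink (vec3 p q r) (vec3 s t u) = - (p * s) + (q * t + r * u).
Proof. by rewrite /mink !big_ord_recl big_ord0 !mxE /= addr0. Qed.

(* The cross product dual to the determinant: [mink (cross a b) c] is the
   determinant of [a], [b], [c]. *)
Definition cross a b : 'rV[R]_3 :=
  vec3 (a 0 2%:R * b 0 1 - a 0 1 * b 0 2%:R)
       (a 0 2%:R * b 0 0 - a 0 0 * b 0 2%:R)
       (a 0 0 * b 0 1 - a 0 1 * b 0 0).

Lemma cross_vec3 p q r s t u : cross (vec3 p q r) (vec3 s t u) =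
  vec3 (r * t - q * u) (r * s - p * u) (p * t - q * s).
Proof. by rewrite /cross !vec3_0 !vec3_1 !vec3_2. Qed.

Ltac vec3_ring := rewrite !(cross_vec3, mink_vec3); ring.

Lemma mink_cross a b c : mink (cross a b) c = mink (cross b c) a.
Proof.
have [? [? [? ->]]] := vec3P a; have [? [? [? ->]]] := vec3P b.
have [? [? [? ->]]] := vec3P c; vec3_ring.
Qed.

Lemma mink_cross_swap a b c : mink (cross a b) c = - mink (cross b a) c.
Proof.
have [? [? [? ->]]] := vec3P a; have [? [? [? ->]]] := vec3P b.
have [? [? [? ->]]] := vec3P c; vec3_ring.
Qed.

Lemma mink_cross_l a b : mink (cross a b) a = 0.
Proof. have [? [? [? ->]]] := vec3P a; have [? [? [? ->]]] := vec3P b; vec3_ring. Qed.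

Lemma mink_cross_r a b : mink (cross a b) b = 0.
Proof. have [? [? [? ->]]] := vec3P a; have [? [? [? ->]]] := vec3P b; vec3_ring. Qed.

Lemma mink_cross_cross a b c x : mink (cross a b) (cross c x) =
  mink a x * mink b c - mink a c * mink b x.
Proof.
have [? [? [? ->]]] := vec3P a; have [? [? [? ->]]] := vec3P b.
have [? [? [? ->]]] := vec3P c; have [? [? [? ->]]] := vec3P x; vec3_ring.
Qed.

(** The square of a determinant is the Gram determinant up to the determinant of the form, here
    -1. *)
Lemma mink_cross_gram a b c : mink (cross a b) c ^+ 2 =
  - (mink a a * (mink b b * mink c c - mink b c ^+ 2)
     - mink a b * (mink a b * mink c c - mink b c * mink a c)
     + mink a c * (mink a b * mink b c - mink b b * mink a c)).
Proof.
have [? [? [? ->]]] := vec3P a; have [? [? [? ->]]] := vec3P b.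
have [? [? [? ->]]] := vec3P c; vec3_ring.
Qed.

Lemma cross_cramer a b c x : mink (cross a b) c *: x =
  mink (cross b c) x *: a + mink (cross c a) x *: b + mink (cross a b) x *: c.
Proof.
have [? [? [? ->]]] := vec3P a; have [? [? [? ->]]] := vec3P b.
have [? [? [? ->]]] := vec3P c; have [? [? [? ->]]] := vec3P x.
by apply/rowP => -[[|[|[|//]]] i]; rewrite !(cross_vec3, mink_vec3) !mxE /=; ring.
Qed.

(** The orthogonal complement of [a] and [b] is the line of their cross product. Without division,
    no independence has to be assumed. *)
Lemma orth_cross a b x : mink a x = 0 -> mink b x = 0 ->
  mink (cross a b) (cross a b) *: x = mink (cross a b) x *: cross a b.
Proof.
move=> ax bx; set c := cross a b; rewrite cross_cramer.
have -> : mink (cross b c) x = 0.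
  by rewrite mink_cross mink_cross mink_cross_cross (minkC x) (minkC x) bx ax !mul0r subrr.
have -> : mink (cross c a) x = 0.
  by rewrite mink_cross mink_cross_cross (minkC x) (minkC x) bx ax !mulr0 subrr.
by rewrite !scale0r !add0r.
Qed.

End vec3.

(** * Polygons from normals and vertices *)

(** A discrete intermediate value theorem, used to find the sector of a fan that contains a given
    direction. *)
Lemma nat_sign_change (R : realDomainType) (h : nat -> R) (a k : nat) :
  0 <= h a -> h (a + k.+1)%N <= 0 ->
  exists j, [/\ (a <= j < a + k.+1)%N, 0 <= h j & h j.+1 <= 0].
Proof.
elim: k a => [|k IH] a ha hb; first by exists a; rewrite addn1 in hb *; rewrite leqnn ltnSn.
have [h1|h1] := leP (h a.+1) 0; first by exists a; split => //; rewrite leqnn -addSnnS leq_addr.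
have [|j [/andP[aj ja] hj hj1]] := IH a.+1 (ltW h1); first by rewrite addSnnS.
by exists j; split => //; rewrite (ltnW aj) -addSnnS.
Qed.

Section fan.
Context {R : realType} {n : nat} (n2 : (2 < n)%N).
Variables (v x : 'I_n -> 'rV[R]_3).
Hypotheses (hx : forall j, hyp (x j)) (vx : forall i, mink (v i) (x i) = 0)
  (vxS : forall i, mink (v i) (x (ordS i)) = 0)
  (vlt : forall i j, ~~ polygon_inc i j -> mink (v i) (x j) < 0).

Lemma fan_vertex_SS i : mink (v i) (x (ordS (ordS i))) < 0.
Proof.
by apply: vlt; rewrite polygon_inc_ordS negb_or ordS_neq ?ordSS_neq // ltnW.
Qed.

Lemma fan_vertex_pred i : mink (v (ordS i)) (x i) < 0.
Proof.
apply: vlt; rewrite /polygon_inc negb_or ![i == _]eq_sym.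
by rewrite ordS_neq ?ordSS_neq // ltnW.
Qed.

(** The normal [v j] is proportional to the cross product of the two ends of its edge, and [s] is
    the common orientation. Consecutive factors have the same sign because [mink (v j) (x (j + 2))]
    and [mink (v (j + 1)) (x j)] are both negative and both involve the determinant of the same
    three vertices. *)
Lemma fan_orientation : exists s : R, forall j, exists2 l : R, 0 < l &
  forall y, s * mink (cross (x j) (x (ordS j))) y = - l * mink (v j) y.
Proof.
pose c j := cross (x j) (x (ordS j)).
have cc j : 0 < mink (c j) (c j).
  rewrite -(ord_predK j) mink_cross_cross; set i := ord_pred j.
  have [xx _] := hx (ordS i); have [yy _] := hx (ordS (ordS i)).
  have ge1 := hyp_mink_ge1 (hx (ordS i)) (hx (ordS (ordS i))).
  suff : - mink (x (ordS i)) (x (ordS (ordS i))) != 1.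
    by rewrite xx yy (minkC (x (ordS (ordS i)))) => /eqP; nra.
  apply/eqP => /(hyp_eq (hx _) (hx _)) e.
  by have := fan_vertex_SS i; rewrite -e vxS ltxx.
pose m j := mink (c j) (v j).
have cv j y : mink (c j) (c j) * mink (v j) y = m j * mink (c j) y.
  by rewrite -!minkZl orth_cross // minkC.
have m0 j : m j != 0.
  apply/eqP => mj; have /eqP := cv j (x (ordS (ordS j))).
  by rewrite mj mul0r mulf_eq0 gt_eqF //= lt_eqF // fan_vertex_SS.
have mm j : 0 < m j * m (ordS j).
  have e : mink (c j) (x (ordS (ordS j))) = mink (c (ordS j)) (x j) by rewrite mink_cross.
  have a := cv j (x (ordS (ordS j))); have b := cv (ordS j) (x j).
  have := fan_vertex_SS j; have := fan_vertex_pred j.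
  have := cc j; have := cc (ordS j); move: a b; rewrite e.
  set p := mink (c (ordS j)) (x j); set q := mink (c j) _; set r := mink (c (ordS j)) _.
  set f := mink (v j) _; set g := mink (v (ordS j)) _ => a b r0 q0 g0 f0.
  have : 0 < (q * f) * (r * g) by rewrite nmulr_rgt0 ?pmulr_rlt0.
  rewrite a b mulrACA => h.
  have := sqr_ge0 p; rewrite expr2 => p2.
  rewrite ltNge; apply/negP => m_le; move: h; rewrite ltNge => /negP; apply.
  exact: mulr_le0_ge0.
pose i0 : 'I_n := Ordinal (ltnW (ltnW n2)).
exists (- m i0) => j.
exists (m i0 * m j * (mink (c j) (c j) / m j ^+ 2)).
  apply: mulr_gt0; last by rewrite divr_gt0 // exprn_even_gt0 //= m0.
  move: j; apply: (ordS_cyclic_ind (i0 := i0)) => [|i H].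
    by rewrite -expr2 exprn_even_gt0 //= m0.
  have mi : 0 < m i ^+ 2 by rewrite exprn_even_gt0 //= m0.
  rewrite -(pmulr_rgt0 _ mi).
  have -> : m i ^+ 2 * (m i0 * m (ordS i)) = (m i0 * m i) * (m i * m (ordS i)) by ring.
  exact: mulr_gt0.
move=> y; have := cv j y; rewrite -/(c j) => e.
have -> : - (m i0 * m j * (mink (c j) (c j) / m j ^+ 2)) * mink (v j) y =
  - (m i0 * m j / m j ^+ 2) * (mink (c j) (c j) * mink (v j) y) by ring.
by rewrite e; field; rewrite m0.
Qed.

Lemma sum_indicator (i : 'I_n) (a : R) : \sum_j ((j == i)%:R * a) *: x j = a *: x i.
Proof.
rewrite (bigD1 i) //= eqxx mul1r big1 ?addr0 // => j /negbTE ->.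
by rewrite mul0r scale0r.
Qed.

End fan.

(** Triangulate from the vertex 0: the oriented determinant of [x 0], [x k], [y] is nonnegative at
    [k = 1] and nonpositive at [k = n - 1], so it changes sign at some triangle [0, k, k + 1], where
    Cramer's rule gives nonnegative coefficients. As [y] may be any vector, timelikeness can be
    deduced from the result. *)
Lemma fan_conic (R : realType) (n : nat) (v x : 'I_n -> 'rV[R]_3) : (2 < n)%N ->
  (forall j, hyp (x j)) -> (forall i, mink (v i) (x i) = 0) ->
  (forall i, mink (v i) (x (ordS i)) = 0) ->
  (forall i j, ~~ polygon_inc i j -> mink (v i) (x j) < 0) ->
  forall y, (forall i, mink (v i) y <= 0) ->
  exists2 c : 'I_n -> R, (forall j, 0 <= c j) & y = \sum_j c j *: x j.
Proof.
case: n v x => [//|[//|[//|m]]] v x n2 hx vx vxS vlt y hy.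
have [s sP] := fan_orientation n2 hx vx vxS vlt.
pose X k := x (inord k); pose g k := s * mink (cross (X 0%N) (X k)) y.
have XS k : (k < m.+2)%N -> ordS (inord k : 'I_m.+3) = inord k.+1.
  move=> km; apply: val_inj => /=.
  by rewrite !inordK ?modn_small // (ltn_trans km).
have g1 : 0 <= g 1%N.
  have [l l0 /(_ y)] := sP (inord 0); rewrite XS // /g => ->.
  by have := hy (inord 0); nra.
have gm : g m.+2 <= 0.
  have [l l0 /(_ y)] := sP (inord m.+2); rewrite mink_cross_swap mulrN.
  have -> : ordS (inord m.+2 : 'I_m.+3) = inord 0.
    by apply: val_inj => /=; rewrite !inordK // modnn.
  rewrite -/(X _) -/(X _) -/(g _) => e.
  by have := hy (inord m.+2); nra.
have [k [/andP[k1 km] gk gk1]] := nat_sign_change (k := m) g1 gm.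
rewrite add1n ltnS in km.
have kS := XS _ km.
have [l l0 lE] := sP (inord k); rewrite kS in lE.
set a := X 0%N; set b := X k; set c := X k.+1.
set E := s * mink (cross a b) c.
have E0 : 0 < E.
  rewrite /E mink_cross lE; suff : mink (v (inord k)) a < 0 by nra.
  apply: vlt; rewrite /polygon_inc kS -!val_eqE /= !inordK //; last by rewrite ltnW.
  by rewrite negb_or /= eq_sym -lt0n k1.
have eqE : E *: y = (s * mink (cross b c) y) *: a + (- g k.+1) *: b + g k *: c.
  rewrite /E -scalerA cross_cramer !scalerDr !scalerA; congr (_ + _ *: _ + _).
  by rewrite /g -/a -/c (mink_cross_swap a) mulrN opprK.
pose A := s * mink (cross b c) y / E; pose B := - g k.+1 / E; pose C := g k / E.
have A0 : 0 <= A.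
  by rewrite divr_ge0 ?(ltW E0) // lE; have := hy (inord k); nra.
have B0 : 0 <= B by rewrite divr_ge0 ?(ltW E0) // oppr_ge0.
have C0 : 0 <= C by rewrite divr_ge0 ?(ltW E0).
exists (fun j => (j == inord 0)%:R * A + (j == inord k)%:R * B + (j == inord k.+1)%:R * C).
  by move=> j; rewrite !addr_ge0 // mulr_ge0 // ler0n.
under eq_bigr do rewrite !scalerDl.
rewrite !big_split /= !sum_indicator -/(X _) -/(X _) -/(X _) -/a -/b -/c.
apply: (scalerI (lt0r_neq0 E0)); rewrite eqE !scalerDr !scalerA.
by rewrite ![E * _]mulrC !divfK // gt_eqF.
Qed.

(** The equality of intersection and hull is reduced to finitely many linear conditions, of which
    the strict ones survive perturbation. *)
Lemma fan_polygon (R : realType) (n : nat) (v x : 'I_n -> 'rV[R]_3) : (2 < n)%N ->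
  (forall i, mink (v i) (v i) = 1) ->
  (forall j, hyp (x j)) -> (forall i, mink (v i) (x i) = 0) ->
  (forall i, mink (v i) (x (ordS i)) = 0) ->
  (forall i j, ~~ polygon_inc i j -> mink (v i) (x j) < 0) ->
  exists2 Q : polygon R n, normal Q = v & vertex Q = x.
Proof.
move=> n2 vv hx vx vxS vlt.
have inc0 i j : polygon_inc i j -> mink (v i) (x j) = 0.
  by move=> /orP[/eqP->|/eqP->].
have hh : halfspaces v = hull x.
  apply/seteqP; split=> y [hy].
    move=> /(fan_conic n2 hx vx vxS vlt) [c c0 yc]; split=> //; by exists c.
  move=> [c c0 yc]; split=> // i; rewrite yc mink_sumr sumr_le0 // => j _.
  rewrite minkZr mulr_ge0_le0 //.
  by have [/inc0->//|/vlt/ltW] := boolP (polygon_inc i j).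
have iE i j : mink (v i) (x j) = 0 <-> polygon_inc i j.
  split=> [e|/inc0//]; apply/negPn/negP => /vlt; by rewrite e ltxx.
by exists (Polytope vv hx hh iE).
Qed.

(** * Trigonometry of a polygon with given angles *)

Section angle_bounds.
Context {R : realType}.
Variable b : R.
Hypothesis hb : 0 < b <= pi / 2.

Lemma sin_angle_gt0 : 0 < sin b.
Proof.
move: hb => /andP[b0 bpi]; apply: sin_gt0_pi; rewrite b0 /=.
by have := pi_gt0 R; lra.
Qed.

Lemma cos_angle_ge0 : 0 <= cos b.
Proof.
move: hb => /andP[b0 bpi]; apply: cos_ge0_pihalf; rewrite bpi andbT.
by have := pi_gt0 R; lra.
Qed.

Lemma cos_angle_lt1 : cos b < 1.
Proof.
have := cos2Dsin2 b; have := sin_angle_gt0; have := cos_angle_ge0.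
by move=> c0 s0; rewrite !expr2; nra.
Qed.

End angle_bounds.

Section polygon_geometry.
Context {R : realType} {n : nat} (n2 : (2 < n)%N).
Variables (beta : 'I_n -> R) (Q : polygon R n).
Hypothesis hbeta : forall i, 0 < beta i <= pi / 2.
Hypothesis hQ : polygon_angles beta Q.

Local Notation v := (normal Q).
Local Notation x := (vertex Q).
Local Notation sn i := (sin (beta i)).
Local Notation cs i := (cos (beta i)).

Let sn0 i : 0 < sn i. Proof. exact: sin_angle_gt0. Qed.

Lemma polygon_normal_mink i : mink (v i) (v (ordS i)) = - cs (ordS i).
Proof.
by apply: (dihedral_mink (v := ordS i)) => //; rewrite /polygon_inc eqxx ?orbT.
Qed.

Lemma polygon_vertex i : mink (v i) (x i) = 0.
Proof. by apply: vertex_incE; rewrite /polygon_inc eqxx. Qed.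

Lemma polygon_vertexS i : mink (v i) (x (ordS i)) = 0.
Proof. by apply: vertex_incE; rewrite /polygon_inc eqxx orbT. Qed.

Lemma polygon_vertexSS i : mink (v i) (x (ordS (ordS i))) < 0.
Proof. apply: (fan_vertex_SS n2) => *; exact: vertex_halfspace_lt. Qed.

Lemma polygon_vertex_pred i : mink (v (ordS i)) (x i) < 0.
Proof. apply: (fan_vertex_pred n2) => *; exact: vertex_halfspace_lt. Qed.

(** Each vertex is a multiple of the cross product of its two normals, whose square norm is minus
    the squared sine of the angle. The sign [e] is common to all vertices because neighbouring ones
    share the determinant of three consecutive normals. *)
Lemma polygon_vertexE : exists2 e : R, e ^+ 2 = 1 &
  forall j, x (ordS j) = (e / sn (ordS j)) *: cross (v j) (v (ordS j)).
Proof.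
pose c j := cross (v j) (v (ordS j)).
pose m j := mink (c j) (x (ordS j)).
have cc j : mink (c j) (c j) = - sn (ordS j) ^+ 2.
  rewrite mink_cross_cross !normal_unit (minkC (v (ordS j))) polygon_normal_mink.
  by have := cos2Dsin2 (beta (ordS j)); lra.
have xE j : - sn (ordS j) ^+ 2 *: x (ordS j) = m j *: c j.
  by rewrite -cc orth_cross ?polygon_vertexS ?polygon_vertex.
have m2 j : m j ^+ 2 = sn (ordS j) ^+ 2.
  have [xx _] := vertex_hyp Q (ordS j).
  have := congr1 (fun z => mink z z) (xE j); rewrite !minkZl !minkZr xx cc.
  have := lt0r_neq0 (sn0 (ordS j)); set s := sn _ => s0 e.
  have s2 : s ^+ 2 != 0 by rewrite expf_neq0.
  apply: (mulfI s2); have -> : s ^+ 2 * m j ^+ 2 = - (m j * (m j * - s ^+ 2)) by ring.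
  by rewrite -e; ring.
pose e j := - m j / sn (ordS j).
have e2 j : e j ^+ 2 = 1 by rewrite /e expr_div_n sqrrN m2 divff // expf_neq0 // gt_eqF.
have xe j : x (ordS j) = (e j / sn (ordS j)) *: c j.
  have s0 := lt0r_neq0 (sn0 (ordS j)).
  have s2 : - sn (ordS j) ^+ 2 != 0 by rewrite oppr_eq0 expf_neq0.
  apply: (scalerI s2); rewrite xE scalerA; congr (_ *: _).
  by rewrite /e; field.
have eS j : e (ordS j) = e j.
  have a : mink (v (ordS (ordS j))) (x (ordS j)) < 0 by exact: polygon_vertex_pred.
  have b := polygon_vertexSS j.
  have d : mink (c j) (v (ordS (ordS j))) = mink (c (ordS j)) (v j) by exact: mink_cross.
  rewrite minkC xe minkZl in a; rewrite minkC xe minkZl -d in b.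
  set D := mink (c j) _ in a b.
  have ee : 0 < e j * e (ordS j).
    have : 0 < (e j / sn (ordS j) * D) * (e (ordS j) / sn (ordS (ordS j)) * D) by rewrite nmulr_rgt0.
    have -> : (e j / sn (ordS j) * D) * (e (ordS j) / sn (ordS (ordS j)) * D) =
      (e j * e (ordS j)) * (D ^+ 2 / (sn (ordS j) * sn (ordS (ordS j)))).
      by field; rewrite !gt_eqF.
    rewrite ltNge => /negP h; rewrite ltNge; apply/negP => le; apply: h.
    by rewrite mulr_le0_ge0 // divr_ge0 ?sqr_ge0 // mulr_ge0 // ltW.
  have : e (ordS j) ^+ 2 == e j ^+ 2 by rewrite !e2.
  rewrite eqf_sqr => /orP[/eqP//|/eqP eN].
  by move: ee; rewrite eN mulrN -expr2 e2 ltr0N1.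
pose i0 : 'I_n := Ordinal (ltnW (ltnW n2)).
exists (e i0) => // j; rewrite xe; congr (_ / _ *: _).
by move: j; apply: (ordS_cyclic_ind (i0 := i0)) => // i <-.
Qed.

(** For fixed angles the length of an edge depends only on the product of the normals of its two
    neighbours; this makes the perimeter an explicit function of the normals. *)
Lemma polygon_edge_mink j : - mink (x (ordS j)) (x (ordS (ordS j))) =
  (cs (ordS j) * cs (ordS (ordS j)) - mink (v j) (v (ordS (ordS j)))) /
  (sn (ordS j) * sn (ordS (ordS j))).
Proof.
have [e e2 xE] := polygon_vertexE.
rewrite !xE minkZl minkZr mink_cross_cross !polygon_normal_mink !normal_unit.
apply: (@etrans _ _ (e ^+ 2 * ((cs (ordS j) * cs (ordS (ordS j)) - mink (v j) (v (ordS (ordS j)))) /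
  (sn (ordS j) * sn (ordS (ordS j)))))); last by rewrite e2 mul1r.
by field; rewrite !gt_eqF.
Qed.

Lemma polygon_edge_gt1 j : 1 < - mink (x (ordS j)) (x (ordS (ordS j))).
Proof.
have ge1 := hyp_mink_ge1 (vertex_hyp Q (ordS j)) (vertex_hyp Q (ordS (ordS j))).
rewrite lt_neqAle ge1 andbT eq_sym; apply/eqP => /(hyp_eq (vertex_hyp _ _) (vertex_hyp _ _)) e.
by have := polygon_vertexSS j; rewrite -e polygon_vertexS ltxx.
Qed.

(** The hyperbolic sine of the length of the edge [ordS j], not of [j]: the shift makes the three
    lines involved [j], [j + 1] and [j + 2]. *)
Definition edge_sinh j := Num.sqrt (mink (x (ordS j)) (x (ordS (ordS j))) ^+ 2 - 1).

Lemma edge_sinh_gt0 j : 0 < edge_sinh j.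
Proof. by rewrite sqrtr_gt0; have := polygon_edge_gt1 j; rewrite expr2; nra. Qed.

(* Right-angled triangles with hypotenuse an edge of the polygon. *)
Lemma polygon_height_l j :
  mink (v j) (x (ordS (ordS j))) = - (sn (ordS j) * edge_sinh j).
Proof.
have [e e2 xE] := polygon_vertexE.
have := mink_cross_gram (v j) (v (ordS j)) (x (ordS (ordS j))).
have [xx _] := vertex_hyp Q (ordS (ordS j)).
have s0 := sn0 (ordS j).
have -> : cross (v j) (v (ordS j)) = (e * sn (ordS j)) *: x (ordS j).
  rewrite xE scalerA.
  have k (s : R) : 0 < s -> e * s * (e / s) = e ^+ 2 by move=> s1; field; rewrite gt_eqF.
  by rewrite k // e2 scale1r.
rewrite minkZl !normal_unit xx polygon_normal_mink polygon_vertexS.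
have := polygon_vertexSS j; have := edge_sinh_gt0 j.
have : edge_sinh j ^+ 2 = mink (x (ordS j)) (x (ordS (ordS j))) ^+ 2 - 1.
  by rewrite sqr_sqrtr // subr_ge0; have := polygon_edge_gt1 j; rewrite expr2; nra.
have := cos2Dsin2 (beta (ordS j)).
set r := mink (v j) _; set h := edge_sinh j; set E := mink (x _) _; set s := sn _; set c := cs _.
move=> cs1 h2 h0 r0; rewrite !exprMn e2 mul1r => eq.
have {}eq : r ^+ 2 = (s * h) ^+ 2 by rewrite exprMn h2; lra.
have sh : 0 < s * h by rewrite mulr_gt0.
by move/eqP: eq; rewrite eqf_sqr => /orP[/eqP|/eqP//]; lra.
Qed.

Lemma polygon_height_r j :
  mink (v (ordS (ordS j))) (x (ordS j)) = - (sn (ordS (ordS j)) * edge_sinh j).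
Proof.
have [e e2 xE] := polygon_vertexE.
have := mink_cross_gram (v (ordS j)) (v (ordS (ordS j))) (x (ordS j)).
have [xx _] := vertex_hyp Q (ordS j).
have s0 := sn0 (ordS (ordS j)).
have -> : cross (v (ordS j)) (v (ordS (ordS j))) = (e * sn (ordS (ordS j))) *: x (ordS (ordS j)).
  rewrite xE scalerA.
  have k (s : R) : 0 < s -> e * s * (e / s) = e ^+ 2 by move=> s1; field; rewrite gt_eqF.
  by rewrite k // e2 scale1r.
rewrite minkZl !normal_unit xx polygon_normal_mink polygon_vertex.
have := polygon_vertex_pred (ordS j); have := edge_sinh_gt0 j.
have : edge_sinh j ^+ 2 = mink (x (ordS j)) (x (ordS (ordS j))) ^+ 2 - 1.
  by rewrite sqr_sqrtr // subr_ge0; have := polygon_edge_gt1 j; rewrite expr2; nra.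
have := cos2Dsin2 (beta (ordS (ordS j))).
rewrite (minkC (x (ordS (ordS j)))).
set r := mink (v _) _; set h := edge_sinh j; set E := mink (x _) _; set s := sn _; set c := cs _.
move=> cs1 h2 h0 r0; rewrite !exprMn e2 mul1r => eq.
have {}eq : r ^+ 2 = (s * h) ^+ 2 by rewrite exprMn h2; lra.
have sh : 0 < s * h by rewrite mulr_gt0.
by move/eqP: eq; rewrite eqf_sqr => /orP[/eqP|/eqP//]; lra.
Qed.

End polygon_geometry.

(** * Pointwise derivatives and curves of vectors *)

Section pointwise_derivatives.
Context {R : realType}.
Implicit Types (f g : R -> R) (x a b c : R).

Lemma is_derive_fun_cst c x : is_derive x 1 (fun=> c) 0.
Proof. exact: is_derive_cst. Qed.

Lemma is_derive_fun_id x : is_derive x (1 : R) (fun s => s) 1.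
Proof. exact: is_derive_id. Qed.

Lemma is_derive_funN f x a : is_derive x 1 f a -> is_derive x 1 (fun s => - f s) (- a).
Proof. by move=> fa; exact: is_deriveN. Qed.

Lemma is_derive_funD f g x a b : is_derive x 1 f a -> is_derive x 1 g b ->
  is_derive x 1 (fun s => f s + g s) (a + b).
Proof. by move=> fa gb; exact: is_deriveD. Qed.

Lemma is_derive_funB f g x a b : is_derive x 1 f a -> is_derive x 1 g b ->
  is_derive x 1 (fun s => f s - g s) (a - b).
Proof. by move=> fa gb; exact: is_deriveB. Qed.

Lemma is_derive_funM f g x a b : is_derive x 1 f a -> is_derive x 1 g b ->
  is_derive x 1 (fun s => f s * g s) (a * g x + f x * b).
Proof.
move=> fa gb; apply: (is_derive_eq (is_deriveM fa gb)).
by rewrite /GRing.scale /= addrC (mulrC (g x)).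
Qed.

Lemma is_derive_funZ f x a c : is_derive x 1 f a -> is_derive x 1 (fun s => c * f s) (c * a).
Proof.
move=> fa; apply: (is_derive_eq (is_derive_funM (is_derive_fun_cst c x) fa)).
by rewrite mul0r add0r.
Qed.

Lemma is_derive_funV f x a : f x != 0 -> is_derive x 1 f a ->
  is_derive x 1 (fun s => (f s)^-1) (- a / f x ^+ 2).
Proof.
move=> f0 fa; apply: (is_derive_eq (is_deriveV f0 fa)).
by rewrite /GRing.scale /= mulNr mulNr mulrC.
Qed.

Lemma is_derive_fun_sqrt f x a : 0 < f x -> is_derive x 1 f a ->
  is_derive x 1 (fun s => Num.sqrt (f s)) (a / (2 * Num.sqrt (f x))).
Proof.
move=> f0 fa; have := is_derive1_sqrt f0 => h.
by apply: (is_derive_eq (is_derive1_comp h fa)); rewrite mulrC.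
Qed.

Lemma is_derive_fun_sum n (f : 'I_n -> R -> R) x (a : 'I_n -> R) :
  (forall i, is_derive x 1 (f i) (a i)) ->
  is_derive x 1 (fun s => \sum_i f i s) (\sum_i a i).
Proof.
move=> fa; have -> : (fun s => \sum_i f i s) = \sum_i f i by apply/funext => s; rewrite fct_sumE.
exact: is_derive_sum.
Qed.

Lemma is_derive_arcosh f x a : 1 < f x -> is_derive x 1 f a ->
  is_derive x 1 (fun s => arcosh (f s)) (a / Num.sqrt (f x ^+ 2 - 1)).
Proof.
move=> f1 fa.
have d0 : 0 < f x ^+ 2 - 1 by rewrite expr2; nra.
have r0 : 0 < Num.sqrt (f x ^+ 2 - 1) by rewrite sqrtr_gt0.
have l0 : 0 < f x + Num.sqrt (f x ^+ 2 - 1) by rewrite addr_gt0 // (lt_trans ltr01).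
have dsq : is_derive x 1 (fun s => f s ^+ 2 - 1) (2 * a * f x).
  apply: (is_derive_eq (is_derive_funB (is_derive_funM fa fa) (is_derive_fun_cst 1 x))).
  by ring.
have dl := is_derive1_ln l0.
have ds := is_derive_funD fa (is_derive_fun_sqrt (f := fun s => f s ^+ 2 - 1) d0 dsq).
apply: (is_derive_eq (@is_derive1_comp _ (@ln R) _ x _ _ dl ds)).
set r := Num.sqrt _ in r0 l0 *.
by field; rewrite !gt_eqF.
Qed.

Lemma is_derive_cvg f x a : is_derive x 1 f a -> f s @[s --> x] --> f x.
Proof.
move=> [fd _]; apply: differentiable_continuous; exact/derivable1_diffP.
Qed.

Lemma is_derive_quotient f x a : is_derive x 1 f a ->
  h^-1 * (f (h + x) - f x) @[h --> (0 : R)^'] --> a.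
Proof.
move=> [fd <-]; move: fd; rewrite /derivable => /cvgP; rewrite /derive /=.
rewrite (_ : (fun h => h^-1 *: _) = (fun h : R => h^-1 * (f (h + x) - f x))) //.
by apply/funext => h; rewrite /GRing.scale /= mulr1.
Qed.

Lemma is_derive_near_min f x a : is_derive x 1 f a -> (\forall s \near x, f x <= f s) -> a = 0.
Proof.
move=> fa fmin; have df := is_derive_quotient fa.
have fmin' : \forall h \near (0 : R)^', f x <= f (h + x).
  apply: nbhs_dnbhs; have cv : (h + x) @[h --> (0 : R)] --> x.
    by rewrite -[X in _ --> X]add0r; apply: cvgD; [exact: cvg_id|exact: cvg_cst].
  exact: (cv _ fmin).
apply/eqP; rewrite eq_le; apply/andP; split; rewrite leNgt; apply/negP => a0.
- have H : \forall h \near (0 : R)^', 0 < h^-1 * (f (h + x) - f x) by exact: (cvgr_gt _ df).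
  have [e /= e0 He] := filterI H fmin'.
  have := He (- (e / 2)); rewrite /= sub0r opprK gtr0_norm ?divr_gt0 // ltr_pdivrMr // ltr_pMr // ltr1n.
  move=> /(_ isT); rewrite oppr_eq0 mulf_neq0 ?invr_eq0 ?gt_eqF // => /(_ isT)[].
  rewrite nmulr_rgt0 ?invr_lt0 ?oppr_lt0 ?divr_gt0 // subr_lt0 => h1 h2.
  by move: (lt_le_trans h1 h2); rewrite ltxx.
- have H : \forall h \near (0 : R)^', h^-1 * (f (h + x) - f x) < 0 by exact: (cvgr_lt _ df).
  have [e /= e0 He] := filterI H fmin'.
  have := He (e / 2); rewrite /= sub0r normrN gtr0_norm ?divr_gt0 // ltr_pdivrMr // ltr_pMr // ltr1n.
  move=> /(_ isT); rewrite mulf_neq0 ?invr_eq0 ?gt_eqF // => /(_ isT)[].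
  rewrite pmulr_rlt0 ?invr_gt0 ?divr_gt0 // subr_lt0 => h1 h2.
  by move: (lt_le_trans h1 h2); rewrite ltxx.
Qed.

End pointwise_derivatives.

Section row_curves.
Context {R : realType}.

(** Coordinatewise, so that limits and derivatives of vectors reduce at once to those of real
    functions. *)
Definition row_cvg {T : Type} {m} (F : set_system T) (f : T -> 'rV[R]_m) (l : 'rV[R]_m) :=
  forall k, f s 0 k @[s --> F] --> l 0 k.

Definition row_derive {m} (f : R -> 'rV[R]_m) (x : R) (l : 'rV[R]_m) :=
  forall k, is_derive x 1 (fun s => f s 0 k) (l 0 k).

Lemma row_derive_cvg {m} (f : R -> 'rV[R]_m) x l : row_derive f x l -> row_cvg (nbhs x) f (f x).
Proof. by move=> fl k; exact: is_derive_cvg. Qed.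

Lemma cvg_mink {T} {d} (F : set_system T) {FF : Filter F} (f g : T -> 'rV[R]_d.+1) a b :
  row_cvg F f a -> row_cvg F g b -> mink (f s) (g s) @[s --> F] --> mink a b.
Proof.
move=> fa gb; rewrite /mink; apply: cvgD.
  by apply: cvgN; apply: cvgM; [exact: fa|exact: gb].
by apply: cvg_big => [|i _]; [exact: add_continuous|apply: cvgM; [exact: fa|exact: gb]].
Qed.

Lemma row_cvg_cst {T} {m} (F : set_system T) {FF : Filter F} (a : 'rV[R]_m) :
  row_cvg F (fun=> a) a.
Proof. by move=> k; exact: cvg_cst. Qed.

Lemma row_cvgZ {T} {m} (F : set_system T) {FF : Filter F} (c : T -> R) (f : T -> 'rV[R]_m) (r : R) a :
  c s @[s --> F] --> r -> row_cvg F f a -> row_cvg F (fun s => c s *: f s) (r *: a).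
Proof.
move=> cr fa k; rewrite mxE; under eq_fun do rewrite mxE.
by apply: cvgM => //; exact: fa.
Qed.

Lemma row_cvg_cross {T} (F : set_system T) {FF : Filter F} (f g : T -> 'rV[R]_3) a b :
  row_cvg F f a -> row_cvg F g b -> row_cvg F (fun s => cross (f s) (g s)) (cross a b).
Proof.
move=> fa gb -[[|[|[|//]]] i]; rewrite mxE /=; under eq_fun do rewrite mxE /=;
  apply: cvgB; apply: cvgM; by [exact: fa|exact: gb].
Qed.

Lemma is_derive_mink {d} (f g : R -> 'rV[R]_d.+1) x a b :
  row_derive f x a -> row_derive g x b ->
  is_derive x 1 (fun s => mink (f s) (g s)) (mink a (g x) + mink (f x) b).
Proof.
move=> fa gb; rewrite /mink.
have E k : is_derive x 1 (fun s => f s 0 k * g s 0 k) (a 0 k * g x 0 k + f x 0 k * b 0 k).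
  exact: (is_derive_funM (fa k) (gb k)).
apply: (is_derive_eq (is_derive_funD (is_derive_funN (E 0)) (is_derive_fun_sum (fun i => E (lift ord0 i))))).
by rewrite big_split /= opprD addrACA.
Qed.

Lemma row_derive_cst {m} (a : 'rV[R]_m) x : row_derive (fun=> a) x 0.
Proof. by move=> k; rewrite mxE; exact: is_derive_fun_cst. Qed.

Lemma row_deriveD {m} (f g : R -> 'rV[R]_m) x a b :
  row_derive f x a -> row_derive g x b -> row_derive (fun s => f s + g s) x (a + b).
Proof.
move=> fa gb k; rewrite mxE; under eq_fun do rewrite mxE.
exact: is_derive_funD (fa k) (gb k).
Qed.

Lemma row_deriveZ {m} (c : R -> R) (a : 'rV[R]_m) (x r : R) :
  is_derive x 1 c r -> row_derive (fun s => c s *: a) x (r *: a).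
Proof.
move=> cr k; rewrite mxE; under eq_fun do rewrite mxE.
apply: (is_derive_eq (is_derive_funM cr (is_derive_fun_cst (a 0 k) x))).
by rewrite mulr0 addr0.
Qed.

End row_curves.

(** * First variation of the perimeter *)

Section variation.
Context {R : realType} {n : nat} (n2 : (2 < n)%N).
Variables (beta : 'I_n -> R) (Q : polygon R n).
Hypothesis hbeta : forall i, 0 < beta i <= pi / 2.
Hypothesis hQ : polygon_angles beta Q.

Local Notation v := (normal Q).
Local Notation x := (vertex Q).
Local Notation sn i := (sin (beta i)).
Local Notation cs i := (cos (beta i)).

Let sn0 i : 0 < sn i. Proof. exact: sin_angle_gt0. Qed.

(** The vertices are recomputed from the normals with the sign [e] of [Q]. Unit norms, angles and
    incidences then hold exactly; what remains, positive time components and strict half-space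
    inequalities, are finitely many open conditions. *)
Lemma polygon_perturbation (V : R -> 'I_n -> 'rV[R]_3) :
  (forall i, row_cvg (nbhs (0 : R)) (V ^~ i) (v i)) ->
  (\forall s \near (0 : R), forall i, mink (V s i) (V s i) = 1) ->
  (\forall s \near (0 : R), forall i, mink (V s i) (V s (ordS i)) = - cs (ordS i)) ->
  \forall s \near (0 : R), exists2 Q' : polygon R n, polygon_angles beta Q' & normal Q' = V s.
Proof.
move=> Vv V1 Va.
have [e e2 xE] := polygon_vertexE n2 hbeta hQ.
pose X s j := (e / sn j) *: cross (V s (ord_pred j)) (V s j).
have Xx j : row_cvg (nbhs (0 : R)) (X ^~ j) (x j).
  rewrite -(ord_predK j) xE; apply: row_cvgZ; first exact: cvg_cst.
  by rewrite ord_predK; apply: row_cvg_cross; exact: Vv.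
have X0 : \forall s \near (0 : R), forall j, 0 < X s j 0 0.
  apply: (@filter_forall R _ (fun j s => 0 < X s j 0 0) (nbhs (0 : R)) _) => j.
  exact: (cvgr_gt _ (Xx j 0) 0 (vertex_hyp Q j).2).
have Xlt : \forall s \near (0 : R), forall ij : 'I_n * 'I_n,
    ~~ polygon_inc ij.1 ij.2 -> mink (V s ij.1) (X s ij.2) < 0.
  pose lt (ij : 'I_n * 'I_n) s := ~~ polygon_inc ij.1 ij.2 -> mink (V s ij.1) (X s ij.2) < 0.
  apply: (@filter_forall R _ lt (nbhs (0 : R)) _) => -[i j]; rewrite /lt /=.
  have [ij|ij] := boolP (polygon_inc i j); first by near=> s.
  have h : \forall s \near (0 : R), mink (V s i) (X s j) < 0 :=
    cvgr_lt _ (cvg_mink (Vv i) (Xx j)) _ (vertex_halfspace_lt Q ij).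
  by near=> s => _; near: s; exact: h.
near=> s.
have s1 : forall i, mink (V s i) (V s i) = 1 by near: s.
have sa : forall i, mink (V s i) (V s (ordS i)) = - cs (ordS i) by near: s.
have Xhyp j : hyp (X s j).
  split; last by move: j; near: s.
  rewrite /X minkZl minkZr mink_cross_cross !s1 (minkC (V s j)).
  have := sa (ord_pred j); rewrite ord_predK => ->.
  have -> : - cs j * - cs j - 1 * 1 = - sn j ^+ 2 by have := cos2Dsin2 (beta j); lra.
  apply: (@etrans _ _ (- e ^+ 2)); last by rewrite e2.
  by field; rewrite gt_eqF.
have VX i : mink (V s i) (X s i) = 0 by rewrite minkZr minkC mink_cross_r mulr0.
have VXS i : mink (V s i) (X s (ordS i)) = 0.
  by rewrite minkZr minkC ordSK mink_cross_l mulr0.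
have VXlt i j : ~~ polygon_inc i j -> mink (V s i) (X s j) < 0.
  move: i j; suff : forall ij : 'I_n * 'I_n,
    ~~ polygon_inc ij.1 ij.2 -> mink (V s ij.1) (X s ij.2) < 0.
    by move=> h i j; exact: (h (i, j)).
  by near: s.
have [Q' Q'v _] := fan_polygon n2 s1 Xhyp VX VXS VXlt.
exists Q' => // i; apply: mink_dihedral; last by rewrite Q'v sa.
by have := hbeta (ordS i); have := pi_gt0 R; lra.
Unshelve. all: by end_near. Qed.

Lemma perimeterE (W : 'I_n -> R) (Q' : polygon R n) : polygon_angles beta Q' ->
  perimeter W Q' = \sum_j W (ordS j) *
    arcosh ((cs (ordS j) * cs (ordS (ordS j)) - mink (normal Q' j) (normal Q' (ordS (ordS j)))) /
      (sn (ordS j) * sn (ordS (ordS j)))).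
Proof.
move=> hQ'; rewrite /perimeter (reindex_inj (@ordS_inj n)); apply: eq_bigr => j _.
by rewrite /hdist (polygon_edge_mink n2 hbeta hQ').
Qed.

(** Fermat's rule along a curve of normals that keeps the angles. The derivative of [arcosh]
    contributes [edge_sinh] to the denominator, the formula for the edges the two sines. *)
Lemma perimeter_first_variation (W : 'I_n -> R) (V : R -> 'I_n -> 'rV[R]_3)
    (V' : 'I_n -> 'rV[R]_3) :
  min_perimeter_polygon W beta Q ->
  (forall i, V 0 i = v i) -> (forall i, row_derive (V ^~ i) 0 (V' i)) ->
  (\forall s \near (0 : R), forall i, mink (V s i) (V s i) = 1) ->
  (\forall s \near (0 : R), forall i, mink (V s i) (V s (ordS i)) = - cs (ordS i)) ->
  \sum_j W (ordS j) / (sn (ordS j) * sn (ordS (ordS j)) * edge_sinh Q j) *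
    (mink (V' j) (v (ordS (ordS j))) + mink (v j) (V' (ordS (ordS j)))) = 0.
Proof.
move=> [_ Qmin] V0 dV V1 Va.
have Vv i : row_cvg (nbhs (0 : R)) (V ^~ i) (v i) by rewrite -V0; exact: (row_derive_cvg (dV i)).
have Vnear := polygon_perturbation Vv V1 Va.
pose E s j := (cs (ordS j) * cs (ordS (ordS j)) - mink (V s j) (V s (ordS (ordS j)))) /
  (sn (ordS j) * sn (ordS (ordS j))).
pose f s := \sum_j W (ordS j) * arcosh (E s j).
have E0 j : E 0 j = - mink (x (ordS j)) (x (ordS (ordS j))).
  by rewrite (polygon_edge_mink n2 hbeta hQ) /E !V0.
have fmin : \forall s \near (0 : R), f 0 <= f s.
  apply: filterS Vnear => s [Q' Q'b Q'V].
  have := Qmin _ Q'b; rewrite !perimeterE // Q'V.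
  by rewrite /f /E; under [X in _ -> X <= _]eq_bigr do rewrite !V0.
pose dE j := - (mink (V' j) (v (ordS (ordS j))) + mink (v j) (V' (ordS (ordS j)))) /
  (sn (ordS j) * sn (ordS (ordS j))).
have dEE j : is_derive (0 : R) 1 (E ^~ j) (dE j).
  have dm := is_derive_mink (dV j) (dV (ordS (ordS j))); rewrite !V0 in dm.
  have := is_derive_funZ ((sn (ordS j) * sn (ordS (ordS j)))^-1)
    (is_derive_funB (is_derive_fun_cst (cs (ordS j) * cs (ordS (ordS j))) 0) dm).
  rewrite (_ : (fun s => _ * (_ - _)) = E ^~ j); last by apply/funext => s; rewrite /E mulrC.
  by move=> h; apply: (is_derive_eq h); rewrite /dE sub0r mulrC.
have df : is_derive (0 : R) 1 f (\sum_j W (ordS j) * (dE j / edge_sinh Q j)).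
  apply: is_derive_fun_sum => j; apply: is_derive_funZ.
  have E1 : 1 < E 0 j by rewrite E0; exact: (polygon_edge_gt1 n2).
  apply: (is_derive_eq (is_derive_arcosh (f := E ^~ j) E1 (dEE j))).
  by rewrite E0 sqrrN.
have := is_derive_near_min df fmin => /eqP; rewrite -oppr_eq0 -sumrN => /eqP H.
apply: etrans H; apply: eq_bigr => j _; rewrite /dE; field.
by rewrite !gt_eqF // (edge_sinh_gt0 n2).
Qed.

End variation.

(** * The center of a polygon of minimal perimeter *)

Section rational_boost.
Context {R : realType}.
Implicit Types (f : R -> R) (a s t : R).

(** With [t = tanh (a / 2)], these are [cosh a] and [sinh a]. In this parameter the condition that
    fixes an angle is a quadratic equation. *)
Definition boost_c t : R := (1 + t ^+ 2) / (1 - t ^+ 2).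
Definition boost_s t : R := 2 * t / (1 - t ^+ 2).

Lemma boost_hyperbola t : t ^+ 2 < 1 -> boost_c t ^+ 2 - boost_s t ^+ 2 = 1.
Proof.
by move=> t1; rewrite /boost_c /boost_s; field; rewrite subr_eq0 eq_sym lt_eqF.
Qed.

Lemma boost_c0 : boost_c 0 = 1.
Proof. by rewrite /boost_c expr0n /= addr0 subr0 divr1. Qed.

Lemma boost_s0 : boost_s 0 = 0.
Proof. by rewrite /boost_s mulr0 mul0r. Qed.

Lemma is_derive_boost f x a : f x = 0 -> is_derive x 1 f a ->
  is_derive x 1 (fun s => boost_c (f s)) 0 /\ is_derive x 1 (fun s => boost_s (f s)) (2 * a).
Proof.
move=> f0 fa.
have sq : is_derive x 1 (fun s => f s ^+ 2) 0.
  apply: (is_derive_eq (is_derive_funM fa fa)); by rewrite f0 mulr0 mul0r addr0.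
have d : 1 - f x ^+ 2 != 0 by rewrite f0 expr0n subr0 oner_eq0.
have inv := is_derive_funV (f := fun s => 1 - f s ^+ 2) d (is_derive_funB (is_derive_fun_cst 1 x) sq).
split.
  apply: (is_derive_eq (is_derive_funM (is_derive_funD (is_derive_fun_cst 1 x) sq) inv)).
  by ring.
apply: (is_derive_eq (is_derive_funM (is_derive_funZ 2 fa) inv)).
by rewrite f0 expr0n /=; field.
Qed.

(* The root near [0] of [(q - p) T ^+ 2 + 2 r T + (p + q) = 0] when [r < 0],
   written so as to remain regular when [q - p] vanishes. *)
Definition boost_root (p q r : R) : R := (p + q) / (Num.sqrt (r ^+ 2 - q ^+ 2 + p ^+ 2) - r).

Lemma boost_rootP (p q r : R) : r < 0 -> 0 <= r ^+ 2 - q ^+ 2 + p ^+ 2 ->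
  boost_root p q r ^+ 2 < 1 ->
  p + q * boost_c (boost_root p q r) + r * boost_s (boost_root p q r) = 0.
Proof.
move=> r0 d0 T1; set S := Num.sqrt (r ^+ 2 - q ^+ 2 + p ^+ 2).
have S2 : S ^+ 2 = r ^+ 2 - q ^+ 2 + p ^+ 2 by rewrite sqr_sqrtr.
have Sr : S - r != 0 by rewrite gt_eqF // subr_gt0 (lt_le_trans r0) // sqrtr_ge0.
set T := boost_root p q r in T1 *.
have T1' : 1 - T ^+ 2 != 0 by rewrite subr_eq0 eq_sym lt_eqF.
have ET : T * (S - r) = p + q by rewrite /T /boost_root -/S divfK.
have E : (q - p) * T ^+ 2 + 2 * r * T + (p + q) = 0.
  apply: (mulfI (expf_neq0 2 Sr)); rewrite mulr0.
  have -> : (S - r) ^+ 2 * ((q - p) * T ^+ 2 + 2 * r * T + (p + q)) =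
    (q - p) * (T * (S - r)) ^+ 2 + 2 * r * (T * (S - r)) * (S - r) + (p + q) * (S - r) ^+ 2 by ring.
  rewrite ET.
  have -> : (q - p) * (p + q) ^+ 2 + 2 * r * (p + q) * (S - r) + (p + q) * (S - r) ^+ 2 =
    (p + q) * (q ^+ 2 - p ^+ 2 - r ^+ 2 + S ^+ 2) by ring.
  by rewrite S2; ring.
rewrite /boost_c /boost_s.
have -> : p + q * ((1 + T ^+ 2) / (1 - T ^+ 2)) + r * (2 * T / (1 - T ^+ 2)) =
  ((q - p) * T ^+ 2 + 2 * r * T + (p + q)) / (1 - T ^+ 2) by field.
by rewrite E mul0r.
Qed.

Lemma is_derive_boost_root (p q r : R -> R) (p' q' r' x : R) :
  is_derive x 1 p p' -> is_derive x 1 q q' -> is_derive x 1 r r' ->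
  p x + q x = 0 -> r x < 0 ->
  is_derive x 1 (fun s => boost_root (p s) (q s) (r s)) ((p' + q') / (- 2 * r x)).
Proof.
move=> dp dq dr pq r0.
have sqd (f : R -> R) (f' : R) : is_derive x 1 f f' -> is_derive x 1 (fun s => f s ^+ 2) (2 * f' * f x).
  by move=> df; apply: (is_derive_eq (is_derive_funM df df)); ring.
have dd := is_derive_funD (is_derive_funB (sqd _ _ dr) (sqd _ _ dq)) (sqd _ _ dp).
have px : p x = - q x by lra.
have e0 : r x ^+ 2 - q x ^+ 2 + p x ^+ 2 = r x ^+ 2 by rewrite px sqrrN subrK.
have r2 : 0 < r x ^+ 2 by rewrite exprn_even_gt0 //= lt_eqF.
have S0 : Num.sqrt (r x ^+ 2 - q x ^+ 2 + p x ^+ 2) = - r x.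
  by rewrite e0 sqrtr_sqr ltr0_norm.
have ds := is_derive_fun_sqrt (f := fun s => r s ^+ 2 - q s ^+ 2 + p s ^+ 2) _ dd.
rewrite /= e0 in ds; have {}ds := is_derive_funB (ds r2) dr.
have nz : Num.sqrt (r x ^+ 2 - q x ^+ 2 + p x ^+ 2) - r x != 0.
  by rewrite S0 -opprD oppr_eq0 -mulr2n mulrn_eq0 /= lt_eqF.
have := is_derive_funM (is_derive_funD dp dq)
  (is_derive_funV (f := fun s => Num.sqrt (r s ^+ 2 - q s ^+ 2 + p s ^+ 2) - r s) nz ds).
move=> h; apply: (is_derive_eq h); rewrite /= pq mul0r addr0 S0.
by congr (_ * _^-1); ring.
Qed.

End rational_boost.

Section pencil.
Context {R : realType}.
Variables (A B X : 'rV[R]_3) (c s : R).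
Hypotheses (AA : mink A A = 1) (BB : mink B B = 1) (AB : mink A B = - c)
  (XX : mink X X = -1) (AX : mink A X = 0) (BX : mink B X = 0) (cs1 : c ^+ 2 + s ^+ 2 = 1).

(* The lines that meet [A] at a given angle, translated along [A]. *)
Definition pencil t : 'rV[R]_3 :=
  (- c) *: A + boost_c t *: (B + c *: A) + (s * boost_s t) *: X.

Lemma pencil0 : pencil 0 = B.
Proof. by rewrite /pencil boost_c0 boost_s0 mulr0 scale0r addr0 scale1r addrCA scaleNr addNr addr0. Qed.

Lemma mink_pencil_l t : mink A (pencil t) = - c.
Proof. by rewrite /pencil !minkE AA AB AX; ring. Qed.

Lemma mink_pencil t : t ^+ 2 < 1 -> mink (pencil t) (pencil t) = 1.
Proof.
move=> /boost_hyperbola; set b := boost_c t; set d := boost_s t => h.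
have -> : mink (pencil t) (pencil t) = c ^+ 2 + (1 - c ^+ 2) * b ^+ 2 - s ^+ 2 * d ^+ 2.
  rewrite /pencil -/b -/d !minkE (minkC B A) (minkC X A) (minkC X B) AA AB AX BX BB XX.
  by ring.
have -> : 1 - c ^+ 2 = s ^+ 2 by rewrite -cs1; ring.
have -> : c ^+ 2 + s ^+ 2 * b ^+ 2 - s ^+ 2 * d ^+ 2 = c ^+ 2 + s ^+ 2 * (b ^+ 2 - d ^+ 2) by ring.
by rewrite h mulr1.
Qed.

Lemma row_derive_pencil (f : R -> R) x a : f x = 0 -> is_derive x 1 f a ->
  row_derive (fun t => pencil (f t)) x ((2 * s * a) *: X).
Proof.
move=> f0 /(is_derive_boost f0) [dc ds].
have := row_deriveD (row_deriveD (row_derive_cst ((- c) *: A) x) (row_deriveZ (B + c *: A) dc))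
  (row_deriveZ X (is_derive_funZ s ds)).
by rewrite add0r scale0r add0r mulrA (mulrC s).
Qed.

End pencil.

(** * Deformations with fixed angles and the critical equation *)

Section critical_point.
Context {R : realType} {n : nat} (n2 : (2 < n)%N).
Variables (beta W : 'I_n -> R) (Q : polygon R n).
Hypothesis hbeta : forall i, 0 < beta i <= pi / 2.
Hypothesis hmin : min_perimeter_polygon W beta Q.

Local Notation v := (normal Q).
Local Notation x := (vertex Q).
Local Notation sn i := (sin (beta i)).
Local Notation cs i := (cos (beta i)).
Local Notation sh := (edge_sinh Q).

Let hQ : polygon_angles beta Q. Proof. by case: hmin. Qed.
Let sn0 i : 0 < sn i. Proof. exact: sin_angle_gt0. Qed.
Let cs_sn i : cs i ^+ 2 + sn i ^+ 2 = 1. Proof. exact: cos2Dsin2. Qed.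

(* Of four consecutive lines the middle two are moved, keeping all angles. *)
Lemma four_line_curve (j0 : 'I_n) (j1 := ordS j0) (j2 := ordS j1) (j3 := ordS j2) :
  exists V : R -> 'I_n -> 'rV[R]_3,
  [/\ forall i, V 0 i = v i,
      forall i, row_derive (V ^~ i) 0
        ((i == j1)%:R *: ((2 * sn j1) *: x j1) +
         (i == j2)%:R *: ((- (2 * sn j1) * sh j0 / sh j1) *: x j3)),
      \forall s \near (0 : R), forall i, mink (V s i) (V s i) = 1 &
      \forall s \near (0 : R), forall i, mink (V s i) (V s (ordS i)) = - cs (ordS i)].
Proof.
have n1 : (1 < n)%N := ltnW n2.
have vv := normal_unit Q; have va := polygon_normal_mink hQ.
have [XX _] := vertex_hyp Q j1; have [YY _] := vertex_hyp Q j3.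
pose B := pencil (v j0) (v j1) (x j1) (cs j1) (sn j1).
pose C := pencil (v j3) (v j2) (x j3) (cs j3) (sn j3).
(* [B s] and [C T] meet at the angle [beta j2] exactly when [p + q cosh + r sinh = 0], with the
   hyperbolic functions in the rational parameter [T]; hence the choice of [T s] below. *)
pose p s := cs j2 - cs j3 * mink (B s) (v j3).
pose q s := mink (B s) (v j2 + cs j3 *: v j3).
pose r s := sn j3 * mink (B s) (x j3).
pose T s := boost_root (p s) (q s) (r s).
have B0 : B 0 = v j1 by rewrite /B pencil0.
have C0 : C 0 = v j2 by rewrite /C pencil0.
have dB : row_derive B 0 ((2 * sn j1) *: x j1).
  have := row_derive_pencil (v j0) (v j1) (x j1) (cs j1) (sn j1) (erefl (0 : R)) (is_derive_fun_id 0).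
  by rewrite mulr1.
have dBl z : is_derive (0 : R) 1 (fun s => mink (B s) z) (2 * sn j1 * mink (x j1) z).
  apply: (is_derive_eq (is_derive_mink dB (row_derive_cst z 0))).
  by rewrite minkZl mink0r addr0.
have h1 : mink (v j1) (x j3) = - (sn j2 * sh j1) by exact: polygon_height_l.
have h2 : mink (v j2) (x j1) = - (sn j2 * sh j0) by exact: polygon_height_r.
have sh0 j : 0 < sh j by exact: (edge_sinh_gt0 n2).
(* The vertex [j3] lies strictly inside the line [j1]. This sign selects the root of the quadratic
   equation that vanishes at [s = 0]. *)
have r0 : r 0 < 0 by rewrite /r B0 h1; have := mulr_gt0 (sn0 j2) (sh0 j1); have := sn0 j3; nra.
have pq0 : p 0 + q 0 = 0 by rewrite /p /q B0 minkDr minkZr va; ring.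
have dT := is_derive_boost_root
  (is_derive_funB (is_derive_fun_cst (cs j2) 0) (is_derive_funZ (cs j3) (dBl (v j3))))
  (dBl (v j2 + cs j3 *: v j3)) (is_derive_funZ (sn j3) (dBl (x j3))) pq0 r0.
have T0 : T 0 = 0 by rewrite /T /boost_root pq0 mul0r.
have dC := row_derive_pencil (v j3) (v j2) (x j3) (cs j3) (sn j3) T0 dT.
have T1 : \forall s \near (0 : R), T s ^+ 2 < 1.
  have := is_derive_cvg (is_derive_funM dT dT); rewrite -/(T 0) T0 mul0r => cT.
  exact: (cvgr_lt _ cT _ ltr01).
have s1 : \forall s \near (0 : R), s ^+ 2 < 1.
  have := is_derive_cvg (is_derive_funM (is_derive_fun_id 0) (is_derive_fun_id (0 : R))); rewrite mul0r => cT.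
  exact: (cvgr_lt _ cT _ ltr01).
have rneg : \forall s \near (0 : R), r s < 0.
  exact: (cvgr_lt _ (is_derive_cvg (is_derive_funZ (sn j3) (dBl (x j3)))) _ r0).
have dsc : \forall s \near (0 : R), 0 < r s ^+ 2 - q s ^+ 2 + p s ^+ 2.
  have cr := is_derive_cvg (is_derive_funZ (sn j3) (dBl (x j3))).
  have cq := is_derive_cvg (dBl (v j2 + cs j3 *: v j3)).
  have cp := is_derive_cvg (is_derive_funB (is_derive_fun_cst (cs j2) 0)
    (is_derive_funZ (cs j3) (dBl (v j3)))).
  have cc : r s ^+ 2 - q s ^+ 2 + p s ^+ 2 @[s --> (0 : R)] --> r 0 ^+ 2 - q 0 ^+ 2 + p 0 ^+ 2.
    exact: (cvgD (cvgB (cvgM cr cr) (cvgM cq cq)) (cvgM cp cp)).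
  suff d0 : 0 < r 0 ^+ 2 - q 0 ^+ 2 + p 0 ^+ 2 by exact: (cvgr_gt _ cc _ d0).
  have -> : p 0 = - q 0 by lra.
  by rewrite sqrrN subrK exprn_even_gt0 //= lt_eqF.
(* For [n = 3] the outer lines [j0] and [j3] coincide; only the moved lines are kept apart from the
   others. *)
have j12 : j1 != j2 by rewrite eq_sym ordS_neq.
have j31 : j3 != j1 by exact: ordSS_neq.
have j32 : j3 != j2 by exact: ordS_neq.
have j01 : j0 != j1 by rewrite eq_sym ordS_neq.
have j02 : j0 != j2 by rewrite eq_sym; exact: ordSS_neq.
pose V s i := if i == j1 then B s else if i == j2 then C (T s) else v i.
have V1 s : V s j1 = B s by rewrite /V eqxx.
have V2 s : V s j2 = C (T s) by rewrite /V eq_sym (negbTE j12) eqxx.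
have Vn s i : i != j1 -> i != j2 -> V s i = v i by move=> /negbTE i1 /negbTE i2; rewrite /V i1 i2.
have BX : mink (v j1) (x j1) = 0 by exact: polygon_vertex.
have AX : mink (v j0) (x j1) = 0 by exact: polygon_vertexS.
have CY : mink (v j2) (x j3) = 0 by exact: polygon_vertexS.
have DY : mink (v j3) (x j3) = 0 by exact: polygon_vertex.
have DC : mink (v j3) (v j2) = - cs j3 by rewrite minkC va.
exists V; split.
- move=> i; rewrite /V; case: eqP => [->|_]; first exact: B0.
  by case: eqP => [->|//]; rewrite T0.
- move=> i; have [->|i1] := eqVneq i j1.
    rewrite (negbTE j12) scale0r addr0 scale1r; under [V ^~ j1]eq_fun do rewrite V1.
    exact: dB.
  rewrite scale0r add0r; have [->|i2] := eqVneq i j2.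
    rewrite scale1r; under [V ^~ j2]eq_fun do rewrite V2.
    move: dC; rewrite -/C; congr (row_derive _ _ (_ *: _)).
    rewrite -/(r 0) /r B0 h1 minkDr minkZr.
    have e1 : mink (x j1) (v j2) = - (sn j2 * sh j0) by rewrite minkC.
    rewrite e1; field; rewrite !gt_eqF //.
  rewrite scale0r; under [V ^~ i]eq_fun do rewrite Vn //.
  exact: row_derive_cst.
- near=> s => i; have [->|i1] := eqVneq i j1.
    by rewrite V1; apply: mink_pencil => //; near: s.
  have [->|i2] := eqVneq i j2; last by rewrite Vn.
  by rewrite V2; apply: mink_pencil => //; near: s.
- near=> s => i; have [->|i0] := eqVneq i j0.
    by rewrite V1 Vn //; apply: mink_pencil_l => //.
  have [->|i1] := eqVneq i j1.
    rewrite V1 V2 /C /pencil !minkDr !minkZr.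
    have t1 : T s ^+ 2 < 1 by near: s.
    have r1 : r s < 0 by near: s.
    have d1 : 0 < r s ^+ 2 - q s ^+ 2 + p s ^+ 2 by near: s.
    have := boost_rootP r1 (ltW d1) t1; rewrite -/(T s) {1}/p {1}/q {1}/r minkDr minkZr.
    by rewrite -/j2; lra.
  have [->|i2] := eqVneq i j2.
    by rewrite V2 Vn // minkC; apply: mink_pencil_l.
  by rewrite !Vn // (inj_eq (@ordS_inj n)).
Unshelve. all: by end_near. Qed.

Let sum_pick (i : 'I_n) (F : 'I_n -> R) : \sum_j (j == i)%:R * F j = F i.
Proof.
rewrite (bigD1 i) //= eqxx mul1r big1 ?addr0 // => j /negbTE ->.
by rewrite mul0r.
Qed.

(** Moving the lines [j1] and [j2] changes only the lengths of the edges [j0], ..., [j3], so the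
    first variation relates four weights. Its coefficients turn out to be those of the linear
    relation between the four normals. The index [k] is the line preceding [j0], which bounds the
    edge [j0]. *)
Lemma critical_step (q : 'rV[R]_3) (k : 'I_n) (j0 := ordS k) (j1 := ordS j0)
    (j2 := ordS j1) (j3 := ordS j2) :
  mink q (v j0) = W j0 -> mink q (v j1) = W j1 -> mink q (v j2) = W j2 ->
  mink q (v j3) = W j3.
Proof.
move=> q0 q1 q2.
have sh0 j : 0 < sh j by exact: (edge_sinh_gt0 n2).
have [V [V0 dV V1 Va]] := four_line_curve j0.
have := perimeter_first_variation n2 hbeta hQ hmin V0 dV V1 Va.
rewrite -/j1 -/j2 -/j3; set b := 2 * sn j1; set c := - b * sh j0 / sh j1.
pose om j := W (ordS j) / (sn (ordS j) * sn (ordS (ordS j)) * sh j).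
pose G j := mink (x j1) (v (ordS (ordS j))).
have b0 : b != 0 by rewrite mulf_neq0 // ?gt_eqF.
have c0 : c != 0 by rewrite !mulf_neq0 ?oppr_eq0 ?invr_eq0 ?b0 // gt_eqF.
(* Indicators keep the sum correct when some of the four edges coincide, as [j0] and [j3] do for
   [n = 3]. *)
have -> : \sum_j om j *
    (mink ((j == j1)%:R *: (b *: x j1) + (j == j2)%:R *: (c *: x j3)) (v (ordS (ordS j))) +
     mink (v j) ((ordS (ordS j) == j1)%:R *: (b *: x j1) + (ordS (ordS j) == j2)%:R *: (c *: x j3))) =
  \sum_j (j == j1)%:R * (om j * b * mink (x j1) (v (ordS (ordS j)))) +
  \sum_j (j == j2)%:R * (om j * c * mink (x j3) (v (ordS (ordS j)))) +
  \sum_j (j == k)%:R * (om j * b * mink (v j) (x j1)) +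
  \sum_j (j == j0)%:R * (om j * c * mink (v j) (x j3)).
  rewrite -!big_split /=; apply: eq_bigr => j _.
  by rewrite /j2 /j1 !(inj_eq (@ordS_inj n)) !minkE; ring.
rewrite !sum_pick /om -/j1 -/j2 -/j3.
have hk : mink (v k) (x j1) = - (sn j0 * sh k) by exact: polygon_height_l.
have h0l : mink (v j0) (x j2) = - (sn j1 * sh j0) by exact: polygon_height_l.
have h0r : mink (v j2) (x j1) = - (sn j2 * sh j0) by exact: polygon_height_r.
have h1l : mink (v j1) (x j3) = - (sn j2 * sh j1) by exact: polygon_height_l.
have h1r : mink (v j3) (x j2) = - (sn j3 * sh j1) by exact: polygon_height_r.
have h2r : mink (v (ordS j3)) (x j3) = - (sn (ordS j3) * sh j2) by exact: polygon_height_r.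
rewrite hk (minkC (x j3)) h2r (minkC (x j1)) -/j0.
set AY := mink (v j0) (x j3); set DX := mink (v j3) (x j1) => F.
(* These are the coefficients read off from [F]. The combination [r] is orthogonal to three
   independent vertices, hence also to [q]. *)
pose r := (- (b / sn j1)) *: v j0 + (c * AY / (sn j1 * sn j2 * sh j0)) *: v j1 +
  (b * DX / (sn j2 * sn j3 * sh j1)) *: v j2 + (- (c / sn j3)) *: v j3.
have vx := polygon_vertex Q; have vxS := polygon_vertexS Q.
have nz i : sn i != 0 by rewrite gt_eqF.
have nzh i : sh i != 0 by rewrite gt_eqF.
have r1 : mink r (x j1) = 0.
  rewrite /r !minkE vxS vx h0r -/DX /c; field.
  by rewrite !nz !nzh.
have r2 : mink r (x j2) = 0.
  rewrite /r !minkE vxS vx h0l h1r /c; field.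
  by rewrite !nz !nzh.
have r3 : mink r (x j3) = 0.
  rewrite /r !minkE vxS vx h1l -/AY /c; field.
  by rewrite !nz !nzh.
have [s /(_ j1) [l l0 sl]] := fan_orientation n2 (vertex_hyp Q) vx vxS (vertex_halfspace_lt Q).
have det0 : mink (cross (x j1) (x j2)) (x j3) != 0.
  apply/eqP => d0; have := sl (x j3); rewrite d0 mulr0 => /esym/eqP.
  by rewrite h1l mulf_eq0 !oppr_eq0 mulf_eq0 !gt_eqF.
have rq : mink r q = 0.
  have := congr1 (mink r) (cross_cramer (x j1) (x j2) (x j3) q).
  rewrite !minkDr !minkZr r1 r2 r3 !mulr0 !addr0 => /eqP.
  by rewrite mulf_eq0 (negbTE det0) => /eqP.
move: rq; rewrite minkC /r !minkDr !minkZr q0 q1 q2 => rq.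
have : c / sn j3 * (mink q (v j3) - W j3) = 0.
  transitivity ((W j2 / (sn j2 * sn j3 * sh j1) * b * DX +
     W j3 / (sn j3 * sn (ordS j3) * sh j2) * c * - (sn (ordS j3) * sh j2) +
     W j0 / (sn j0 * sn j1 * sh k) * b * - (sn j0 * sh k) +
     W j1 / (sn j1 * sn j2 * sh j0) * c * AY) -
     (- (b / sn j1) * W j0 + c * AY / (sn j1 * sn j2 * sh j0) * W j1 +
     b * DX / (sn j2 * sn j3 * sh j1) * W j2 + - (c / sn j3) * mink q (v j3))); last first.
    by rewrite F rq subrr.
  field; by rewrite !nz !nzh.
move/eqP; rewrite mulf_eq0 (negbTE (_ : c / sn j3 != 0)) /=; last first.
  by rewrite mulf_neq0 // invr_eq0.
by rewrite subr_eq0 => /eqP.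
Qed.

(** The first three normals are independent, so their dual basis gives [q] on three edges;
    [critical_step] carries it around the polygon. *)
Lemma critical_point : exists q, forall i, mink q (v i) = W i.
Proof.
pose i0 : 'I_n := Ordinal (ltnW (ltnW n2)); pose i1 := ordS i0; pose i2 := ordS i1.
have [e e2 xE] := polygon_vertexE n2 hbeta hQ.
pose D := mink (cross (v i0) (v i1)) (v i2).
have D0 : D != 0.
  apply/eqP => D0; have := polygon_vertex_pred n2 Q i1.
  by rewrite minkC xE minkZl -/i1 -/i2 -/D D0 mulr0 ltxx.
pose q := D^-1 *: (W i0 *: cross (v i1) (v i2) + W i1 *: cross (v i2) (v i0) +
  W i2 *: cross (v i0) (v i1)).
have q0 : mink q (v i0) = W i0.
  rewrite /q !(minkZl, minkDl) mink_cross_r mink_cross_l -mink_cross -/D.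
  by rewrite !mulr0 !addr0 mulrC mulfK.
have q1 : mink q (v i1) = W i1.
  rewrite /q !(minkZl, minkDl) mink_cross_r mink_cross_l mink_cross -/D.
  by rewrite !mulr0 add0r addr0 mulrC mulfK.
have q2 : mink q (v i2) = W i2.
  rewrite /q !(minkZl, minkDl) mink_cross_r mink_cross_l -/D.
  by rewrite !mulr0 !add0r mulrC mulfK.
exists q.
have H : forall k, [/\ mink q (v k) = W k, mink q (v (ordS k)) = W (ordS k) &
    mink q (v (ordS (ordS k))) = W (ordS (ordS k))].
  apply: (ordS_cyclic_ind (i0 := i0)) => // k [a b c]; split=> //.
  by rewrite -(ord_predK k) in a b c *; exact: critical_step.
by move=> i; case: (H i).
Qed.

(* [- mink (v i) p] is the hyperbolic sine of the distance from [p] to the edge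
   [i]. *)
Lemma min_perimeter_center : (forall i, 0 < W i) ->
  exists p c, [/\ hyp p, 0 < c & forall i, mink (v i) p = - (c * W i)].
Proof.
move=> W0; have [q qW] := critical_point.
(* As [W > 0], the vector [- q] satisfies all half-space inequalities, hence lies in the cone of the
   vertices and is timelike by [conic_hyp]. The factor sought is the inverse of its length. *)
have [|c c0 yE] := fan_conic n2 (vertex_hyp Q) (polygon_vertex Q) (polygon_vertexS Q)
    (vertex_halfspace_lt Q) (y := - q).
  by move=> i; rewrite minkNr minkC qW oppr_le0 ltW.
pose i0 : 'I_n := Ordinal (ltnW (ltnW n2)).
have S0 : 0 < \sum_i c i.
  rewrite lt_neqAle sumr_ge0 // andbT eq_sym psumr_eq0 //; apply/negP => /allP h.
  have q0 : - q = 0.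
    rewrite yE big1 // => i _; have := h i (mem_index_enum i) => /eqP ->.
    by rewrite scale0r.
  by have := W0 i0; rewrite -qW -[q]opprK q0 oppr0 mink0l ltxx.
have := conic_hyp (vertex_hyp Q) c0; rewrite -yE => le.
have qq : 0 < - mink (- q) (- q) by apply: lt_le_trans le; rewrite exprn_gt0.
have m0 : 0 < Num.sqrt (- mink (- q) (- q)) by rewrite sqrtr_gt0.
have m2 : Num.sqrt (- mink (- q) (- q)) ^+ 2 = - mink (- q) (- q) by rewrite sqr_sqrtr // ltW.
set m := Num.sqrt _ in m0 m2.
exists (m^-1 *: - q), m^-1; split.
- split; last first.
    rewrite mxE mulr_gt0 ?invr_gt0 // yE summxE.
    rewrite lt_neqAle sumr_ge0 ?andbT; last first.
      by move=> i _; rewrite mxE mulr_ge0 // ltW // (vertex_hyp Q i).2.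
    rewrite eq_sym psumr_eq0; last first.
      by move=> i _; rewrite mxE mulr_ge0 // ltW // (vertex_hyp Q i).2.
    apply/negP => /allP h; move: S0; rewrite big1 ?ltxx // => i _.
    have := h i (mem_index_enum i); rewrite mxE mulf_eq0 => /orP[/eqP//|].
    by rewrite gt_eqF // (vertex_hyp Q i).2.
  rewrite minkZl minkZr; apply: (mulfI (expf_neq0 2 (lt0r_neq0 m0))).
  have -> : mink (- q) (- q) = - m ^+ 2 by lra.
  by field; rewrite gt_eqF.
- by rewrite invr_gt0.
- by move=> i; rewrite minkZr minkNr minkC qW mulrN.
Qed.

End critical_point.

(** * Total turning of the lateral directions *)

Section turning.
Context {R : realType} {n : nat} (n2 : (2 < n)%N).

Definition ord_first : 'I_n := Ordinal (ltnW (ltnW n2)).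

Lemma iter_ord_first (i : 'I_n) : iter i (@ordS n) ord_first = i.
Proof. by apply: val_inj => /=; rewrite val_iter_ordS add0n modn_small. Qed.

Definition turn (C : 'I_n -> R) (k : nat) : R :=
  \sum_(j < k) acos (C (iter j (@ordS n) ord_first)).

Lemma turn0 C : turn C 0 = 0. Proof. by rewrite /turn big_ord0. Qed.

Lemma turnS C k : turn C k.+1 = turn C k + acos (C (iter k (@ordS n) ord_first)).
Proof. by rewrite /turn big_ord_recr. Qed.

Lemma turn_total C : turn C n = \sum_i acos (C i).
Proof. by apply: eq_bigr => i _; rewrite iter_ord_first. Qed.

Lemma cos_eq1 (t : R) : 0 <= t <= pi -> cos t = 1 -> t = 0.
Proof.
move=> /andP[t0 tpi] ct; apply: cos_inj; rewrite ?in_itv /= ?t0 ?tpi ?lexx ?pi_ge0 //.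
by rewrite ct cos0.
Qed.

Variables (a b : 'I_n -> R).
Let C i := a i * a (ordS i) + b i * b (ordS i).
Let D i := a i * b (ordS i) - b i * a (ordS i).
Hypotheses (ab1 : forall i, a i ^+ 2 + b i ^+ 2 = 1) (C_gtN1 : forall i, -1 < C i)
  (a0 : a ord_first = 1) (b0 : b ord_first = 0) (b1 : 0 < b (ordS ord_first)).
Hypothesis not_conic : forall i k (r s : R), i != k -> i != ordS k -> 0 <= r -> 0 <= s ->
  ~ (a i = r * a k + s * a (ordS k) /\ b i = r * b k + s * b (ordS k)).

Let CD i : C i ^+ 2 + D i ^+ 2 = 1.
Proof.
rewrite -[RHS](mulr1 1) -{1}(ab1 i) -(ab1 (ordS i)) /C /D; ring.
Qed.

Let aS i : a (ordS i) = C i * a i - D i * b i.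
Proof. by rewrite -[LHS]mulr1 -(ab1 i) /C /D; ring. Qed.

Let bS i : b (ordS i) = C i * b i + D i * a i.
Proof. by rewrite -[LHS]mulr1 -(ab1 i) /C /D; ring. Qed.

Let n1 : (1 < n)%N. Proof. exact: ltnW. Qed.

Let D_neq0 i : D i != 0.
Proof.
apply/eqP => Di; have C1 : C i = 1.
  have := CD i; rewrite Di expr0n addr0 => /eqP; rewrite sqrf_eq1 => /orP[/eqP//|/eqP Ci].
  by have := C_gtN1 i; rewrite Ci ltxx.
have ik : ordS i != ord_pred i.
  by rewrite -{1}(ord_predK i); apply: ordSS_neq.
apply: (not_conic (i := ordS i) (k := ord_pred i) (r := 0) (s := 1)) => //.
  by rewrite ord_predK ordS_neq.
by rewrite ord_predK !mul0r !mul1r !add0r aS bS C1 Di; split; ring.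
Qed.

(** In the linear relation between three consecutive planar directions, a change of orientation puts
    the last one into the sector of the first two, or the first one into the sector of the last two;
    [not_conic] excludes both. *)
Let D_same_sign i : 0 < D i * D (ordS i).
Proof.
set d := D i; set d' := D (ordS i).
pose d'' := a (ordS (ordS i)) * b i - b (ordS (ordS i)) * a i.
have ea : d * a (ordS (ordS i)) + d' * a i + d'' * a (ordS i) = 0 by rewrite /d /d' /d'' /D; ring.
have eb : d * b (ordS (ordS i)) + d' * b i + d'' * b (ordS i) = 0 by rewrite /d /d' /d'' /D; ring.
have i2 : ordS (ordS i) != i by exact: ordSS_neq.
have i1 : ordS (ordS i) != ordS i by exact: ordS_neq.
have i1' : i != ordS i by rewrite eq_sym ordS_neq.
have i2' : i != ordS (ordS i) by rewrite eq_sym.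
have K1 (r s : R) : 0 <= r -> 0 <= s -> a (ordS (ordS i)) = r * a i + s * a (ordS i) ->
  b (ordS (ordS i)) = r * b i + s * b (ordS i) -> False.
  by move=> r0 s0 e1 e2; apply: (not_conic (i := ordS (ordS i)) (k := i) (r := r) (s := s)).
have K2 (r s : R) : 0 <= r -> 0 <= s -> a i = r * a (ordS i) + s * a (ordS (ordS i)) ->
  b i = r * b (ordS i) + s * b (ordS (ordS i)) -> False.
  by move=> r0 s0 e1 e2; apply: (not_conic (i := i) (k := ordS i) (r := r) (s := s)).
have dn : d != 0 := D_neq0 i; have dn' : d' != 0 := D_neq0 (ordS i).
have sa : a (ordS (ordS i)) = (- d' / d) * a i + (- d'' / d) * a (ordS i).
  apply: (mulfI dn); transitivity (- (d' * a i + d'' * a (ordS i))); first by lra.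
  by field.
have sb : b (ordS (ordS i)) = (- d' / d) * b i + (- d'' / d) * b (ordS i).
  apply: (mulfI dn); transitivity (- (d' * b i + d'' * b (ordS i))); first by lra.
  by field.
have ta : a i = (- d'' / d') * a (ordS i) + (- d / d') * a (ordS (ordS i)).
  apply: (mulfI dn'); transitivity (- (d'' * a (ordS i) + d * a (ordS (ordS i)))); first by lra.
  by field.
have tb : b i = (- d'' / d') * b (ordS i) + (- d / d') * b (ordS (ordS i)).
  apply: (mulfI dn'); transitivity (- (d'' * b (ordS i) + d * b (ordS (ordS i)))); first by lra.
  by field.
rewrite ltNge; apply/negP => dd.
have {}dd : d * d' < 0 by rewrite lt_neqAle dd andbT mulf_neq0.
have nd : 0 < - d' / d.
  have -> : - d' / d = - (d * d') / d ^+ 2 by field.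
  by rewrite divr_gt0 ?oppr_gt0 // exprn_even_gt0.
have nd' : 0 < - d / d'.
  have -> : - d / d' = - (d * d') / d' ^+ 2 by field.
  by rewrite divr_gt0 ?oppr_gt0 // exprn_even_gt0.
have [h|h] := leP 0 (- d'' / d); first exact: (K1 _ _ (ltW nd) h sa sb).
apply: (K2 _ _ _ (ltW nd') ta tb).
have -> : - d'' / d' = (- d'' / d) * - (- d / d') by field; rewrite dn dn'.
by rewrite mulr_le0 ?oppr_le0 ?ltW.
Qed.

Lemma turn_orientation i : 0 < D i.
Proof.
have D0 : 0 < D ord_first by rewrite /D a0 b0 mul1r mul0r subr0.
move: i; apply: (ordS_cyclic_ind (i0 := ord_first)) => // i Di.
by have := D_same_sign i; rewrite pmulr_rgt0.
Qed.

Let C_lt1 i : C i < 1.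
Proof.
have := CD i; have : 0 < D i ^+ 2 by rewrite exprn_even_gt0 //= D_neq0.
by rewrite !expr2; nra.
Qed.

Let Citv i : -1 <= C i <= 1.
Proof. by rewrite (ltW (C_gtN1 i)) (ltW (C_lt1 i)). Qed.

Let cosC i : cos (acos (C i)) = C i. Proof. by rewrite acosK // in_itv /= Citv. Qed.

Let sinC i : sin (acos (C i)) = D i.
Proof.
rewrite sin_acos ?Citv // -(CD i) (addrC (C i ^+ 2)) addrK sqrtr_sqr gtr0_norm //.
exact: turn_orientation.
Qed.

Let acosC_gt0 i : 0 < acos (C i). Proof. by rewrite acos_gt0 // C_lt1 (ltW (C_gtN1 i)). Qed.
Let acosC_ltpi i : acos (C i) < pi. Proof. by rewrite acos_ltpi // C_gtN1 (ltW (C_lt1 i)). Qed.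

Lemma turn_iter k : a (iter k (@ordS n) ord_first) = cos (turn C k) /\
  b (iter k (@ordS n) ord_first) = sin (turn C k).
Proof.
elim: k => [|k [IHa IHb]]; first by rewrite turn0 cos0 sin0.
by rewrite turnS cosD sinD cosC sinC -IHa -IHb /= aS bS; split; ring.
Qed.

Lemma turn_direction i : a i = cos (turn C i) /\ b i = sin (turn C i).
Proof. by rewrite -{1 3}(iter_ord_first i); exact: turn_iter. Qed.

Let turn_lt k : turn C k < turn C k.+1. Proof. by rewrite turnS ltrDl. Qed.

(** The directions return to the start, so the total is a positive multiple of [2 pi]. If it
    exceeded [2 pi], the initial direction would be passed again between two others and lie in their
    sector, against [not_conic]. *)
Lemma turn_closes : \sum_i acos (C i) = 2 * pi.
Proof.
rewrite -turn_total.
have pi0 := pi_gt0 R.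
have cosn : cos (turn C n) = 1.
  have [<- _] := turn_iter n; have -> : iter n (@ordS n) ord_first = ord_first; last exact: a0.
  by apply/eqP; rewrite (iter_ordS_eq n 0) modnn mod0n.
have posn k : 0 < turn C k.+1.
  by elim: k => [|k IH]; [rewrite -(turn0 C)|apply: lt_trans IH _].
have n0 : 0 < turn C n by rewrite -(prednK (ltnW n1)).
apply/eqP; rewrite eq_le; apply/andP; split; last first.
  rewrite leNgt; apply/negP => lt.
  have [le|gt] := leP (turn C n) pi.
    by have := cos_eq1 _ cosn; rewrite (ltW n0) le => /(_ isT) e; rewrite e ltxx in n0.
  have : cos (2 * pi - turn C n) = 1.
    have -> : 2 * pi - turn C n = - turn C n + pi + pi by ring.
    by rewrite !cosDpi opprK cosN.
  by move=> /cos_eq1 h; have : 2 * pi - turn C n = 0; [apply: h; lra|lra].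
rewrite leNgt; apply/negP => gt.
(* Each turn is less than [pi], so [3 pi] in total ensures that [2 pi] is passed before the last
   turn, hence in a sector not bounded by the initial direction. *)
have n3 : 3 * pi <= turn C n.
  rewrite leNgt; apply/negP => lt3.
  have : cos (turn C n - 2 * pi) = 1.
    have e : turn C n = (turn C n - 2 * pi) + pi + pi by ring.
    by move: cosn; rewrite {1}e !cosDpi opprK.
  by move=> /cos_eq1 h; have : turn C n - 2 * pi = 0; [apply: h; lra|lra].
have [m nE] : exists m, n = m.+3 by exists (n - 3)%N; rewrite -{1}(subnK n2) addn3.
have hn1 : 2 * pi - turn C (1 + m.+1) <= 0.
  have := acosC_ltpi (iter m.+2 (@ordS n) ord_first).
  have := turnS C m.+2; rewrite -nE add1n => e.
  by lra.
have h1 : 0 <= 2 * pi - turn C 1.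
  by have := acosC_ltpi ord_first; rewrite turnS turn0 /=; lra.
have [k [/andP[k1 km] hk hk1]] := nat_sign_change (h := fun k => 2 * pi - turn C k) h1 hn1.
rewrite add1n ltnS in km.
set A := 2 * pi - turn C k in hk; set B := - (2 * pi - turn C k.+1).
have B0 : 0 <= B by rewrite /B; lra.
pose j := iter k (@ordS n) ord_first.
have AB : A + B = acos (C j) by rewrite /A /B turnS; ring.
have [ak bk] := turn_iter k; have [ak1 bk1] := turn_iter k.+1.
have tk : turn C k = - A + pi + pi by rewrite /A; ring.
have tk1 : turn C k.+1 = B + pi + pi by rewrite /B; ring.
rewrite tk cosDpi cosDpi opprK cosN in ak.
rewrite tk sinDpi sinDpi opprK sinN in bk.
rewrite tk1 cosDpi cosDpi opprK /= in ak1.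
rewrite tk1 sinDpi sinDpi opprK /= in bk1.
have sAB : 0 < sin (A + B) by rewrite AB sinC turn_orientation.
have ABpi : A + B < pi by rewrite AB.
have sA : 0 <= sin A by apply: sin_ge0_pi; lra.
have sB : 0 <= sin B by apply: sin_ge0_pi; lra.
have kn : (k < n)%N by rewrite nE (leq_ltn_trans km).
have kn1 : (k.+1 < n)%N by rewrite nE.
(* The initial direction is at angle [A] from the direction [k] and at angle [B] from [k + 1]; the
   coefficients are those of the law of sines. *)
apply: (not_conic (i := ord_first) (k := j) (r := sin B / sin (A + B)) (s := sin A / sin (A + B))).
- by rewrite eq_sym (iter_ordS_eq k 0) mod0n modn_small // -lt0n.
- by rewrite eq_sym (iter_ordS_eq k.+1 0) mod0n modn_small.
- by rewrite divr_ge0 // ltW.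
- by rewrite divr_ge0 // ltW.
rewrite ak bk ak1 bk1 a0 b0; split; last by ring.
apply: (mulfI (lt0r_neq0 sAB)); rewrite mulr1 {1}sinD.
by field; rewrite gt_eqF.
Qed.

End turning.

(** * Normal form of a fan of facets *)

Section frames.
Context {R : realType} {d : nat}.
Implicit Types (f : 'I_d.+1 -> 'rV[R]_d.+1) (x y : 'rV[R]_d.+1).

Definition lorentz_sign (i : 'I_d.+1) : R := if i == 0 then -1 else 1.

Lemma mink_lorentz_sign x y : mink x y = \sum_i lorentz_sign i * (x 0 i * y 0 i).
Proof.
by rewrite /mink big_ord_recl mulN1r; congr (_ + _); apply: eq_bigr => i _; rewrite mul1r.
Qed.

Definition lorentz_frame f := forall i j, mink (f i) (f j) = lorentz_sign i * (i == j)%:R.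

(** Orthonormality says that the matrix of the frame has a one-sided inverse, which is two-sided; so
    the frame spans. *)
Lemma lorentz_frame_decomp f x : lorentz_frame f ->
  x = \sum_i (lorentz_sign i * mink x (f i)) *: f i.
Proof.
move=> fP.
pose J : 'M[R]_d.+1 := diag_mx (\row_i lorentz_sign i).
pose M : 'M[R]_d.+1 := \matrix_(i, j) f i 0 j.
have JJ : J *m J = 1%:M.
  rewrite /J mulmx_diag -diag_const_mx; congr diag_mx; apply/rowP => i; rewrite !mxE.
  by rewrite /lorentz_sign; case: ifP => _; rewrite ?mulrNN mulr1.
have MJM : M *m J *m M^T = J.
  apply/matrixP => i j; rewrite /J mul_mx_diag !mxE -(mulr1n (lorentz_sign i)).
  transitivity (mink (f i) (f j)); last by rewrite fP mulr_natr mulr1n.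
  by rewrite mink_lorentz_sign; apply: eq_bigr => k _; rewrite !mxE; ring.
have inv : (M *m J) *m (M^T *m J) = 1%:M by rewrite mulmxA MJM JJ.
have {}inv := mulmx1C inv.
have : x *m J *m (M^T *m J *m (M *m J)) *m J = x by rewrite inv mulmx1 -mulmxA JJ mulmx1.
rewrite !mulmxA -[in LHS]mulmxA JJ mulmx1 => {1}<-.
rewrite mulmx_sum_row; apply: eq_bigr => i _; congr (_ *: _); last first.
  by apply/rowP => j; rewrite !mxE.
rewrite /J mul_mx_diag !mxE mulrC mink_lorentz_sign; congr (_ * _).
by apply: eq_bigr => k _; rewrite mul_mx_diag !mxE; ring.
Qed.

(** The Lorentz transformation taking the frame [f] to the standard basis; it moves a body to a
    comparable position without changing distances. *)
Definition frame_coord f x : 'rV[R]_d.+1 := \row_i (lorentz_sign i * mink x (f i)).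

Lemma mink_frame_coord f x y : lorentz_frame f -> mink (frame_coord f x) (frame_coord f y) = mink x y.
Proof.
move=> fP; rewrite [in RHS](lorentz_frame_decomp x fP) mink_suml mink_lorentz_sign.
apply: eq_bigr => i _; rewrite !mxE minkZl (minkC _ y) /lorentz_sign.
by case: ifP => _; ring.
Qed.

Lemma hyp_frame_coord f x : lorentz_frame f -> hyp (f 0) -> hyp x -> hyp (frame_coord f x).
Proof.
move=> fP h0 hx; split; first by rewrite mink_frame_coord //; case: hx.
by rewrite mxE /lorentz_sign eqxx mulN1r (lt_le_trans ltr01) // hyp_mink_ge1.
Qed.

End frames.

Section vec4.
Context {R : realType}.

Definition vec4 (p q r s : R) : 'rV[R]_4 := \row_(k < 4) nth 0 [:: p; q; r; s] k.

Lemma mink_vec4 (p q r s p' q' r' s' : R) :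
  mink (vec4 p q r s) (vec4 p' q' r' s') = - (p * p') + (q * q' + (r * r' + s * s')).
Proof. by rewrite /mink !big_ord_recl big_ord0 !mxE /= addr0. Qed.

Definition frame4 (p a b e : 'rV[R]_4) (i : 'I_4) : 'rV[R]_4 := nth 0 [:: p; a; b; e] i.

Lemma frame4P (p a b e : 'rV[R]_4) : mink p p = -1 -> mink a a = 1 -> mink b b = 1 ->
  mink e e = 1 -> mink p a = 0 -> mink p b = 0 -> mink p e = 0 -> mink a b = 0 ->
  mink a e = 0 -> mink b e = 0 -> lorentz_frame (frame4 p a b e).
Proof.
move=> pp aa bb ee pa pb pe ab ae be.
by move=> [[|[|[|[|//]]]] i] [[|[|[|[|//]]]] j]; rewrite /frame4 /lorentz_sign -!val_eqE /=;
  rewrite ?mulr0 ?mulr1 // minkC.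
Qed.

Lemma frame_coord4 (p a b e x : 'rV[R]_4) :
  frame_coord (frame4 p a b e) x = vec4 (- mink x p) (mink x a) (mink x b) (mink x e).
Proof.
by apply/rowP => -[[|[|[|[|//]]]] i]; rewrite !mxE /lorentz_sign -val_eqE /= ?mulN1r ?mul1r.
Qed.

End vec4.

Section normal_form.
Context {R : realType} {n : nat}.
Variables (c tau eps : 'I_n -> R).

(** If a unit normal has products [- tau i] and [- eps i] with [p] and [e], this is the length of
    its projection orthogonal to both; [proj_cos i] is then the cosine of the angle between the
    projections [i] and [i + 1]. *)
Definition proj_norm i : R := Num.sqrt (1 + tau i ^+ 2 - eps i ^+ 2).

Definition proj_cos i : R :=
  (tau i * tau (ordS i) - eps i * eps (ordS i) - c (ordS i)) / (proj_norm i * proj_norm (ordS i)).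

Variable n2 : (2 < n)%N.

(** At the last index, [ordS i] restarts at turn 0, which gives the same direction as the full turn
    [2 pi]. *)
Definition direction_det (i : 'I_n) : R :=
  cos (turn n2 proj_cos i) * sin (turn n2 proj_cos (ordS i)) -
  sin (turn n2 proj_cos i) * cos (turn n2 proj_cos (ordS i)).

(* Klein coordinates of the vertex on the facets [i], [i + 1] at height [b]. *)
Definition klein_height (b : R) (i : 'I_n) : R := (tau i + eps i * b) / proj_norm i.

Definition klein_x (b : R) (i : 'I_n) : R :=
  (klein_height b i * sin (turn n2 proj_cos (ordS i)) -
   klein_height b (ordS i) * sin (turn n2 proj_cos i)) / direction_det i.

Definition klein_y (b : R) (i : 'I_n) : R :=
  (klein_height b (ordS i) * cos (turn n2 proj_cos i) -
   klein_height b i * cos (turn n2 proj_cos (ordS i))) / direction_det i.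

Definition klein_gap (b : R) (i : 'I_n) : R := 1 - klein_x b i ^+ 2 - klein_y b i ^+ 2 - b ^+ 2.

Definition klein_vertex (b : R) (i : 'I_n) : 'rV[R]_4 :=
  (Num.sqrt (klein_gap b i))^-1 *: vec4 1 (klein_x b i) (klein_y b i) b.

Variables (p e : 'rV[R]_4) (u : 'I_n -> 'rV[R]_4).
Hypotheses (pp : mink p p = -1) (ee : mink e e = 1) (pe : mink p e = 0)
  (uu : forall i, mink (u i) (u i) = 1)
  (uS : forall i, mink (u i) (u (ordS i)) = - c (ordS i))
  (up : forall i, mink (u i) p = - tau i) (ue : forall i, mink (u i) e = - eps i)
  (eps1 : forall i, eps i ^+ 2 < 1) (cos_gtN1 : forall i, -1 < proj_cos i).
Hypothesis not_conic : forall i k (r s l m : R), i != k -> i != ordS k -> 0 <= r -> 0 <= s ->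
  u i <> r *: u k + s *: u (ordS k) + l *: p + m *: e.

Let k0 i : 0 < proj_norm i.
Proof. by rewrite sqrtr_gt0; have := eps1 i; have := sqr_ge0 (tau i); lra. Qed.

Let k2 i : proj_norm i ^+ 2 = 1 + tau i ^+ 2 - eps i ^+ 2.
Proof. by rewrite sqr_sqrtr //; have := eps1 i; have := sqr_ge0 (tau i); lra. Qed.

Let nu i := (proj_norm i)^-1 *: (u i - tau i *: p + eps i *: e).

Let nuE i : u i = proj_norm i *: nu i + tau i *: p - eps i *: e.
Proof.
rewrite /nu scalerA divff ?scale1r ?gt_eqF //.
by apply/rowP => j; rewrite !mxE; ring.
Qed.

Let nup i : mink (nu i) p = 0.
Proof. by rewrite /nu !minkE up pp (minkC e) pe; ring. Qed.

Let nue i : mink (nu i) e = 0.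
Proof. by rewrite /nu !minkE ue ee pe; ring. Qed.

Let nunu i j : mink (nu i) (nu j) =
  (mink (u i) (u j) + tau i * tau j - eps i * eps j) / (proj_norm i * proj_norm j).
Proof.
rewrite {2}/nu minkZr minkDr minkBr !minkZr nup nue !mulr0 subr0 addr0.
rewrite /nu minkZl minkDl minkBl !minkZl (minkC p) (minkC e) up ue.
by field; rewrite !gt_eqF.
Qed.

Let nu1 i : mink (nu i) (nu i) = 1.
Proof.
rewrite nunu uu -!expr2 -k2 divff // expf_neq0 // gt_eqF //.
Qed.

Let nuS i : mink (nu i) (nu (ordS i)) = proj_cos i.
Proof. by rewrite nunu uS /proj_cos; congr (_ / _); ring. Qed.

Let nu_not_conic i k (r s : R) : i != k -> i != ordS k -> 0 <= r -> 0 <= s ->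
  nu i <> r *: nu k + s *: nu (ordS k).
Proof.
move=> ik ikS r0 s0 E.
pose r' := proj_norm i * r / proj_norm k; pose s' := proj_norm i * s / proj_norm (ordS k).
apply: (not_conic (r := r') (s := s')
  (l := tau i - r' * tau k - s' * tau (ordS k))
  (m := - eps i + r' * eps k + s' * eps (ordS k)) ik ikS).
- by rewrite divr_ge0 ?mulr_ge0 // ltW.
- by rewrite divr_ge0 ?mulr_ge0 // ltW.
rewrite {1}nuE E (nuE k) (nuE (ordS k)).
apply/rowP => j; rewrite !mxE /r' /s'; field.
by rewrite !gt_eqF.
Qed.

Let i0 := ord_first n2.
Let i1 := ordS i0.

Let cos_lt1 i : proj_cos i < 1.
Proof.
have pnu j : mink p (nu j) = 0 by rewrite minkC.
rewrite ltNge; apply/negP => ge1.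
have := mink_orth_cauchy_schwarz pp (pnu i) (pnu (ordS i)); rewrite !nu1 nuS mulr1 => le1.
have {ge1 le1}C1 : proj_cos i = 1 by move: le1; rewrite expr2; nra.
have : mink p (nu (ordS i) - nu i) = 0 by rewrite minkBr !pnu subrr.
move=> /(mink_orth_ge0 pp) [_]; rewrite !minkBl !minkBr !nu1 (minkC (nu (ordS i))) nuS C1.
rewrite !subrr eqxx => /esym; rewrite subr_eq0 => /eqP E.
apply: (nu_not_conic (i := ordS i) (k := ord_pred i) (r := 0) (s := 1)) => //.
- by rewrite -{1}(ord_predK i); exact: ordSS_neq.
- by rewrite ord_predK ordS_neq // ltnW.
- by rewrite ord_predK scale0r add0r scale1r.
Qed.

(** Gram-Schmidt on the projections of the first two normals fixes [f1] and [f2], with the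
    orientation in which the second direction is a positive turn. All normals are then determined by
    [c], [tau] and [eps]. *)
Lemma fan_normal_form : exists f1 f2, [/\ lorentz_frame (frame4 p f1 f2 e),
  forall i, mink (u i) f1 = proj_norm i * cos (turn n2 proj_cos i) /\
            mink (u i) f2 = proj_norm i * sin (turn n2 proj_cos i),
  forall i, 0 < direction_det i, forall i, -1 < proj_cos i < 1 &
  \sum_i acos (proj_cos i) = 2 * pi].
Proof.
move: nuE nup nue nunu nu1 nuS nu_not_conic.
move: (nu) => w wE wp we ww w1 wS w_not_conic.
have C2 : 0 < 1 - proj_cos i0 ^+ 2.
  by have := cos_gtN1 i0; have := cos_lt1 i0; rewrite expr2; nra.
set S := Num.sqrt (1 - proj_cos i0 ^+ 2).
have S0 : 0 < S by rewrite sqrtr_gt0.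
have S2 : S ^+ 2 = 1 - proj_cos i0 ^+ 2 by rewrite sqr_sqrtr // ltW.
pose f1 := w i0; pose f2 := S^-1 *: (w i1 - proj_cos i0 *: w i0).
have f22 : mink f2 f2 = 1.
  rewrite /f2 !minkE !w1 (minkC (w i1)) wS.
  apply: (mulfI (expf_neq0 2 (lt0r_neq0 S0))); rewrite mulr1 [in RHS]S2.
  by field; rewrite gt_eqF.
have f12 : mink f1 f2 = 0 by rewrite /f1 /f2 !minkE w1 wS; ring.
have pf1 : mink p f1 = 0 by rewrite minkC wp.
have ef1 : mink e f1 = 0 by rewrite minkC we.
have pf2 : mink p f2 = 0 by rewrite minkC /f2 !minkE !wp; ring.
have ef2 : mink e f2 = 0 by rewrite minkC /f2 !minkE !we; ring.
have fr : lorentz_frame (frame4 p f1 f2 e).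
  by apply: frame4P => //; [exact: w1|rewrite minkC|rewrite minkC].
pose a i := mink (w i) f1; pose b i := mink (w i) f2.
have wab i j : mink (w i) (w j) = a i * a j + b i * b j.
  rewrite -(mink_frame_coord (w i) (w j) fr) !frame_coord4 mink_vec4 !wp !we.
  by rewrite -/(a i) -/(a j) -/(b i) -/(b j); ring.
have wE2 i : w i = a i *: f1 + b i *: f2.
  rewrite {1}(lorentz_frame_decomp (w i) fr) !big_ord_recl big_ord0 addr0 /frame4 /lorentz_sign /=.
  by rewrite wp we !mul1r !mulr0 !scale0r add0r addr0.
have ab1 i : a i ^+ 2 + b i ^+ 2 = 1 by rewrite -(w1 i) wab !expr2.
have abC i : a i * a (ordS i) + b i * b (ordS i) = proj_cos i by rewrite -wS wab.
have ab_gtN1 i : -1 < a i * a (ordS i) + b i * b (ordS i) by rewrite abC.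
have a0 : a i0 = 1 by exact: w1.
have b0 : b i0 = 0 by exact: f12.
have b1 : 0 < b i1.
  have -> : b i1 = S; last by [].
  rewrite /b /f2 minkZr minkBr minkZr w1 (minkC (w i1)) wS -expr2 -S2.
  by field; rewrite gt_eqF.
have ab_not_conic i k (r s : R) : i != k -> i != ordS k -> 0 <= r -> 0 <= s ->
    ~ (a i = r * a k + s * a (ordS k) /\ b i = r * b k + s * b (ordS k)).
  move=> ik ikS r0 s0 [ea eb]; apply: (w_not_conic _ _ _ _ ik ikS r0 s0).
  by rewrite !wE2 ea eb; apply/rowP => j; rewrite !mxE; ring.
have CE : (fun i => a i * a (ordS i) + b i * b (ordS i)) = proj_cos by apply/funext.
have dir := turn_direction ab1 ab_gtN1 a0 b0 b1 ab_not_conic.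
have ori := turn_orientation ab1 ab_gtN1 a0 b0 b1 ab_not_conic.
have clo := turn_closes ab1 ab_gtN1 a0 b0 b1 ab_not_conic.
rewrite CE in dir.
exists f1, f2; split=> //.
- move=> i; have [<- <-] := dir i.
  have U z : mink p z = 0 -> mink e z = 0 -> mink (u i) z = proj_norm i * mink (w i) z.
    by move=> pz ez; rewrite wE minkBl minkDl !minkZl pz ez !mulr0 subr0 addr0.
  by rewrite !U.
- move=> i; have [ai bi] := dir i; have [aj bj] := dir (ordS i).
  by rewrite /direction_det -ai -bi -aj -bj.
- by move=> i; rewrite cos_gtN1 cos_lt1.
- by rewrite -clo; apply: eq_bigr => i _; rewrite abC.
Qed.

End normal_form.

(** * Vertices in Klein coordinates and their limits *)

Section klein.
Context {R : realType} {n : nat} (n2 : (2 < n)%N).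
Variables (c : 'I_n -> R).

(** Divided by the time coordinate [- mink x p], the two facet equations form a linear system for
    the horizontal Klein coordinates, solved by Cramer's rule; [mink x x = -1] recovers the time
    coordinate from [klein_gap]. *)
Lemma klein_vertexE (tau eps : 'I_n -> R) (p f1 f2 e x : 'rV[R]_4) (u : 'I_n -> 'rV[R]_4)
    (i : 'I_n) (b : R) :
  (forall i, mink (u i) p = - tau i) -> (forall i, mink (u i) e = - eps i) ->
  (forall i, 0 < proj_norm tau eps i) -> lorentz_frame (frame4 p f1 f2 e) ->
  (forall i, mink (u i) f1 = proj_norm tau eps i * cos (turn n2 (proj_cos c tau eps) i) /\
             mink (u i) f2 = proj_norm tau eps i * sin (turn n2 (proj_cos c tau eps) i)) ->
  (forall i, 0 < direction_det c tau eps n2 i) ->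
  hyp p -> hyp x -> mink (u i) x = 0 -> mink (u (ordS i)) x = 0 -> mink x e = - b * mink x p ->
  0 < klein_gap c tau eps n2 b i /\
  frame_coord (frame4 p f1 f2 e) x = klein_vertex c tau eps n2 b i.
Proof.
move=> up ue k0 fr uf D0 hp hx ux uSx xe.
have A1 := hyp_mink_ge1 hx hp.
set A := - mink x p in A1; have A0 : 0 < A by rewrite (lt_le_trans ltr01).
have xp : mink x p = - A by rewrite opprK.
set Y1 := mink x f1 / A; set Y2 := mink x f2 / A.
have y1 : mink x f1 = A * Y1 by rewrite /Y1; field; rewrite gt_eqF.
have y2 : mink x f2 = A * Y2 by rewrite /Y2; field; rewrite gt_eqF.
have {}xe : mink x e = A * b by rewrite xe xp; ring.
have lin j : mink (u j) x = 0 -> cos (turn n2 (proj_cos c tau eps) j) * Y1 +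
    sin (turn n2 (proj_cos c tau eps) j) * Y2 = klein_height tau eps b j.
  move=> ujx; have := ujx; rewrite -(mink_frame_coord (u j) x fr) !frame_coord4 mink_vec4.
  have [-> ->] := uf j; rewrite up ue xp y1 y2 xe opprK => E.
  apply: (mulfI (lt0r_neq0 (mulr_gt0 A0 (k0 j)))).
  rewrite /klein_height; move: E; set k := proj_norm _ _ _ => E.
  have kk : k != 0 := lt0r_neq0 (k0 j).
  have -> : A * k * ((tau j + eps j * b) / k) = A * tau j + A * eps j * b by field.
  by rewrite !opprK in E; lra.
have d0 := lt0r_neq0 (D0 i).
have Y1E : Y1 = klein_x c tau eps n2 b i.
  rewrite /klein_x -(lin i ux) -(lin (ordS i) uSx); apply: (mulIf d0); rewrite divfK //.
  by rewrite /direction_det; ring.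
have Y2E : Y2 = klein_y c tau eps n2 b i.
  rewrite /klein_y -(lin i ux) -(lin (ordS i) uSx); apply: (mulIf d0); rewrite divfK //.
  by rewrite /direction_det; ring.
have G : A ^+ 2 * klein_gap c tau eps n2 b i = 1.
  have [xx _] := hx; move: xx; rewrite -(mink_frame_coord x x fr) !frame_coord4 mink_vec4.
  by rewrite xp y1 y2 xe /klein_gap -Y1E -Y2E opprK; lra.
have A2 : 0 < A ^+ 2 by rewrite exprn_gt0.
have g0 : 0 < klein_gap c tau eps n2 b i by rewrite -(pmulr_rgt0 _ A2) G.
split=> //; rewrite /klein_vertex.
have -> : (Num.sqrt (klein_gap c tau eps n2 b i))^-1 = A.
  have s0 : Num.sqrt (klein_gap c tau eps n2 b i) != 0 by rewrite gt_eqF // sqrtr_gt0.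
  apply: (mulIf s0); rewrite mulVf //; apply/esym/eqP.
  rewrite -(@eqrXn2 _ 2) // ?mulr_ge0 ?sqrtr_ge0 ?ltW //.
  by rewrite exprMn sqr_sqrtr ?ltW // G expr1n.
rewrite frame_coord4 xp y1 y2 xe -Y1E -Y2E opprK.
by apply/rowP => -[[|[|[|[|//]]]] k]; rewrite !mxE /= ?mulr1.
Qed.

Section limits.
Context {T : Type} {F : set_system T} {FF : Filter F}.
Variables (taut epst : T -> 'I_n -> R) (bt : T -> R) (tau eps : 'I_n -> R) (b : R).
Hypotheses (taulim : forall i, taut t i @[t --> F] --> tau i)
  (epslim : forall i, epst t i @[t --> F] --> eps i) (blim : bt t @[t --> F] --> b).
Hypotheses (k0 : forall i, 0 < proj_norm tau eps i)
  (C1 : forall i, -1 < proj_cos c tau eps i < 1).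

Let Nt t := proj_norm (taut t) (epst t).
Let Ct t := proj_cos c (taut t) (epst t).

Let cvg_sqr (f : T -> R) (l : R) : f t @[t --> F] --> l -> f t ^+ 2 @[t --> F] --> l ^+ 2.
Proof. by move=> fl; exact: (cvgM fl fl). Qed.

Lemma cvg_proj_norm i : Nt t i @[t --> F] --> proj_norm tau eps i.
Proof.
apply: continuous_cvg; first exact: sqrt_continuous.
apply: cvgB; last exact: cvg_sqr.
by apply: cvgD; [exact: cvg_cst|exact: cvg_sqr].
Qed.

Lemma cvg_proj_cos i : Ct t i @[t --> F] --> proj_cos c tau eps i.
Proof.
apply: cvgM; last first.
  apply: cvgV; first by rewrite mulf_neq0 // gt_eqF.
  by apply: cvgM; exact: cvg_proj_norm.
by apply: cvgB; [apply: cvgB; exact: cvgM|exact: cvg_cst].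
Qed.

Lemma cvg_turn k : turn n2 (Ct t) k @[t --> F] --> turn n2 (proj_cos c tau eps) k.
Proof.
apply: cvg_big => [|j _]; first exact: add_continuous.
apply: continuous_cvg; [exact: continuous_acos|exact: cvg_proj_cos].
Qed.

Let cvg_cos_turn k : cos (turn n2 (Ct t) k) @[t --> F] --> cos (turn n2 (proj_cos c tau eps) k).
Proof. by apply: continuous_cvg; [exact: continuous_cos|exact: cvg_turn]. Qed.

Let cvg_sin_turn k : sin (turn n2 (Ct t) k) @[t --> F] --> sin (turn n2 (proj_cos c tau eps) k).
Proof. by apply: continuous_cvg; [exact: continuous_sin|exact: cvg_turn]. Qed.

Lemma cvg_direction_det (i : 'I_n) :
  direction_det c (taut t) (epst t) n2 i @[t --> F] --> direction_det c tau eps n2 i.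
Proof. by apply: cvgB; apply: cvgM; try exact: cvg_cos_turn; exact: cvg_sin_turn. Qed.

Lemma cvg_klein_height (i : 'I_n) :
  klein_height (taut t) (epst t) (bt t) i @[t --> F] --> klein_height tau eps b i.
Proof.
apply: cvgM; first by apply: cvgD; [exact: taulim|exact: cvgM].
by apply: cvgV; [rewrite gt_eqF|exact: cvg_proj_norm].
Qed.

Lemma cvg_klein_vertex (i : 'I_n) : direction_det c tau eps n2 i != 0 ->
  0 < klein_gap c tau eps n2 b i ->
  row_cvg F (fun t => klein_vertex c (taut t) (epst t) n2 (bt t) i) (klein_vertex c tau eps n2 b i).
Proof.
move=> d0 g0.
have cx : klein_x c (taut t) (epst t) n2 (bt t) i @[t --> F] --> klein_x c tau eps n2 b i.
  apply: cvgM; last by apply: cvgV => //; exact: cvg_direction_det.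
  by apply: cvgB; apply: cvgM; try exact: cvg_klein_height; exact: cvg_sin_turn.
have cy : klein_y c (taut t) (epst t) n2 (bt t) i @[t --> F] --> klein_y c tau eps n2 b i.
  apply: cvgM; last by apply: cvgV => //; exact: cvg_direction_det.
  by apply: cvgB; apply: cvgM; try exact: cvg_klein_height; exact: cvg_cos_turn.
apply: row_cvgZ.
  apply: cvgV; first by rewrite gt_eqF // sqrtr_gt0.
  apply: continuous_cvg; first exact: sqrt_continuous.
  apply: cvgB; last exact: cvg_sqr.
  apply: cvgB; last exact: cvg_sqr.
  by apply: cvgB; [exact: cvg_cst|exact: cvg_sqr].
move=> -[[|[|[|[|//]]]] k]; rewrite mxE /=; under eq_fun do rewrite mxE /=; by [exact: cvg_cst|].
Qed.

End limits.

End klein.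

(** * Normal form of the polygon *)

Section normal_form_bounds.
Context {R : realType} {n : nat} (c tau eps : 'I_n -> R).

Lemma proj_norm_gt0 i : eps i ^+ 2 < 1 -> 0 < proj_norm tau eps i.
Proof. by move=> e1; rewrite sqrtr_gt0; have := sqr_ge0 (tau i); lra. Qed.

(** The numerator is at least [- dl - c (ordS i)] and the denominator at least [1 - dl], whence the
    margin [2 * dl]. *)
Lemma proj_cos_gtN1 i (dl : R) : (forall i, 0 <= tau i) -> (forall i, eps i ^+ 2 <= dl) ->
  c (ordS i) + 2 * dl < 1 -> dl < 1 -> -1 < proj_cos c tau eps i.
Proof.
move=> t0 ed cd d1; have d0 : 0 <= dl by rewrite (le_trans (sqr_ge0 (eps i))).
have kk j : Num.sqrt (1 - dl) <= proj_norm tau eps j.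
  by apply: ler_wsqrtr; have := ed j; have := sqr_ge0 (tau j); lra.
have K0 j : 0 < proj_norm tau eps j by apply: proj_norm_gt0; apply: le_lt_trans d1.
have K : 1 - dl <= proj_norm tau eps i * proj_norm tau eps (ordS i).
  have -> : 1 - dl = Num.sqrt (1 - dl) * Num.sqrt (1 - dl).
    by rewrite -expr2 sqr_sqrtr // subr_ge0 ltW.
  by rewrite ler_pM ?sqrtr_ge0.
have ee : eps i * eps (ordS i) <= dl.
  have := sqr_ge0 (eps i - eps (ordS i)); have := ed i; have := ed (ordS i).
  by rewrite !expr2; lra.
rewrite /proj_cos ltr_pdivlMr ?mulr_gt0 // mulN1r.
by have := mulr_ge0 (t0 i) (t0 (ordS i)); lra.
Qed.

End normal_form_bounds.

Section embedding.
Context {R : realType}.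

(** The hyperbolic plane as the hyperplane orthogonal to [pole], which takes the place of the
    direction of the common perpendicular. *)
Definition emb (x : 'rV[R]_3) : 'rV[R]_4 := vec4 (x 0 0) (x 0 1) (x 0 2%:R) 0.
Definition pole : 'rV[R]_4 := vec4 0 0 0 1.

Lemma mink_emb x y : mink (emb x) (emb y) = mink x y.
Proof.
have [? [? [? ->]]] := vec3P x; have [? [? [? ->]]] := vec3P y.
by rewrite /emb mink_vec4 mink_vec3 !vec3_0 !vec3_1 !vec3_2 mulr0 addr0.
Qed.

Lemma mink_emb_pole x : mink (emb x) pole = 0.
Proof. by rewrite /emb mink_vec4; ring. Qed.

Lemma mink_pole : mink pole pole = 1.
Proof. by rewrite mink_vec4; ring. Qed.

Lemma hyp_emb x : hyp x -> hyp (emb x).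
Proof. by move=> [xx x0]; split; [rewrite mink_emb|rewrite mxE]. Qed.

End embedding.

(** The polygon is treated as a prism of height zero about its center: [eps] and the Klein height
    vanish, and [tau] is exactly proportional to [W]. *)
Lemma polygon_normal_form (R : realType) (n : nat) (n2 : (2 < n)%N) (beta W : 'I_n -> R)
    (Q : polygon R n) (c := fun i => cos (beta i)) :
  (forall i, 0 < beta i <= pi / 2) -> (forall i, 0 < W i) -> min_perimeter_polygon W beta Q ->
  exists (l : R) (p f1 f2 : 'rV[R]_4), let tau i := l * W i in let eps := fun=> 0 in
  [/\ 0 < l, hyp p, lorentz_frame (frame4 p f1 f2 pole),
      (forall i, -1 < proj_cos c tau eps i < 1) /\ \sum_i acos (proj_cos c tau eps i) = 2 * pi &
      forall i, [/\ 0 < direction_det c tau eps n2 i, 0 < klein_gap c tau eps n2 0 i &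
        frame_coord (frame4 p f1 f2 pole) (emb (vertex Q (ordS i))) =
        klein_vertex c tau eps n2 0 i]].
Proof.
move=> hbeta W0 hmin; have [hQ _] := hmin.
have [p0 [l [hp l0 pW]]] := min_perimeter_center n2 hbeta hmin W0.
pose tau i := l * W i; pose eps : 'I_n -> R := fun=> 0.
pose p := emb p0; pose u i := emb (normal Q i).
have hp4 : hyp p by exact: hyp_emb.
have up i : mink (u i) p = - tau i by rewrite mink_emb pW.
have ue i : mink (u i) pole = - eps i by rewrite mink_emb_pole oppr0.
have tau0 i : 0 <= tau i by rewrite mulr_ge0 ?ltW.
have eps1 i : eps i ^+ 2 < 1 by rewrite expr0n.
have C1 i : -1 < proj_cos c tau eps i.
  apply: (proj_cos_gtN1 (dl := 0)) => // [j|]; first by rewrite expr0n.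
  by rewrite mulr0 addr0; exact: cos_angle_lt1.
have uS i : mink (u i) (u (ordS i)) = - c (ordS i) by rewrite mink_emb (polygon_normal_mink hQ).
have uu i : mink (u i) (u i) = 1 by rewrite mink_emb normal_unit.
have not_conic i k (r s a b : R) : i != k -> i != ordS k -> 0 <= r -> 0 <= s ->
    u i <> r *: u k + s *: u (ordS k) + a *: p + b *: pole.
  move=> ik ikS r0 s0 E.
  have Ex j : mink (normal Q i) (vertex Q j) = r * mink (normal Q k) (vertex Q j) +
      s * mink (normal Q (ordS k)) (vertex Q j) + a * mink p (emb (vertex Q j)).
    rewrite -mink_emb -/(u i) E !minkDl !minkZl !mink_emb (minkC pole) mink_emb_pole.
    by rewrite mulr0 addr0.
  have pv j : mink p (emb (vertex Q j)) <= -1.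
    by have := hyp_mink_ge1 hp4 (hyp_emb (vertex_hyp Q j)); lra.
  (* Evaluation at the common vertex of the edges [k] and [k + 1], which is not on the edge [i]. *)
  have a0 : 0 < a.
    have := Ex (ordS k); rewrite polygon_vertexS polygon_vertex.
    have : mink (normal Q i) (vertex Q (ordS k)) < 0.
      apply: vertex_halfspace_lt; rewrite polygon_inc_ordS negb_or.
      by rewrite ![_ == i]eq_sym ik ikS.
    by have := pv (ordS k); nra.
  (* At a vertex of the edge [i] the left side vanishes, whereas [a > 0] makes the right side
     negative. *)
  have := Ex i; rewrite polygon_vertex.
  have := mulr_ge0_le0 r0 (vertex_halfspace Q k i).
  have := mulr_ge0_le0 s0 (vertex_halfspace Q (ordS k) i).
  by have := pv i; nra.
have [f1 [f2 [fr uf D0 C2 tot]]] :=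
  fan_normal_form n2 hp4.1 mink_pole (mink_emb_pole p0) uu uS up ue eps1 C1 not_conic.
exists l, p, f1, f2; split=> // i.
have vx : mink (u i) (emb (vertex Q (ordS i))) = 0 by rewrite mink_emb polygon_vertexS.
have vSx : mink (u (ordS i)) (emb (vertex Q (ordS i))) = 0 by rewrite mink_emb polygon_vertex.
have xe : mink (emb (vertex Q (ordS i))) pole = - 0 * mink (emb (vertex Q (ordS i))) p.
  by rewrite mink_emb_pole oppr0 mul0r.
have k0 j : 0 < proj_norm tau eps j by exact: proj_norm_gt0.
by have [] := klein_vertexE up ue k0 fr uf D0 hp4 (hyp_emb (vertex_hyp Q (ordS i))) vx vSx xe.
Qed.

Lemma hyp_rescale (R : realType) (d : nat) (x z : 'rV[R]_d.+1) : hyp x -> mink z z < 0 ->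
  mink x z < 0 -> hyp ((Num.sqrt (- mink z z))^-1 *: z).
Proof.
move=> hx zz xz; set m := Num.sqrt _.
have m0 : 0 < m by rewrite sqrtr_gt0 oppr_gt0.
have m2 : m ^+ 2 = - mink z z by rewrite sqr_sqrtr // oppr_ge0 ltW.
have unit (a : R) : a ^+ 2 = 1 -> mink ((a * m^-1) *: z) ((a * m^-1) *: z) = -1.
  move=> a1; rewrite minkZl minkZr.
  have -> : mink z z = - m ^+ 2 by lra.
  have -> : a / m * (a / m * - m ^+ 2) = - a ^+ 2 by field; rewrite gt_eqF.
  by rewrite a1.
split; first by have := unit 1; rewrite expr1n mul1r => ->.
rewrite mxE ltNge; apply/negP => le0.
have z0 : z 0 0 != 0.
  apply/eqP => z00; move: zz; rewrite /mink z00 mulr0 oppr0 add0r ltNge => /negP; apply.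
  by apply: sumr_ge0 => i _; rewrite -expr2 sqr_ge0.
have hN : hyp ((-1 * m^-1) *: z).
  split; first by apply: unit; rewrite sqrrN expr1n.
  rewrite mxE mulN1r mulNr oppr_gt0 lt_neqAle le0 andbT mulf_neq0 // invr_eq0 gt_eqF //.
have := hyp_mink_ge1 hx hN; rewrite minkZr mulN1r mulNr opprK.
by have : m^-1 * mink x z < 0; [rewrite pmulr_rlt0 ?invr_gt0|lra].
Qed.

(** The hull condition for vectors not normalized to the hyperboloid; [x] only serves to tell the
    future cone from the past one. *)
Lemma polytope_timelike_conic (R : realType) (d : nat) (F V : finType) (inc : F -> V -> bool)
    (P : polytope R d inc) (x z : 'rV[R]_d.+1) : hyp x -> mink z z < 0 -> mink x z < 0 ->
  (forall f, mink (normal P f) z <= 0) ->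
  exists2 c : V -> R, (forall v, 0 <= c v) & z = \sum_v c v *: vertex P v.
Proof.
move=> hx zz xz fz; set m := Num.sqrt (- mink z z).
have m0 : 0 < m by rewrite sqrtr_gt0 oppr_gt0.
have : halfspaces (normal P) (m^-1 *: z).
  split; first exact: (hyp_rescale hx).
  by move=> f; rewrite minkZr mulr_ge0_le0 // invr_ge0 ltW.
rewrite halfspaces_hull => -[_ [c c0 E]].
exists (fun v => m * c v) => [v|]; first by rewrite mulr_ge0 // ltW.
under eq_bigr do rewrite -scalerA.
by rewrite -scaler_sumr -E scalerA divff ?scale1r // gt_eqF.
Qed.

(** * Normal form of the prism *)

Section prism.
Context {R : realType} {n : nat} (n2 : (2 < n)%N).
Variables (P : prism R n) (c A A' : 'I_n -> R).

Local Notation hn b := (normal P (inl b)).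
Local Notation u i := (normal P (inr i)).
Local Notation x b j := (vertex P (b, j)).

Hypotheses (A0 : forall i, 0 <= A i) (A'0 : forall i, 0 <= A' i)
  (hA : forall i, mink (hn true) (u i) = - A i)
  (hA' : forall i, mink (hn false) (u i) = - A' i).

Lemma prism_horizontal b j : mink (hn b) (x b j) = 0.
Proof. by apply: vertex_incE => /=; rewrite eqxx. Qed.

Lemma prism_horizontal_lt b j : mink (hn b) (x (~~ b) j) < 0.
Proof. by apply: vertex_halfspace_lt => /=; case: b. Qed.

(* Andreev: nonadjacent faces of a polyhedron with nonobtuse angles lie in
   disjoint planes. Otherwise, from a point of the prism equidistant from both
   planes, one would reach their intersection inside the prism. *)
Lemma prism_ultraparallel : mink (hn true) (hn false) < -1.
Proof.
pose i0 := ord_first n2.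
pose b := - mink (hn false) (x true i0); pose a := - mink (hn true) (x false i0).
have b0 : 0 < b by rewrite oppr_gt0; exact: (prism_horizontal_lt false).
have a0 : 0 < a by rewrite oppr_gt0; exact: (prism_horizontal_lt true).
have hx := vertex_hyp P (true, i0); have hz := vertex_hyp P (false, i0).
(* The weights make the products of [y] with both horizontal normals equal to -1: [y] is the
   equidistant point, up to scale. *)
pose y := b^-1 *: x true i0 + a^-1 *: x false i0.
pose s := hn true + hn false.
pose k := mink (hn true) (hn false).
have xz := hyp_mink_ge1 hx hz.
have yt : mink (hn true) y = -1.
  rewrite /y minkDr !minkZr prism_horizontal mulr0 add0r.
  have -> : mink (hn true) (x false i0) = - a by rewrite opprK.
  by rewrite mulrN mulVf ?gt_eqF.
have yf : mink (hn false) y = -1.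
  rewrite /y minkDr !minkZr prism_horizontal mulr0 addr0.
  have -> : mink (hn false) (x true i0) = - b by rewrite opprK.
  by rewrite mulrN mulVf ?gt_eqF.
have yu i : mink (u i) y <= 0.
  rewrite /y minkDr !minkZr; have := vertex_halfspace P (inr i) (true, i0).
  have := vertex_halfspace P (inr i) (false, i0).
  have bV : 0 <= b^-1 by rewrite invr_ge0 ltW.
  have aV : 0 <= a^-1 by rewrite invr_ge0 ltW.
  by move=> h1 h2; have := mulr_ge0_le0 bV h2; have := mulr_ge0_le0 aV h1; lra.
have xy : mink (x true i0) y < 0.
  rewrite /y minkDr !minkZr (proj1 hx).
  have : 0 < b^-1 by rewrite invr_gt0.
  have : 0 < a^-1 by rewrite invr_gt0.
  by nra.
have yy : mink y y < 0.
  have zy : mink (x false i0) y < 0.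
    rewrite /y minkDr !minkZr (proj1 hz) (minkC (x false i0)).
    have : 0 < b^-1 by rewrite invr_gt0.
    have : 0 < a^-1 by rewrite invr_gt0.
    by nra.
  rewrite {1}/y minkDl !minkZl.
  have h1 : b^-1 * mink (x true i0) y < 0 by rewrite pmulr_rlt0 // invr_gt0.
  have h2 : a^-1 * mink (x false i0) y < 0 by rewrite pmulr_rlt0 // invr_gt0.
  by lra.
have su i : mink (u i) s <= 0.
  by rewrite minkDr !(minkC (u i)) hA hA'; have := A0 i; have := A'0 i; lra.
have st : mink (hn true) s = 1 + k by rewrite minkDr normal_unit.
have sf : mink (hn false) s = 1 + k by rewrite minkDr normal_unit (minkC (hn false)) addrC.
have sy : mink y s = -2 by rewrite minkC /s minkDl yt yf; ring.
have ss : mink s s = 2 + 2 * k by rewrite {1}/s minkDl st sf; ring.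
have xs : mink (x true i0) s < 0.
  by rewrite minkC minkDl prism_horizontal add0r; exact: (prism_horizontal_lt false).
have M1 (v : bool * 'I_n) : 0 <= - mink (vertex P v) y.
  rewrite /y minkDr !minkZr.
  have := hyp_mink_ge1 (vertex_hyp P v) hx; have := hyp_mink_ge1 (vertex_hyp P v) hz.
  have : 0 < b^-1 by rewrite invr_gt0.
  have : 0 < a^-1 by rewrite invr_gt0.
  by nra.
clearbody s y.
rewrite ltNge; apply/negP; rewrite -/k le_eqVlt => /orP[/eqP kN1|k1].
  pose M := \sum_v - mink (vertex P v) y.
  have M0 : 0 <= M by exact: sumr_ge0.
  have Mv v : - mink (vertex P v) y <= M by rewrite /M (bigD1 v) //= lerDl sumr_ge0.
  (* If the planes are asymptotic, [s] is lightlike and the ray [y + l s] stays in the cone of the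
     vertices. Along it the product with [y] grows like [l], but is bounded by [M] times the sum of
     the coefficients, which grows at most like the square root of [l]; [l = M ^+ 2] is already
     contradictory. *)
  pose l := M ^+ 2; have l0 : 0 <= l by exact: sqr_ge0.
  pose z := y + l *: s.
  have zz : mink z z = mink y y - 4 * l.
    by rewrite /z !minkE (minkC s) sy ss -kN1; ring.
  have zf : forall f, mink (normal P f) z <= 0.
    move=> [[]|i]; rewrite /z minkDr minkZr ?yt ?yf ?st ?sf -?kN1; try lra.
    by have := yu i; have := mulr_ge0_le0 l0 (su i); lra.
  have [||||d d0 zE] := @polytope_timelike_conic _ _ _ _ _ P (x true i0) z => //.
  - by rewrite zz; lra.
  - by rewrite /z minkDr minkZr; have := mulr_ge0_le0 l0 (ltW xs); lra.
  have := conic_hyp (vertex_hyp P) d0; rewrite -zE zz.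
  have zy : - mink z y = - mink y y + 2 * l by rewrite /z minkDl minkZl (minkC s) sy; ring.
  have : - mink z y <= M * \sum_v d v.
    rewrite zE mink_suml -sumrN mulr_sumr; apply: ler_sum => v _.
    by rewrite minkZl -mulrN mulrC ler_wpM2r.
  rewrite zy; set S := \sum_v d v => le1 le2.
  have : (- mink y y + 2 * l) ^+ 2 <= (M * S) ^+ 2 by rewrite lerXn2r // nnegrE; lra.
  rewrite exprMn -/l => le3.
  have : l * S ^+ 2 <= l * - (mink y y - 4 * l) by rewrite ler_wpM2l.
  have : 0 < mink y y ^+ 2 by rewrite exprn_even_gt0 //= lt_eqF.
  by move: le3; rewrite !expr2; nra.
have k1' : 0 < 1 + k by lra.
(* The parameter at which the ray from [y] in the direction [s] meets both horizontal planes. *)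
pose l := (1 + k)^-1; have l0 : 0 < l by rewrite invr_gt0.
have lk : l * (1 + k) = 1 by rewrite mulVf // gt_eqF.
pose z := y + l *: s.
have zt : mink (hn true) z = 0 by rewrite minkDr minkZr yt st lk; ring.
have zf : mink (hn false) z = 0 by rewrite minkDr minkZr yf sf lk; ring.
have zz : mink z z < 0.
  rewrite /z !minkE (minkC s) sy ss.
  have -> : l * (l * (2 + 2 * k)) = 2 * l * (l * (1 + k)) by ring.
  by rewrite lk; lra.
have [||d d0 zE] := @polytope_timelike_conic _ _ _ _ _ P (x true i0) z hx zz => //.
- by rewrite /z minkDr minkZr; have := mulr_ge0_le0 (ltW l0) (ltW xs); lra.
- move=> [[]|i]; rewrite ?zt ?zf // /z minkDr minkZr.
  by have := yu i; have := mulr_ge0_le0 (ltW l0) (su i); lra.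
(* No vertex lies on both horizontal planes, so a conic combination of vertices lying on both has
   zero coefficients. *)
have d00 b' j : d (~~ b', j) = 0.
  have zb : mink (hn b') z = 0 by case: (b').
  have : \sum_v d v * - mink (hn b') (vertex P v) = 0.
    rewrite -[RHS]oppr0 -[in RHS]zb zE mink_sumr -sumrN.
    by apply: eq_bigr => v _; rewrite minkZr mulrN.
  move/eqP; rewrite psumr_eq0 => [/allP/(_ (~~ b', j) (mem_index_enum _))|v _].
    rewrite mulf_eq0 => /orP[/eqP//|].
    by rewrite oppr_eq0 lt_eqF // prism_horizontal_lt.
  by rewrite mulr_ge0 // oppr_ge0 vertex_halfspace.
move: zz; rewrite zE big1 ?mink0l ?ltxx // => -[b' j] _.
by rewrite -(negbK b') d00 scale0r.
Qed.

(* With [eta = 2 sinh (h / 2)], [h] being the distance between the horizontal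
   planes, [tau] and [eps] are the components of the lateral normals along the
   midpoint and the direction of the common perpendicular. *)
Definition prism_tau (eta : R) i := (A i + A' i) / eta.
Definition prism_eps (eta : R) i := (A i - A' i) / Num.sqrt (4 + eta ^+ 2).
(** The number [tanh (h / 2)] with a sign: the Klein height of the horizontal faces, the square root
    being [2 cosh (h / 2)]. *)
Definition prism_tilt (eta : R) (b : bool) := (if b then eta else - eta) / Num.sqrt (4 + eta ^+ 2).

Variable dl : R.
Hypotheses (uS : forall i, mink (u i) (u (ordS i)) = - c (ordS i))
  (Adl : forall i, (A i - A' i) ^+ 2 <= 4 * dl) (cdl : forall i, c (ordS i) + 2 * dl < 1)
  (dl1 : dl < 1).

(** Up to isometry, the vertices depend on the prism only through its angles and the single unknown
    [eta]. *)
Lemma prism_normal_form : exists (eta : R) (p f1 f2 e : 'rV[R]_4),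
  [/\ 0 < eta, hyp p, lorentz_frame (frame4 p f1 f2 e),
    (forall i, -1 < proj_cos c (prism_tau eta) (prism_eps eta) i < 1) /\
    \sum_i acos (proj_cos c (prism_tau eta) (prism_eps eta) i) = 2 * pi &
    forall b i, frame_coord (frame4 p f1 f2 e) (x b (ordS i)) =
      klein_vertex c (prism_tau eta) (prism_eps eta) n2 (prism_tilt eta b) i].
Proof.
pose k := mink (hn true) (hn false); have k1 : k < -1 := prism_ultraparallel.
pose eta := Num.sqrt (- (2 + 2 * k)).
have eta0 : 0 < eta by rewrite sqrtr_gt0; lra.
have eta2 : eta ^+ 2 = - (2 + 2 * k) by rewrite sqr_sqrtr //; lra.
pose del := Num.sqrt (4 + eta ^+ 2).
have del0 : 0 < del by rewrite sqrtr_gt0; have := sqr_ge0 eta; lra.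
have del2 : del ^+ 2 = 2 - 2 * k by rewrite sqr_sqrtr ?eta2 //; lra.
pose p := eta^-1 *: (hn true + hn false).
pose e := del^-1 *: (hn true - hn false).
have tt : mink (hn true) (hn true) = 1 by exact: normal_unit.
have ff : mink (hn false) (hn false) = 1 by exact: normal_unit.
have pp : mink p p = -1.
  rewrite /p !minkE tt ff (minkC (hn false)) -/k.
  have -> : eta^-1 * (eta^-1 * (1 + k) + eta^-1 * (k + 1)) = (2 + 2 * k) / eta ^+ 2.
    by field; rewrite gt_eqF.
  have -> : 2 + 2 * k = - eta ^+ 2 by lra.
  by rewrite mulNr divff // expf_neq0 // gt_eqF.
have ee : mink e e = 1.
  rewrite /e !minkE tt ff (minkC (hn false)) -/k.
  transitivity ((2 - 2 * k) / del ^+ 2); first by field; rewrite gt_eqF.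
  by rewrite -del2 divff // expf_neq0 // gt_eqF.
have pe : mink p e = 0 by rewrite /p /e !minkE tt ff (minkC (hn false)); ring.
have xp b j : mink (x b j) p = mink (hn (~~ b)) (x b j) / eta.
  rewrite minkC /p minkZl minkDl; have := prism_horizontal b j.
  by case: b => /= ->; ring.
have xe b j : mink (x b j) e = - (prism_tilt eta b) * mink (x b j) p.
  rewrite xp minkC /e minkZl minkBl /prism_tilt -/del; have := prism_horizontal b j.
  by case: b => /= ->; field; rewrite !gt_eqF.
have xb0 b j : mink (hn (~~ b)) (x b j) < 0.
  by have := prism_horizontal_lt (~~ b) j; rewrite negbK.
have hp : hyp p.
  have xp0 : mink (x true (ord_first n2)) p < 0.
    by rewrite xp pmulr_llt0 ?invr_gt0 //; exact: (xb0 true).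
  have := hyp_rescale (vertex_hyp P (true, ord_first n2)) (z := p).
  rewrite pp opprK sqrtr1 invr1 scale1r; apply=> //; exact: ltrN10.
have up i : mink (u i) p = - prism_tau eta i.
  by rewrite /p minkZr minkDr !(minkC (u i)) hA hA' /prism_tau; ring.
have ue i : mink (u i) e = - prism_eps eta i.
  by rewrite /e minkZr minkBr !(minkC (u i)) hA hA' /prism_eps -/del; ring.
have tau0 i : 0 <= prism_tau eta i by rewrite divr_ge0 ?addr_ge0 // ltW.
have eps_dl i : prism_eps eta i ^+ 2 <= dl.
  rewrite /prism_eps expr_div_n -/del ler_pdivrMr ?exprn_gt0 //.
  have := Adl i; have := sqr_ge0 eta; have dl0 : 0 <= dl.
    by have := Adl i; have := sqr_ge0 (A i - A' i); lra.
  rewrite del2 (_ : 2 - 2 * k = 4 + eta ^+ 2); last by lra.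
  by have := mulr_ge0 dl0 (sqr_ge0 eta); lra.
have eps1 i : prism_eps eta i ^+ 2 < 1 by apply: le_lt_trans dl1.
have C1 i : -1 < proj_cos c (prism_tau eta) (prism_eps eta) i.
  exact: (proj_cos_gtN1 (dl := dl)).
have not_conic i j (r s a b : R) : i != j -> i != ordS j -> 0 <= r -> 0 <= s ->
    u i <> r *: u j + s *: u (ordS j) + a *: p + b *: e.
  move=> ij ijS r0 s0 E.
  (* The combination of [p] and [e] rewritten in the two horizontal normals. Evaluation at the two
     ends of the vertical edge [j + 1] shows both coefficients positive, which is impossible at a
     vertex of the facet [i]. *)
  pose at' := a / eta + b / del; pose af := a / eta - b / del.
  have Ex v : mink (u i) (vertex P v) = r * mink (u j) (vertex P v) +
      s * mink (u (ordS j)) (vertex P v) + (at' * mink (hn true) (vertex P v) +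
      af * mink (hn false) (vertex P v)).
    by rewrite E /p /e /at' /af !minkE; ring.
  have ux0 m b' : mink (u m) (x b' m) = 0.
    by apply: vertex_incE; rewrite /= /polygon_inc eqxx.
  have uxS m b' : mink (u m) (x b' (ordS m)) = 0.
    by apply: vertex_incE; rewrite /= /polygon_inc eqxx orbT.
  have neg b' : mink (u i) (x b' (ordS j)) < 0.
    apply: vertex_halfspace_lt; rewrite /= polygon_inc_ordS negb_or.
    by rewrite ![_ == i]eq_sym ij ijS.
  have af0 : 0 < af.
    have := Ex (true, ordS j); rewrite ux0 uxS prism_horizontal.
    by have := neg true; have := xb0 true (ordS j) => /=; nra.
  have at0 : 0 < at'.
    have := Ex (false, ordS j); rewrite ux0 uxS prism_horizontal.
    by have := neg false; have := xb0 false (ordS j) => /=; nra.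
  have := Ex (true, i); rewrite ux0 prism_horizontal.
  have := mulr_ge0_le0 r0 (vertex_halfspace P (inr j) (true, i)).
  have := mulr_ge0_le0 s0 (vertex_halfspace P (inr (ordS j)) (true, i)).
  have : af * mink (hn false) (x true i) < 0 by rewrite pmulr_rlt0 //; exact: (xb0 true).
  by lra.
have uu i : mink (u i) (u i) = 1 by exact: normal_unit.
have [f1 [f2 [fr uf D0 C2 tot]]] :=
  fan_normal_form n2 pp ee pe uu uS up ue eps1 C1 not_conic.
exists eta, p, f1, f2, e; split=> // b i.
have vx : mink (u i) (x b (ordS i)) = 0.
  by apply: vertex_incE; rewrite /= /polygon_inc eqxx orbT.
have vSx : mink (u (ordS i)) (x b (ordS i)) = 0.
  by apply: vertex_incE; rewrite /= /polygon_inc eqxx.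
have k0 j : 0 < proj_norm (prism_tau eta) (prism_eps eta) j by exact: proj_norm_gt0.
by have [] := klein_vertexE up ue k0 fr uf D0 hp (vertex_hyp P (b, ordS i)) vx vSx (xe b (ordS i)).
Qed.

End prism.

(** * Convergence of the scale *)

Section scale.
Context {R : realType}.

Lemma ler_sqr_pos (x y : R) : 0 <= y -> x ^+ 2 <= y ^+ 2 -> x <= y.
Proof.
move=> y0 h; have [x0|x0] := leP x 0; first exact: le_trans y0.
by rewrite -(@ler_pXn2r _ 2) // nnegrE ltW.
Qed.

Lemma ltr_sqr_pos (x y : R) : 0 <= y -> x ^+ 2 < y ^+ 2 -> x < y.
Proof.
move=> y0 h; have [x0|x0] := leP x 0; last by rewrite -(@ltr_pXn2r _ 2) // nnegrE ltW.
rewrite lt_neqAle (le_trans x0 y0) andbT; apply/eqP => xy.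
by move: h; rewrite xy ltxx.
Qed.

Lemma acos_lt (x y : R) : -1 <= x -> x < y -> y <= 1 -> acos y < acos x.
Proof.
move=> x1 xy y1; have xi : -1 <= x <= 1 by rewrite x1 (le_trans (ltW xy)).
have yi : -1 <= y <= 1 by rewrite y1 (le_trans x1 (ltW xy)).
rewrite -ltr_cos ?in_itv /= ?acos_ge0 ?acos_lepi //.
by rewrite !acosK ?in_itv.
Qed.

(* The estimate does not depend on [k]: it is uniform in the unknown scale. *)
Lemma quotient_perturb (N N0 K K0 dl : R) : 0 <= dl -> dl <= 2^-1 -> 0 < K0 -> 0 < K ->
  (1 - dl) * K0 <= K -> K <= (1 + dl) * K0 -> `|N - N0| <= 2 * dl * K0 -> `|N0| <= K0 ->
  `|N / K - N0 / K0| <= 6 * dl.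
Proof.
move=> d0 d1 K00 Kp Kl Ku NN N0K.
have -> : N / K - N0 / K0 = ((N - N0) * K0 + N0 * (K0 - K)) / (K * K0).
  by field; rewrite !gt_eqF.
have KK0 : 0 < K * K0 by rewrite mulr_gt0.
rewrite normrM normfV (gtr0_norm KK0) ler_pdivrMr //.
apply: (le_trans (ler_normD _ _)); rewrite !normrM (gtr0_norm K00).
have h1 : `|N - N0| * K0 <= 2 * dl * K0 * K0 by rewrite ler_wpM2r // ltW.
have h2 : `|K0 - K| <= dl * K0 by rewrite ler_norml; lra.
have h3 : `|N0| * `|K0 - K| <= K0 * (dl * K0) by rewrite ler_pM.
(* The two error terms add up to [3 dl K0^2]; [K0 <= 2 K] turns this into [6 dl K K0]. *)
have h4 : K0 * K0 <= 2 * (K * K0) by have : K0 <= 2 * K; nra.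
have := ler_wpM2l d0 h4; lra.
Qed.

(** The errors in [th] are relative, so the factor [r ^+ 2] they acquire is absorbed by the product
    of norms, which dominates both [r ^+ 2 * (W i * W (ordS i))] and 1. *)
Lemma proj_cos_perturb (n : nat) (c W th ep : 'I_n -> R) (i : 'I_n) (r dl : R) :
  (forall i, 0 < W i) -> (forall i, 0 <= c i <= 1) -> 0 <= r ->
  0 <= dl -> dl <= 2^-1 ->
  `|th i * th (ordS i) - W i * W (ordS i)| <= dl * (W i * W (ordS i)) ->
  `|th i ^+ 2 - W i ^+ 2| <= dl * W i ^+ 2 ->
  `|th (ordS i) ^+ 2 - W (ordS i) ^+ 2| <= dl * W (ordS i) ^+ 2 ->
  ep i ^+ 2 <= dl -> ep (ordS i) ^+ 2 <= dl ->
  `|proj_cos c (fun i => r * th i) ep i - proj_cos c (fun i => r * W i) (fun=> 0) i| <= 6 * dl.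
Proof.
move=> W0 c01 r0 d0 d1 hth h1 h2 e1 e2.
pose k0 j := proj_norm (fun i => r * W i) (fun=> 0) j.
pose k j := proj_norm (fun i => r * th i) ep j.
have k0sq j : k0 j ^+ 2 = 1 + (r * W j) ^+ 2.
  by rewrite sqr_sqrtr expr0n subr0 //; have := sqr_ge0 (r * W j); lra.
have k0p j : 1 <= k0 j.
  by rewrite -sqrtr1; apply: ler_wsqrtr; rewrite expr0n subr0; have := sqr_ge0 (r * W j); lra.
have k00 j : 0 < k0 j := lt_le_trans ltr01 (k0p j).
have kb j : `|th j ^+ 2 - W j ^+ 2| <= dl * W j ^+ 2 -> ep j ^+ 2 <= dl ->
    [/\ 0 < k j, (1 - dl) * k0 j ^+ 2 <= k j ^+ 2 & k j ^+ 2 <= (1 + dl) * k0 j ^+ 2].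
  rewrite ler_norml => /andP[a b] e.
  have r2 : 0 <= r ^+ 2 by exact: sqr_ge0.
  have ra := ler_wpM2l r2 a; have rb := ler_wpM2l r2 b.
  have ep0 := sqr_ge0 (ep j).
  have s0 : 0 < 1 + (r * th j) ^+ 2 - ep j ^+ 2.
    by have := sqr_ge0 (r * th j); lra.
  have ksq : k j ^+ 2 = 1 + (r * th j) ^+ 2 - ep j ^+ 2 by rewrite sqr_sqrtr // ltW.
  rewrite sqrtr_gt0 s0 ksq k0sq !exprMn; split=> //; lra.
have [ki kil kiu] := kb _ h1 e1; have [ks ksl ksu] := kb _ h2 e2.
have K0 : 0 < k0 i * k0 (ordS i) by rewrite mulr_gt0.
have K : 0 < k i * k (ordS i) by rewrite mulr_gt0.
have d1' : 0 <= 1 - dl by lra.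
rewrite /proj_cos; apply: quotient_perturb => //.
- rewrite -/(k0 i) -/(k0 (ordS i)) -/(k i) -/(k (ordS i)).
  apply: ler_sqr_pos; first exact: ltW.
  have -> : ((1 - dl) * (k0 i * k0 (ordS i))) ^+ 2 =
    ((1 - dl) * k0 i ^+ 2) * ((1 - dl) * k0 (ordS i) ^+ 2) by ring.
  by rewrite exprMn ler_pM // mulr_ge0 ?sqr_ge0.
- rewrite -/(k0 i) -/(k0 (ordS i)) -/(k i) -/(k (ordS i)).
  apply: ler_sqr_pos; first by rewrite mulr_ge0 ?ltW //; lra.
  have -> : ((1 + dl) * (k0 i * k0 (ordS i))) ^+ 2 =
    ((1 + dl) * k0 i ^+ 2) * ((1 + dl) * k0 (ordS i) ^+ 2) by ring.
  by rewrite exprMn ler_pM ?sqr_ge0.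
- rewrite -/(k0 i) -/(k0 (ordS i)) mul0r subr0.
  have ee : `|ep i * ep (ordS i)| <= dl.
    have := sqr_ge0 (ep i - ep (ordS i)); have := sqr_ge0 (ep i + ep (ordS i)).
    by rewrite ler_norml !expr2 in e1 e2 *; nra.
  have WK : r ^+ 2 * (W i * W (ordS i)) <= k0 i * k0 (ordS i).
    apply: ler_sqr_pos; first exact: ltW.
    have -> : (r ^+ 2 * (W i * W (ordS i))) ^+ 2 = (r * W i) ^+ 2 * (r * W (ordS i)) ^+ 2 by ring.
    by rewrite [leRHS]exprMn !k0sq ler_pM ?sqr_ge0 // lerDr.
  have K1 : 1 <= k0 i * k0 (ordS i).
    by rewrite -[1](mulr1 1) ler_pM.
  have r2 : 0 <= r ^+ 2 by exact: sqr_ge0.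
  have -> : r * th i * (r * th (ordS i)) - ep i * ep (ordS i) - c (ordS i) -
      (r * W i * (r * W (ordS i)) - c (ordS i)) =
      r ^+ 2 * (th i * th (ordS i) - W i * W (ordS i)) - ep i * ep (ordS i) by ring.
  apply: (le_trans (ler_normB _ _)); rewrite normrM (ger0_norm r2).
  have := ler_wpM2l r2 hth; have := ler_wpM2l d0 WK; have := ler_wpM2l d0 K1.
  by lra.
- rewrite -/(k0 i) -/(k0 (ordS i)) mul0r subr0.
  have /andP[c0 c1] := c01 (ordS i).
  have K1 : 1 <= k0 i * k0 (ordS i).
    by rewrite -[1](mulr1 1) ler_pM.
  have WK : r * W i * (r * W (ordS i)) <= k0 i * k0 (ordS i).
    apply: ler_sqr_pos; first exact: ltW.
    by rewrite [leLHS]exprMn [leRHS]exprMn !k0sq ler_pM ?sqr_ge0 // lerDr.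
  have : 0 <= r * W i * (r * W (ordS i)) by rewrite !mulr_ge0 // ltW.
  by rewrite ler_norml; lra.
Qed.

(** Each factor [r W / sqrt (1 + r^2 W^2)] increases with [r], and the remaining term, [- c] over
    the product of norms, does not decrease because [c >= 0]. *)
Lemma proj_cos_increasing (n : nat) (c W : 'I_n -> R) (i : 'I_n) (r s : R) :
  (forall i, 0 < W i) -> (forall i, 0 <= c i) -> 0 < r -> r < s ->
  proj_cos c (fun i => r * W i) (fun=> 0) i < proj_cos c (fun i => s * W i) (fun=> 0) i.
Proof.
move=> W0 c0 r0 rs; have s0 : 0 < s := lt_trans r0 rs.
pose k (q : R) j := proj_norm (fun i => q * W i) (fun=> 0) j.
have ksq q j : k q j ^+ 2 = 1 + (q * W j) ^+ 2.
  by rewrite sqr_sqrtr expr0n subr0 //; have := sqr_ge0 (q * W j); lra.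
have k0 q j : 0 < k q j.
  by rewrite sqrtr_gt0 expr0n subr0; have := sqr_ge0 (q * W j); lra.
have rs2 : r ^+ 2 < s ^+ 2 by rewrite !expr2; nra.
have lt j : r * k s j < s * k r j.
  apply: ltr_sqr_pos; first by rewrite mulr_ge0 ?ltW.
  by rewrite !exprMn !ksq !exprMn; lra.
have le j : k r j <= k s j.
  apply: ler_sqr_pos; first exact: ltW.
  rewrite !ksq !exprMn lerD2l ler_wpM2r ?sqr_ge0 // ltW //.
rewrite /proj_cos !mul0r !subr0 -!/(k _ _).
have KK : 0 < k r i * k r (ordS i) by rewrite mulr_gt0.
have KKs : 0 < k s i * k s (ordS i) by rewrite mulr_gt0.
have a : (r * k s i) * (r * k s (ordS i)) < (s * k r i) * (s * k r (ordS i)).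
  by apply: ltr_pM => //; rewrite mulr_ge0 // ltW.
have b : k r i * k r (ordS i) <= k s i * k s (ordS i) by apply: ler_pM => //; exact: ltW.
rewrite ltr_pdivrMr // [ltRHS]mulrAC ltr_pdivlMr //.
have WW : 0 < W i * W (ordS i) by rewrite mulr_gt0.
have aW : (r * k s i) * (r * k s (ordS i)) * (W i * W (ordS i)) <
  (s * k r i) * (s * k r (ordS i)) * (W i * W (ordS i)) by rewrite ltr_pM2r.
have cb := ler_wpM2l (c0 (ordS i)) b.
by lra.
Qed.

Section scale_limit.
Context {n : nat} (n2 : (2 < n)%N) {T : Type} {F : set_system T} {FF : Filter F}.
Variables (c W : 'I_n -> R) (th ep : T -> 'I_n -> R) (r : T -> R) (l : R).
Hypotheses (W0 : forall i, 0 < W i) (c01 : forall i, 0 <= c i < 1) (l0 : 0 < l)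
  (Cl : forall i, -1 < proj_cos c (fun i => l * W i) (fun=> 0) i < 1)
  (suml : \sum_i acos (proj_cos c (fun i => l * W i) (fun=> 0) i) = 2 * pi)
  (r0 : \forall t \near F, 0 < r t)
  (thW : forall i, th t i @[t --> F] --> W i) (ep0 : forall i, ep t i @[t --> F] --> 0)
  (Ct : \forall t \near F, forall i,
    -1 <= proj_cos c (fun i => r t * th t i) (ep t) i <= 1)
  (sumt : \forall t \near F,
    \sum_i acos (proj_cos c (fun i => r t * th t i) (ep t) i) = 2 * pi).

Let c01' i : 0 <= c i <= 1. Proof. by have /andP[-> /ltW ->] := c01 i. Qed.

Let close (i : 'I_n) (e : R) : 0 < e -> \forall t \near F,
  `|proj_cos c (fun i => r t * th t i) (ep t) i - proj_cos c (fun i => r t * W i) (fun=> 0) i| < e.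
Proof.
move=> e0; pose dl := Num.min 2^-1 (e / 12).
have d0 : 0 < dl by rewrite lt_min invr_gt0 ltr0n divr_gt0.
have d1 : dl <= 2^-1 by rewrite ge_min lexx.
have d2 : 6 * dl < e.
  have : dl <= e / 12 by rewrite ge_min lexx orbT.
  by lra.
have cw (f : T -> R) (L : R) : 0 < L -> f t @[t --> F] --> L ->
    \forall t \near F, `|f t - L| <= dl * L.
  move=> L0 /cvgrPdist_le /(_ _ (mulr_gt0 d0 L0)); apply: filterS => t.
  by rewrite distrC.
have ce j : \forall t \near F, ep t j ^+ 2 <= dl.
  have h : ep t j ^+ 2 @[t --> F] --> (0 : R).
    by rewrite -[X in _ --> X](mulr0 0); exact: (cvgM (@ep0 j) (@ep0 j)).
  by near=> t; apply: ltW; near: t; exact: (cvgr_lt _ h _ d0).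
have w1 : \forall t \near F, `|th t i * th t (ordS i) - W i * W (ordS i)| <= dl * (W i * W (ordS i)).
  by apply: cw; [rewrite mulr_gt0|exact: cvgM].
have w2 j : \forall t \near F, `|th t j ^+ 2 - W j ^+ 2| <= dl * W j ^+ 2.
  have h : th t j ^+ 2 @[t --> F] --> W j ^+ 2 by exact: (cvgM (@thW j) (@thW j)).
  by apply: (cw _ _ _ h); rewrite exprn_gt0.
have w2i := w2 i; have w2s := w2 (ordS i).
have e1 := ce i; have e2 := ce (ordS i).
near=> t; apply: le_lt_trans d2; apply: proj_cos_perturb => //.
- by apply: ltW; near: t.
- exact: ltW.
- by near: t.
- by near: t.
- by near: t.
- by near: t.
- by near: t.
Unshelve. all: by end_near. Qed.

Let sum_acos_lt (f g : 'I_n -> R) : (forall i, -1 <= f i) -> (forall i, f i < g i) ->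
  (forall i, g i <= 1) -> \sum_i acos (g i) < \sum_i acos (f i).
Proof.
move=> f1 fg g1; rewrite (bigD1 (ord_first n2)) //= [ltRHS](bigD1 (ord_first n2)) //=.
apply: ltr_leD; first exact: acos_lt.
by apply: ler_sum => i _; apply: ltW; exact: acos_lt.
Qed.

(** If [r t <= s < l], every cosine is at most its value at scale [s] plus an error smaller than the
    gap to scale [l], so the angles add up to more than [2 pi]; symmetrically above [l]. As the
    error does not depend on [r t], neither bound presupposes the other. *)
Lemma scale_cvg : r t @[t --> F] --> l.
Proof.
have lo (s : R) : s < l -> \forall t \near F, s < r t.
  move=> sl; have [s0|s0] := leP s 0; first by apply: filterS r0 => t; exact: le_lt_trans.
  pose G q i := proj_cos c (fun i => q * W i) (fun=> 0) i.
  have gap i : 0 < G l i - G s i.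
    by rewrite subr_gt0; apply: proj_cos_increasing => // j; have /andP[] := c01 j.
  have cl : \forall t \near F, forall i,
      `|proj_cos c (fun i => r t * th t i) (ep t) i - G (r t) i| < G l i - G s i.
    apply: (@filter_forall T _ (fun i t => `|proj_cos c (fun i => r t * th t i) (ep t) i -
      G (r t) i| < G l i - G s i) F) => i.
    exact: close.
  near=> t; rewrite ltNge; apply/negP => rs.
  have rt0 : 0 < r t by near: t.
  have : \sum_i acos (G l i) < \sum_i acos (proj_cos c (fun i => r t * th t i) (ep t) i).
    apply: sum_acos_lt => [i|i|i].
    - suff /(_ i)/andP[] : forall i, -1 <= proj_cos c (fun i => r t * th t i) (ep t) i <= 1 by [].
      by near: t.
    - have h : `|proj_cos c (fun i => r t * th t i) (ep t) i - G (r t) i| < G l i - G s i.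
        by move: i; near: t.
      have : G (r t) i <= G s i.
        move: rs; rewrite le_eqVlt => /orP[/eqP-> //|rs]; apply: ltW.
        by apply: proj_cos_increasing => // j; have /andP[] := c01 j.
      by move: h; rewrite ltr_norml; lra.
    - by have /andP[_ /ltW] := Cl i.
  rewrite suml.
  have -> : \sum_i acos (proj_cos c (fun i => r t * th t i) (ep t) i) = 2 * pi by near: t.
  by rewrite ltxx.
have hi (s : R) : l < s -> \forall t \near F, r t < s.
  move=> ls.
  pose G q i := proj_cos c (fun i => q * W i) (fun=> 0) i.
  have s0 := lt_trans l0 ls.
  have gap i : 0 < G s i - G l i.
    by rewrite subr_gt0; apply: proj_cos_increasing => // j; have /andP[] := c01 j.
  have cl : \forall t \near F, forall i,
      `|proj_cos c (fun i => r t * th t i) (ep t) i - G (r t) i| < G s i - G l i.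
    apply: (@filter_forall T _ (fun i t => `|proj_cos c (fun i => r t * th t i) (ep t) i -
      G (r t) i| < G s i - G l i) F) => i.
    exact: close.
  near=> t; rewrite ltNge; apply/negP => rs.
  have : \sum_i acos (proj_cos c (fun i => r t * th t i) (ep t) i) < \sum_i acos (G l i).
    apply: sum_acos_lt => [i|i|i].
    - by have /andP[/ltW] := Cl i.
    - have h : `|proj_cos c (fun i => r t * th t i) (ep t) i - G (r t) i| < G s i - G l i.
        by move: i; near: t.
      have : G s i <= G (r t) i.
        move: rs; rewrite le_eqVlt => /orP[/eqP-> //|rs]; apply: ltW.
        by apply: proj_cos_increasing => // j; have /andP[] := c01 j.
      by move: h; rewrite ltr_norml; lra.
    - suff /(_ i)/andP[] : forall i, -1 <= proj_cos c (fun i => r t * th t i) (ep t) i <= 1 by [].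
      by near: t.
  rewrite suml.
  have -> : \sum_i acos (proj_cos c (fun i => r t * th t i) (ep t) i) = 2 * pi by near: t.
  by rewrite ltxx.
apply/cvgrPdist_lt => e e0.
have a := lo (l - e); have b := hi (l + e).
have {}a : \forall t \near F, l - e < r t by apply: a; lra.
have {}b : \forall t \near F, r t < l + e by apply: b; lra.
near=> t; rewrite ltr_norml.
have ta : l - e < r t by near: t.
have tb : r t < l + e by near: t.
by lra.
Unshelve. all: by end_near. Qed.

End scale_limit.

End scale.

(** * Closeness of hulls and convergence *)

Section hull_closeness.
Context {R : realType} {d : nat} {V : finType}.
Implicit Types (X Y : V -> 'rV[R]_d.+1) (c : V -> R).

Lemma hyp_conic X c : (forall v, hyp (X v)) -> (forall v, 0 <= c v) ->
  mink (\sum_v c v *: X v) (\sum_v c v *: X v) = -1 -> hyp (\sum_v c v *: X v).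
Proof.
move=> hX c0 zz; split=> //; rewrite lt_neqAle.
have z0 : 0 <= (\sum_v c v *: X v) 0 0.
  by rewrite summxE sumr_ge0 // => v _; rewrite mxE mulr_ge0 // ltW // (hX v).2.
rewrite z0 andbT eq_sym; apply/eqP => e.
suff : 0 <= (-1 : R) by rewrite oppr_ge0 ler10.
rewrite -zz /mink e mulr0 oppr0 add0r; apply: sumr_ge0 => i _.
by rewrite -expr2 sqr_ge0.
Qed.

(* Both hypotheses compare Gram matrices entrywise, hence survive taking
   combinations with the same nonnegative coefficients. *)
Lemma hull_close X Y c (dl : R) : (forall v, hyp (X v)) -> (forall v, hyp (Y v)) ->
  0 < dl < 1 ->
  (forall v w, - mink (X v) (Y w) <= (1 + dl) * - mink (X v) (X w)) ->
  (forall v w, (1 - dl) * - mink (X v) (X w) <= - mink (Y v) (Y w)) ->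
  (forall v, 0 <= c v) -> hyp (\sum_v c v *: X v) ->
  exists m : R, [/\ 0 < m, hyp (\sum_v (m * c v) *: Y v) &
    hdist (\sum_v c v *: X v) (\sum_v (m * c v) *: Y v) <= arcosh ((1 + dl) / Num.sqrt (1 - dl))].
Proof.
move=> hX hY /andP[d0 d1] XY YY c0 hx.
set x := \sum_v c v *: X v in hx *; set y := \sum_v c v *: Y v.
have bil (Z Z' : V -> 'rV[R]_d.+1) : - mink (\sum_v c v *: Z v) (\sum_v c v *: Z' v) =
    \sum_v \sum_w c v * c w * - mink (Z v) (Z' w).
  rewrite mink_suml -sumrN; apply: eq_bigr => v _.
  rewrite mink_sumr -sumrN; apply: eq_bigr => w _.
  by rewrite minkZl minkZr mulrA mulrN.
have xx : - mink x x = 1 by rewrite (proj1 hx) opprK.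
have xy : - mink x y <= 1 + dl.
  have -> : 1 + dl = (1 + dl) * - mink x x by rewrite xx mulr1.
  rewrite !bil mulr_sumr; apply: ler_sum => v _.
  rewrite mulr_sumr; apply: ler_sum => w _.
  rewrite (mulrCA (1 + dl)); apply: ler_wpM2l; [exact: mulr_ge0|exact: XY].
have yy : 1 - dl <= - mink y y.
  have -> : 1 - dl = (1 - dl) * - mink x x by rewrite xx mulr1.
  rewrite !bil mulr_sumr; apply: ler_sum => v _.
  rewrite mulr_sumr; apply: ler_sum => w _.
  rewrite (mulrCA (1 - dl)); apply: ler_wpM2l; [exact: mulr_ge0|exact: YY].
have s0 : 0 < 1 - dl by rewrite subr_gt0.
have yy0 : 0 < - mink y y by exact: lt_le_trans yy.
(* The same combination of the [Y] misses the hyperboloid slightly; rescaling costs at most the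
   factor [1 / sqrt (1 - dl)]. *)
pose m := (Num.sqrt (- mink y y))^-1.
have m0 : 0 < m by rewrite invr_gt0 sqrtr_gt0.
have ym : \sum_v (m * c v) *: Y v = m *: y.
  by rewrite scaler_sumr; apply: eq_bigr => v _; rewrite scalerA.
have m2 : m ^+ 2 * - mink y y = 1.
  by rewrite /m exprVn sqr_sqrtr ?ltW // mulVf // gt_eqF.
have hy : hyp (\sum_v (m * c v) *: Y v).
  apply: hyp_conic => // [v|]; first by rewrite mulr_ge0 // ltW.
  by rewrite ym minkZl minkZr mulrA -expr2 -m2; ring.
exists m; split=> //.
apply: le_arcosh; first by apply: hyp_mink_ge1.
rewrite ym minkZr -mulrN; apply: (@le_trans _ _ (m * (1 + dl))).
  by rewrite ler_wpM2l // ltW.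
rewrite mulrC; apply: ler_wpM2l; first by lra.
by rewrite /m lef_pV2 ?posrE ?sqrtr_gt0 // ler_wsqrtr.
Qed.

End hull_closeness.

Lemma near_at_right (R : realType) (x : R) (Pr : R -> Prop) :
  (\forall t \near x, Pr t) -> \forall t \near x^'+, Pr t.
Proof. by move=> h; exact: (@cvg_within _ (nbhs x) _ (fun u : R => x < u)). Qed.

Lemma arcosh_ratio_small (R : realType) (e : R) : 0 < e ->
  exists2 dl : R, 0 < dl < 1 & arcosh ((1 + dl) / Num.sqrt (1 - dl)) < e.
Proof.
move=> e0.
pose f (dl : R) := (1 + dl) / Num.sqrt (1 - dl).
have f0 : f 0 = 1 by rewrite /f addr0 subr0 sqrtr1 divr1.
have cf : f dl @[dl --> (0 : R)] --> f 0.
  apply: cvgM; first by apply: cvgD; [exact: cvg_cst|exact: cvg_id].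
  apply: cvgV; first by rewrite subr0 sqrtr1 oner_neq0.
  apply: continuous_cvg; first exact: sqrt_continuous.
  by apply: cvgB; [exact: cvg_cst|exact: cvg_id].
have cs : f dl + Num.sqrt (f dl ^+ 2 - 1) @[dl --> (0 : R)] --> f 0 + Num.sqrt (f 0 ^+ 2 - 1).
  apply: cvgD => //; apply: continuous_cvg; first exact: sqrt_continuous.
  apply: cvgB; last exact: cvg_cst.
  exact: (cvgM cf cf).
have ca : arcosh (f dl) @[dl --> (0 : R)] --> arcosh (f 0).
  have l0 : 0 < f 0 + Num.sqrt (f 0 ^+ 2 - 1) by rewrite f0 expr1n subrr sqrtr0 addr0.
  exact: (cvg_comp _ _ cs (continuous_ln l0)).
have lt0 : arcosh (f 0) < e by rewrite f0 arcosh1.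
have h1 : \forall dl \near (0 : R), arcosh (f dl) < e by exact: (cvgr_lt _ ca _ lt0).
have h2 : \forall dl \near (0 : R), dl < 1.
  exact: (cvgr_lt _ (@cvg_id _ (nbhs (0 : R))) _ ltr01).
have h3 : \forall dl \near (0 : R)^'+, 0 < dl < 1 /\ arcosh (f dl) < e.
  near=> dl; split; last by near: dl; exact: near_at_right.
  by apply/andP; split; near: dl; [exact: nbhs_right_gt|exact: near_at_right].
by have [dl [? ?]] := filter_ex h3; exists dl.
Unshelve. all: by end_near. Qed.

Lemma frame_coord_sum (R : realType) (d : nat) (V : finType) (f : 'I_d.+1 -> 'rV[R]_d.+1)
    (c : V -> R) (x : V -> 'rV[R]_d.+1) :
  frame_coord f (\sum_v c v *: x v) = \sum_v c v *: frame_coord f (x v).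
Proof.
apply/rowP => i; rewrite mxE summxE mink_suml mulr_sumr; apply: eq_bigr => v _.
by rewrite !mxE minkZl mulrCA.
Qed.

Lemma emb_sum (R : realType) (V : finType) (c : V -> R) (x : V -> 'rV[R]_3) :
  emb (\sum_v c v *: x v) = \sum_v c v *: emb (x v).
Proof.
apply/rowP => -[[|[|[|[|//]]]] i]; rewrite mxE [RHS]summxE /=.
- by rewrite summxE; apply: eq_bigr => v _; rewrite !mxE.
- by rewrite summxE; apply: eq_bigr => v _; rewrite !mxE.
- by rewrite summxE; apply: eq_bigr => v _; rewrite !mxE.
- by rewrite big1 // => v _; rewrite !mxE /= mulr0.
Qed.

(** Each polygon vertex is counted twice in [Y], once for each end of the vertical edge collapsing
    to it, so that both hulls have the same index set. *)
Lemma gh_dist_prism_polygon (R : realType) (n : nat) (P : prism R n) (Q : polygon R n)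
    (f g : 'I_4 -> 'rV[R]_4) (dl e : R) (X := fun v => frame_coord f (vertex P v))
    (Y := fun v : bool * 'I_n => frame_coord g (emb (vertex Q v.2))) :
  lorentz_frame f -> hyp (f 0) -> lorentz_frame g -> hyp (g 0) ->
  0 < e -> 0 < dl < 1 -> arcosh ((1 + dl) / Num.sqrt (1 - dl)) < e ->
  (forall v w, - mink (X v) (Y w) <= (1 + dl) * - mink (X v) (X w)) ->
  (forall v w, (1 - dl) * - mink (X v) (X w) <= - mink (Y v) (Y w)) ->
  (forall v w, - mink (Y v) (X w) <= (1 + dl) * - mink (Y v) (Y w)) ->
  (forall v w, (1 - dl) * - mink (Y v) (Y w) <= - mink (X v) (X w)) ->
  (gh_dist (@hdist R 3) (body P) (@hdist R 2) (body Q) <= e%:E)%E.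
Proof.
move=> ff hf gg hg e0 d01 small XY YY YX XX.
have hX v : hyp (X v) by apply: hyp_frame_coord => //; exact: vertex_hyp.
have hY v : hyp (Y v) by apply: hyp_frame_coord => //; apply: hyp_emb; exact: vertex_hyp.
have GG x y : mink (frame_coord g (emb x)) (frame_coord g (emb y)) = mink x y.
  by rewrite mink_frame_coord // mink_emb.
apply: (@gh_dist_le_hausdorff _ _ _ _ _ _ (frame_coord f) (fun x => frame_coord g (emb x))) => //.
- by move=> x [hx _]; exact: hyp_frame_coord.
- by move=> x [hx _]; apply: hyp_frame_coord => //; exact: hyp_emb.
- by move=> x y; exact: mink_frame_coord.
- move=> a; rewrite /body halfspaces_hull => -[ha [c c0 aE]].
  have Fa : frame_coord f a = \sum_v c v *: X v by rewrite aE frame_coord_sum.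
  have hFa : hyp (\sum_v c v *: X v) by rewrite -Fa; exact: hyp_frame_coord.
  have [m [m0 hGb dist]] := hull_close hX hY d01 XY YY c0 hFa.
  pose b := \sum_v (m * c v) *: vertex Q v.2.
  have Gb : frame_coord g (emb b) = \sum_v (m * c v) *: Y v.
    by rewrite /b emb_sum frame_coord_sum.
  exists b; last by rewrite Fa Gb; exact: le_lt_trans small.
  have hb : hyp b.
    apply: hyp_conic => [v|v|]; first exact: vertex_hyp.
      by rewrite mulr_ge0 // ltW.
    by rewrite -/b -GG Gb; case: hGb.
  rewrite /body halfspaces_hull; split=> //.
  (* The coefficients of the two copies of a vertex are added. *)
  exists (fun i => \sum_b' m * c (b', i)) => [i|].
    by apply: sumr_ge0 => b' _; rewrite mulr_ge0 // ltW.
  under [RHS]eq_bigr do rewrite scaler_suml.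
  rewrite exchange_big /= pair_bigA /=.
  by apply: eq_bigr => -[].
- move=> b; rewrite /body halfspaces_hull => -[hb [c c0 bE]].
  (* Conversely, a point of the polygon is expressed by the copies on one horizontal face only. *)
  pose c' (v : bool * 'I_n) := if v.1 then c v.2 else 0.
  have c'0 v : 0 <= c' v by rewrite /c'; case: ifP.
  have bE' : b = \sum_v c' v *: vertex Q v.2.
    rewrite -(pair_bigA _ (fun b' i => c' (b', i) *: vertex Q i)) /= big_bool /=.
    by rewrite /c' /= [X in _ + X]big1 ?addr0 // => i _; rewrite scale0r.
  have Gb : frame_coord g (emb b) = \sum_v c' v *: Y v by rewrite bE' emb_sum frame_coord_sum.
  have hGb : hyp (\sum_v c' v *: Y v).
    by rewrite -Gb; apply: hyp_frame_coord => //; exact: hyp_emb.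
  have [m [m0 hFa dist]] := hull_close hY hX d01 YX XX c'0 hGb.
  pose a := \sum_v (m * c' v) *: vertex P v.
  have Fa : frame_coord f a = \sum_v (m * c' v) *: X v by rewrite /a frame_coord_sum.
  exists a; last by rewrite Fa Gb hdistC; exact: le_lt_trans small.
  have mc0 v : 0 <= m * c' v by rewrite mulr_ge0 // ltW.
  have ha : hyp a.
    apply: hyp_conic => // [v|]; first exact: vertex_hyp.
    by rewrite -/a -(mink_frame_coord _ _ ff) Fa; case: hFa.
  by rewrite /body halfspaces_hull; split=> //; exists (fun v => m * c' v).
Qed.

Lemma cvg_ereal0 (R : realType) (T : Type) (F : set_system T) {FF : Filter F} (f : T -> \bar R) :
  (forall t, (0 <= f t)%E) -> (forall e : R, 0 < e -> \forall t \near F, (f t <= e%:E)%E) ->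
  f t @[t --> F] --> 0%E.
Proof.
move=> f0 fe; apply/fine_cvgP; split.
  near=> t; apply: fin_real; apply/andP; split.
    by rewrite (lt_le_trans _ (f0 t)) // ltNy0.
  have h : (f t <= 1%:E)%E by near: t; apply: fe.
  by rewrite (le_lt_trans h) // ltry.
apply/cvgrPdist_le => e e0; near=> t; rewrite sub0r normrN.
have h : (f t <= e%:E)%E by near: t; apply: fe.
rewrite ger0_norm ?fine_ge0 //; rewrite -lee_fin fineK //.
apply: fin_real; apply/andP; split.
  by rewrite (lt_le_trans _ (f0 t)) // ltNy0.
by rewrite (le_lt_trans h) // ltry.
Unshelve. all: by end_near. Qed.

(** * Convergence of the prisms to the polygon *)

Lemma mink_inl_inr (R : realType) (n : nat) (P : prism R n) (b : bool) (i : 'I_n) (t : R) :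
  dihedral P (inl b) (inr i) = pi / 2 - t ->
  mink (normal P (inl b)) (normal P (inr i)) = - sin t.
Proof.
move=> h; rewrite (@dihedral_mink _ _ _ _ _ P (inl b) (inr i) (b, i) _ _ _ h) /=.
- by rewrite cosB cos_pihalf sin_pihalf mul0r mul1r add0r.
- by rewrite eqxx.
- by rewrite /polygon_inc eqxx.
Qed.

Theorem corollary1p4 (R : realType) (n : nat) (beta w w' : 'I_n -> R)
    (P : R -> prism R n) (Q : polygon R n)
    (hn : (3 <= n)%N)
    (hbeta : forall i, 0 < beta i <= pi / 2)
    (hsum : 2 * pi < \sum_(i < n) (pi - beta i))
    (hw : forall i, 0 < w i) (hw' : forall i, 0 < w' i)
    (hP : \forall t \near (0 : R)^'+,
      prism_angles (fun i => pi / 2 - w i * t) (fun i => pi / 2 - w' i * t)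
        beta (P t))
    (hQ : min_perimeter_polygon (fun i => w i + w' i) beta Q) :
  gh_dist (@hdist R 3) (body (P t)) (@hdist R 2) (body Q) @[t --> (0 : R)^'+]
    --> 0%E.
Proof.
pose W i := w i + w' i; have W0 i : 0 < W i by rewrite addr_gt0.
pose c i := cos (beta i).
have c01 i : 0 <= c i < 1 by rewrite cos_angle_ge0 // cos_angle_lt1.
have [l [q [g1 [g2 /= [l0 hq gfr [Cl suml] Qv]]]]] := polygon_normal_form hn hbeta W0 hQ.
pose A t i := sin (w i * t); pose A' t i := sin (w' i * t).
pose good t eta := [/\ 0 < eta,
  (forall i, -1 < proj_cos c (prism_tau (A t) (A' t) eta) (prism_eps (A t) (A' t) eta) i < 1),
  \sum_i acos (proj_cos c (prism_tau (A t) (A' t) eta) (prism_eps (A t) (A' t) eta) i) = 2 * pi &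
  exists p f1 f2 e, [/\ hyp p, lorentz_frame (frame4 p f1 f2 e) &
    forall b i, frame_coord (frame4 p f1 f2 e) (vertex (P t) (b, ordS i)) =
      klein_vertex c (prism_tau (A t) (A' t) eta) (prism_eps (A t) (A' t) eta) hn
        (prism_tilt eta b) i]].
have cwt (a : R) : a * t @[t --> (0 : R)^'+] --> (0 : R).
  apply: cvg_at_right_filter; rewrite -[X in _ --> X](mulr0 a).
  by apply: cvgM; [exact: cvg_cst|exact: cvg_id].
have csin (a : R) : sin (a * t) @[t --> (0 : R)^'+] --> (0 : R).
  by rewrite -[X in _ --> X]sin0; exact: (cvg_comp _ _ (cwt a) (@continuous_sin R 0)).
have sin_near (v : 'I_n -> R) : (forall i, 0 < v i) ->
    \forall t \near (0 : R)^'+, forall i, 0 <= sin (v i * t).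
  move=> v0; apply: (@filter_forall R _ (fun i t => 0 <= sin (v i * t)) (0 : R)^'+ _) => i.
  near=> t; apply: sin_ge0_pi; apply/andP; split.
    by rewrite mulr_ge0 ?(ltW (v0 i)) // ltW //; near: t; exact: nbhs_right_gt.
  by apply: ltW; near: t; exact: (cvgr_lt _ (cwt (v i)) _ (pi_gt0 R)).
have nA : \forall t \near (0 : R)^'+, forall i, 0 <= A t i by exact: sin_near.
have nA' : \forall t \near (0 : R)^'+, forall i, 0 <= A' t i by exact: sin_near.
have [dl [dl0 dl1 cdl]] : exists dl : R, [/\ 0 < dl, dl < 1 & forall i, c (ordS i) + 2 * dl < 1].
  have h : \forall dl \near (0 : R)^'+, [/\ 0 < dl, dl < 1 & forall i, c (ordS i) + 2 * dl < 1].
    near=> dl; split.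
    - by near: dl; exact: nbhs_right_gt.
    - by near: dl; exact: nbhs_right_lt.
    near: dl; apply: (@filter_forall R _ (fun i dl => c (ordS i) + 2 * dl < 1) (0 : R)^'+ _) => i.
    near=> dl; rewrite -ltrBrDl; near: dl; apply: (cvgr_lt _ (cwt 2)).
    by rewrite subr_gt0; have /andP[] := c01 (ordS i).
  exact: (filter_ex h).
have cAA i : A t i - A' t i @[t --> (0 : R)^'+] --> (0 : R).
  by rewrite -[X in _ --> X]subr0; exact: (cvgB (csin (w i)) (csin (w' i))).
have AA : \forall t \near (0 : R)^'+, forall i, (A t i - A' t i) ^+ 2 <= 4 * dl.
  apply: (@filter_forall R _ (fun i t => (A t i - A' t i) ^+ 2 <= 4 * dl) (0 : R)^'+ _) => i.
  have h : (A t i - A' t i) ^+ 2 @[t --> (0 : R)^'+] --> (0 : R).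
    by rewrite -[X in _ --> X](mulr0 0); exact: (cvgM (@cAA i) (@cAA i)).
  have dl4 : 0 < 4 * dl by rewrite mulr_gt0.
  by near=> t; apply: ltW; near: t; exact: (cvgr_lt _ h _ dl4).
have thW i : (A t i + A' t i) / t @[t --> (0 : R)^'+] --> W i.
  have ds (a : R) : is_derive (0 : R) 1 (fun t => sin (a * t)) a.
    have h := is_derive1_comp (is_derive_sin (a * 0)) (is_derive_funZ a (is_derive_fun_id 0)).
    by apply: (is_derive_eq h); rewrite mulr0 cos0 mul1r mulr1.
  have dq := is_derive_quotient (is_derive_funD (ds (w i)) (ds (w' i))).
  have : t^-1 * (A t i + A' t i) @[t --> (0 : R)^'] --> W i.
    move: dq; rewrite !mulr0 sin0 addr0; under eq_fun do rewrite addr0 subr0.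
    by [].
  move=> dq'; under eq_fun do rewrite mulrC.
  apply: cvg_trans dq'; apply: cvg_app => U [d d0 Ud]; exists d => // t td t0.
  by apply: Ud => //; exact: lt0r_neq0.
have ex : \forall t \near (0 : R)^'+, exists eta, good t eta.
  near=> t.
  have [a1 a2 a3] : prism_angles (fun i => pi / 2 - w i * t) (fun i => pi / 2 - w' i * t) beta (P t).
    by near: t.
  have t1 : forall i, 0 <= A t i by near: t.
  have t2 : forall i, 0 <= A' t i by near: t.
  have t3 : forall i, (A t i - A' t i) ^+ 2 <= 4 * dl by near: t.
  have hA i := mink_inl_inr (a1 i); have hA' i := mink_inl_inr (a2 i).
  have uS i : mink (normal (P t) (inr i)) (normal (P t) (inr (ordS i))) = - c (ordS i).
    by apply: (@dihedral_mink _ _ _ _ _ (P t) _ _ (true, ordS i)) => //;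
      rewrite /= /polygon_inc eqxx ?orbT.
  have [eta [p [f1 [f2 [e [e0 hp fr [C1 s1] v1]]]]]] :=
    prism_normal_form hn t1 t2 hA hA' uS t3 cdl dl1.
  by exists eta; split=> //; exists p, f1, f2, e.
(* To have a limit, [eta] must be a function of [t]; it is 0 where no suitable value exists, which
   does not happen for small [t > 0]. *)
have /choice [eta etaP] : forall t, exists eta, (exists eta', good t eta') -> good t eta.
  move=> t; have [[eta h]|h] := pselect (exists eta, good t eta); first by exists eta.
  by exists 0.
have {}ex : \forall t \near (0 : R)^'+, good t (eta t).
  by near=> t; apply: etaP; near: t.
(* The product [r * th] is [tau]: the unknown scale is separated from a factor already known to tend
   to [W]. *)
pose r t := t / eta t; pose th t i := (A t i + A' t i) / t.
pose ep t i := prism_eps (A t) (A' t) (eta t) i.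
have tauE t : 0 < t -> prism_tau (A t) (A' t) (eta t) = (fun i => r t * th t i).
  move=> t0; apply/funext => i; rewrite /prism_tau /r /th.
  by rewrite [RHS]mulrC mulrA divfK // gt_eqF.
have del1 (x : R) : 1 <= Num.sqrt (4 + x ^+ 2).
  by rewrite -[leLHS]sqrtr1; apply: ler_wsqrtr; have := sqr_ge0 x; lra.
have del0 (x : R) : 0 < Num.sqrt (4 + x ^+ 2) by exact: lt_le_trans (del1 x).
(* The denominator is at least 1 whatever [eta] is, so [eps] tends to 0 before anything is known
   about the height. *)
have cep i : ep t i @[t --> (0 : R)^'+] --> (0 : R).
  apply/cvgrPdist_lt => e e0; near=> t; rewrite sub0r normrN normrM normfV (gtr0_norm (del0 _)).
  apply: (@le_lt_trans _ _ `|A t i - A' t i|).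
    by rewrite ler_pdivrMr // ler_peMr.
  rewrite -normrN -sub0r; near: t; move: e e0; apply/cvgrPdist_lt; exact: cAA.
have rpos : \forall t \near (0 : R)^'+, 0 < r t.
  near=> t; have [e0 _ _ _] : good t (eta t) by near: t.
  by rewrite divr_gt0 //; near: t; exact: nbhs_right_gt.
have rl : r t @[t --> (0 : R)^'+] --> l.
  apply: (@scale_cvg R n hn _ _ _ c W th ep) => //.
  - near=> t => i; have t0 : 0 < t by near: t; exact: nbhs_right_gt.
    have [_ C1 _ _] : good t (eta t) by near: t.
    have := C1 i; rewrite tauE // => /andP[h1 h2].
    by rewrite (ltW h1) (ltW h2).
  - near=> t; have t0 : 0 < t by near: t; exact: nbhs_right_gt.
    have [_ _ s1 _] : good t (eta t) by near: t.
    by rewrite -tauE.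
(* The collapse of the height is a consequence of the scale limit: [eta = t / r] with [r] tending to
   [l > 0]. *)
have ceta : eta t @[t --> (0 : R)^'+] --> (0 : R).
  have h : t * (r t)^-1 @[t --> (0 : R)^'+] --> (0 : R).
    rewrite -[X in _ --> X](mul0r l^-1); apply: cvgM; last by apply: cvgV rl; rewrite gt_eqF.
    by apply: cvg_at_right_filter; exact: cvg_id.
  apply: cvg_trans h; apply: near_eq_cvg; near=> t.
  have t0 : 0 < t by near: t; exact: nbhs_right_gt.
  by rewrite /r invf_div mulrC divfK // gt_eqF.
have ctilt b : prism_tilt (eta t) b @[t --> (0 : R)^'+] --> (0 : R).
  apply/cvgrPdist_lt => e e0; near=> t; rewrite sub0r normrN normrM normfV (gtr0_norm (del0 _)).
  have -> : `|if b then eta t else - eta t| = `|eta t| by case: b; rewrite ?normrN.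
  apply: (@le_lt_trans _ _ `|eta t|); first by rewrite ler_pdivrMr // ler_peMr.
  rewrite -normrN -sub0r; near: t; move: e e0; apply/cvgrPdist_lt; exact: ceta.
have ctau i : prism_tau (A t) (A' t) (eta t) i @[t --> (0 : R)^'+] --> l * W i.
  have h : r t * th t i @[t --> (0 : R)^'+] --> l * W i by exact: (cvgM rl (@thW i)).
  apply: cvg_trans h; apply: near_eq_cvg; near=> t.
  by rewrite tauE //; near: t; exact: nbhs_right_gt.
(* [klein_vertex] at [i] describes the vertex [i + 1], hence the predecessor. *)
pose Xt t (v : bool * 'I_n) := klein_vertex c (prism_tau (A t) (A' t) (eta t))
  (prism_eps (A t) (A' t) (eta t)) hn (prism_tilt (eta t) v.1) (ord_pred v.2).
pose Y (v : bool * 'I_n) := klein_vertex c (fun i => l * W i) (fun=> 0) hn 0 (ord_pred v.2).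
have XtY v : row_cvg (0 : R)^'+ (Xt ^~ v) (Y v).
  have [D0 G0 _] := Qv (ord_pred v.2).
  apply: cvg_klein_vertex => //.
  - by move=> i; apply: proj_norm_gt0; rewrite expr0n.
  - by rewrite gt_eqF.
have YE v : frame_coord (frame4 q g1 g2 pole) (emb (vertex Q v.2)) = Y v.
  by have [_ _] := Qv (ord_pred v.2); rewrite ord_predK.
have YY1 v v' : 1 <= - mink (Y v) (Y v').
  by rewrite -!YE; apply: hyp_mink_ge1; apply: hyp_frame_coord => //;
    apply: hyp_emb; exact: vertex_hyp.
apply: cvg_ereal0 => [t|e e0]; first exact: gh_dist_ge0.
have [d /andP[d0 d1] small] := arcosh_ratio_small e0.
(* The limit entries are at least 1, so [a < b] leaves room for the error of convergence. Used with
   one factor equal to 1, it yields all four Gram comparisons. *)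
have gram (f g : R -> (bool * 'I_n)%type * (bool * 'I_n)%type -> R) (a b : R) :
    (forall vw, f t vw @[t --> (0 : R)^'+] --> - mink (Y vw.1) (Y vw.2)) ->
    (forall vw, g t vw @[t --> (0 : R)^'+] --> - mink (Y vw.1) (Y vw.2)) ->
    a < b -> \forall t \near (0 : R)^'+, forall vw, a * f t vw <= b * g t vw.
  move=> cf cg ab.
  apply: (@filter_forall R _ (fun vw t => a * f t vw <= b * g t vw) (0 : R)^'+ _) => vw.
  have h : b * g t vw - a * f t vw @[t --> (0 : R)^'+] -->
      b * - mink (Y vw.1) (Y vw.2) - a * - mink (Y vw.1) (Y vw.2).
    by apply: cvgB; apply: cvgM; by [exact: cvg_cst|exact: cf|exact: cg].
  have h0 : 0 < b * - mink (Y vw.1) (Y vw.2) - a * - mink (Y vw.1) (Y vw.2).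
    by rewrite -mulrBl mulr_gt0 ?subr_gt0 // (lt_le_trans ltr01).
  near=> t; rewrite -subr_ge0; apply: ltW; near: t.
  exact: (cvgr_gt _ h _ h0).
have cXX vw : - mink (Xt t vw.1) (Xt t vw.2) @[t --> (0 : R)^'+] --> - mink (Y vw.1) (Y vw.2).
  by apply: cvgN; apply: cvg_mink; exact: XtY.
have cXY vw : - mink (Xt t vw.1) (Y vw.2) @[t --> (0 : R)^'+] --> - mink (Y vw.1) (Y vw.2).
  by apply: cvgN; apply: cvg_mink; [exact: XtY|exact: row_cvg_cst].
have cYX vw : - mink (Y vw.1) (Xt t vw.2) @[t --> (0 : R)^'+] --> - mink (Y vw.1) (Y vw.2).
  by apply: cvgN; apply: cvg_mink; [exact: row_cvg_cst|exact: XtY].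
have cYY (vw : (bool * 'I_n)%type * (bool * 'I_n)%type) :
    - mink (Y vw.1) (Y vw.2) @[t --> (0 : R)^'+] --> - mink (Y vw.1) (Y vw.2) by exact: cvg_cst.
have lt1 : 1 < 1 + d by rewrite ltrDl.
have gt1 : 1 - d < 1 by rewrite ltrBlDr ltrDl.
have h1 := gram _ _ _ _ cXY cXX lt1; have h2 := gram _ _ _ _ cXX cYY gt1.
have h3 := gram _ _ _ _ cYX cYY lt1; have h4 := gram _ _ _ _ cYY cXX gt1.
near=> t.
have [_ _ _ [p [f1 [f2 [e' [hp fr Pv]]]]]] : good t (eta t) by near: t.
have XE v : frame_coord (frame4 p f1 f2 e') (vertex (P t) v) = Xt t v.
  by case: v => b i; rewrite /Xt -Pv ord_predK.
have k1 : forall vw, 1 * - mink (Xt t vw.1) (Y vw.2) <= (1 + d) * - mink (Xt t vw.1) (Xt t vw.2).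
  by near: t.
have k2 : forall vw, (1 - d) * - mink (Xt t vw.1) (Xt t vw.2) <= 1 * - mink (Y vw.1) (Y vw.2).
  by near: t.
have k3 : forall vw, 1 * - mink (Y vw.1) (Xt t vw.2) <= (1 + d) * - mink (Y vw.1) (Y vw.2).
  by near: t.
have k4 : forall vw, (1 - d) * - mink (Y vw.1) (Y vw.2) <= 1 * - mink (Xt t vw.1) (Xt t vw.2).
  by near: t.
apply: (@gh_dist_prism_polygon _ _ (P t) Q (frame4 p f1 f2 e') (frame4 q g1 g2 pole) d) => //.
- by rewrite d0 d1.
- by move=> v v'; rewrite !XE YE -[leLHS]mul1r; exact: (k1 (v, v')).
- by move=> v v'; rewrite !XE !YE -[leRHS]mul1r; exact: (k2 (v, v')).
- by move=> v v'; rewrite !XE !YE -[leLHS]mul1r; exact: (k3 (v, v')).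
- by move=> v v'; rewrite !XE !YE -[leRHS]mul1r; exact: (k4 (v, v')).
Unshelve. all: by end_near. Qed.
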